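(* Let $\mathsf{G}$ be a finite simple graph, and let $A=E/I$ be the Orlik-Solomon algebra of the graphic arrangement $\mathcal{A}_{\mathsf{G}}$. Then, for all $i\ge2$, $$b'_{i,i+1}=i(\kappa_2+\kappa_3).$$
   Context: $\Bbbk$ is a field of characteristic $0$. For a simple graph $\mathsf{G}$ on vertices $1,\dots,\ell$ with edge set $\mathsf{E}$, the graphic arrangement is $\mathcal{A}_{\mathsf{G}}=\{z_i-z_j=0\mid (i,j)\in\mathsf{E}\}$ in $\mathbb{C}^\ell$. For $r\ge1$, $\kappa_{r-1}$ is the number of subgraphs of $\mathsf{G}$ isomorphic to the complete graph $K_r$ on $r$ vertices (so $\kappa_2$ counts triangles and $\kappa_3$ counts copies of $K_4$). For a finite central arrangement $\{H_1,\dots,H_n\}$, let $E$ be the exterior algebra over $\Bbbk$ on degree-one generators $e_1,\dots,e_n$, with derivation $\partial$ given by $\partial(e_i)=1$ and the graded Leibniz rule, and $e_J=e_{i_1}\wedge\cdots\wedge e_{i_r}$ for $J=\{i_1<\dots<i_r\}$. The Orlik-Solomon ideal $I\subset E$ is generated by all $\partial e_J$ with $\operatorname{codim}\bigcap_{i\in J}H_i<|J|$; the Orlik-Solomon algebra is $A=E/I$, graded by degree. The graded Betti numbers are $b'_{ij}=\dim_\Bbbk\operatorname{Tor}_i^E(A,\Bbbk)_j$ ($j$ is the internal degree). *)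

(* Defs.v *)
From HB Require Import structures.
From mathcomp Require Import all_boot all_order all_algebra.
From mathcomp Require Import reals complex.

Set Implicit Arguments.
Unset Strict Implicit.
Unset Printing Implicit Defensive.

Import Order.TTheory GRing.Theory Num.Theory.
Local Open Scope ring_scope.

(* The exterior algebra on e_0, ..., e_(n-1), in coordinates: x S is the
   coefficient of x on the monomial e_S, the increasing product of the e_i,
   i in S (lemma extb_prod). *)
Definition extalg (k : fieldType) (n : nat) : Type := {ffun {set 'I_n} -> k^o}.

Section ExteriorAlgebra.

Variables (k : fieldType) (n : nat).

HB.instance Definition _ := Vector.copy (extalg k n) {ffun {set 'I_n} -> k^o}.

Implicit Types (x y z : extalg k n) (S T U : {set 'I_n}).

Definition extb S : extalg k n := [ffun T => (T == S)%:R].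

(* e_S e_T = wedge_coef S T *: e_(S :|: T), the sign being that of the shuffle
   sorting the concatenation of S and T. *)
Definition inversions S T : nat :=
  #|[set p : 'I_n * 'I_n | [&& p.1 \in S, p.2 \in T & (p.2 < p.1)%N]]|.

Definition wedge_coef S T : k :=
  if [disjoint S & T] then (-1) ^+ inversions S T else 0.

Definition ext_mul x y : extalg k n :=
  \sum_S \sum_T (x S * y T * wedge_coef S T) *: extb (S :|: T).

Lemma extE x : x = \sum_S x S *: extb S.
Proof.
apply/ffunP=> T; rewrite sum_ffunE (bigD1 T) //= big1 ?addr0.
  by rewrite !ffunE eqxx /GRing.scale /= mulr1.
move=> S; rewrite !ffunE eq_sym => /negPf ->.
by rewrite /GRing.scale /= mulr0.
Qed.

Lemma ext_mul_linl y : linear (ext_mul^~ y).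
Proof.
move=> a u v; rewrite /ext_mul scaler_sumr -big_split; apply: eq_bigr => S _ /=.
rewrite scaler_sumr -big_split; apply: eq_bigr => T _ /=.
by rewrite scalerA -scalerDl !ffunE /GRing.scale /= !mulrDl !mulrA.
Qed.

Lemma ext_mul_linr x : linear (ext_mul x).
Proof.
move=> a u v; rewrite /ext_mul scaler_sumr -big_split; apply: eq_bigr => S _ /=.
rewrite scaler_sumr -big_split; apply: eq_bigr => T _ /=.
rewrite scalerA -scalerDl !ffunE /GRing.scale /= mulrDr mulrDl.
by rewrite !mulrA [x S * a]mulrC.
Qed.

Lemma ext_mulb S T : ext_mul (extb S) (extb T) = wedge_coef S T *: extb (S :|: T).
Proof.
rewrite /ext_mul (bigD1 S) //= [X in _ + X]big1 ?addr0; last first.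
  move=> S' /negPf nS; apply: big1 => T' _; rewrite !ffunE nS.
  by rewrite !mul0r scale0r.
rewrite (bigD1 T) //= [X in _ + X]big1 ?addr0 ?ffunE ?eqxx ?mul1r //.
by move=> T' /negPf nT; rewrite !ffunE nT mulr0 mul0r scale0r.
Qed.

Lemma inversionsUl S T U : [disjoint S & T] ->
  inversions (S :|: T) U = (inversions S U + inversions T U)%N.
Proof.
move=> dST; rewrite /inversions -cardsUI.
rewrite [X in (_ + X)%N](_ : _ = 0)%N ?addn0.
  by apply: eq_card => p; rewrite !inE; case: (p.1 \in S); case: (p.1 \in T);
    case: (p.2 \in U); case: (p.2 < p.1)%N.
apply/eqP; rewrite cards_eq0; apply/eqP/setP=> p; rewrite !inE.
by case: (boolP (p.1 \in S)) => [/(disjointFr dST) ->|]; rewrite ?andbF.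
Qed.

Lemma inversionsUr S T U : [disjoint T & U] ->
  inversions S (T :|: U) = (inversions S T + inversions S U)%N.
Proof.
move=> dTU; rewrite /inversions -cardsUI.
rewrite [X in (_ + X)%N](_ : _ = 0)%N ?addn0.
  by apply: eq_card => p; rewrite !inE; case: (p.1 \in S); case: (p.2 \in T);
    case: (p.2 \in U); case: (p.2 < p.1)%N.
apply/eqP; rewrite cards_eq0; apply/eqP/setP=> p; rewrite !inE.
by case: (boolP (p.2 \in T)) => [/(disjointFr dTU) ->|]; rewrite ?andbF.
Qed.

Lemma wedge_coefA S T U :
  wedge_coef T U * wedge_coef S (T :|: U) = wedge_coef S T * wedge_coef (S :|: T) U.
Proof.
have dUr : [disjoint S & T :|: U] = [disjoint S & T] && [disjoint S & U].
  by rewrite -!setI_eq0 setIUr setU_eq0.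
have dUl : [disjoint S :|: T & U] = [disjoint S & U] && [disjoint T & U].
  by rewrite -!setI_eq0 setIUl setU_eq0.
rewrite /wedge_coef dUr dUl.
case: (boolP [disjoint S & T]) => dST; case: (boolP [disjoint T & U]) => dTU;
  rewrite /= ?andbF ?mulr0 ?mul0r //=; rewrite andbT; case: ifP => dSU; rewrite ?mulr0 //.
by rewrite -!exprD inversionsUl // inversionsUr //; congr (_ ^+ _); rewrite addnC -addnA.
Qed.

Lemma ext_mulDl : left_distributive ext_mul +%R.
Proof. by move=> x y z; have := ext_mul_linl z 1 x y; rewrite !scale1r. Qed.

Lemma ext_mulDr : right_distributive ext_mul +%R.
Proof. by move=> x y z; have := ext_mul_linr x 1 y z; rewrite !scale1r. Qed.

Lemma ext_mul0l y : ext_mul 0 y = 0.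
Proof. by apply: (@addrI _ (ext_mul 0 y)); rewrite -ext_mulDl !addr0. Qed.

Lemma ext_mul0r x : ext_mul x 0 = 0.
Proof. by apply: (@addrI _ (ext_mul x 0)); rewrite -ext_mulDr !addr0. Qed.

Lemma ext_mulZl (a : k) x y : ext_mul (a *: x) y = a *: ext_mul x y.
Proof. by have := ext_mul_linl y a x 0; rewrite ext_mul0l !addr0. Qed.

Lemma ext_mulZr (a : k) x y : ext_mul x (a *: y) = a *: ext_mul x y.
Proof. by have := ext_mul_linr x a y 0; rewrite ext_mul0r !addr0. Qed.

Lemma ext_mul_suml (I : finType) (F : I -> extalg k n) y :
  ext_mul (\sum_i F i) y = \sum_i ext_mul (F i) y.
Proof.
exact: (big_morph (ext_mul^~ y) (fun u v => ext_mulDl u v y) (ext_mul0l y)).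
Qed.

Lemma ext_mul_sumr (I : finType) (F : I -> extalg k n) x :
  ext_mul x (\sum_i F i) = \sum_i ext_mul x (F i).
Proof. exact: (big_morph (ext_mul x) (ext_mulDr x) (ext_mul0r x)). Qed.

Lemma wedge_coef0l T : wedge_coef set0 T = 1.
Proof.
rewrite /wedge_coef -setI_eq0 set0I eqxx /inversions.
by rewrite (_ : [set p | _] = set0) ?cards0 //; apply/setP=> p; rewrite !inE.
Qed.

Lemma wedge_coef0r S : wedge_coef S set0 = 1.
Proof.
rewrite /wedge_coef -setI_eq0 setI0 eqxx /inversions.
by rewrite (_ : [set p | _] = set0) ?cards0 //; apply/setP=> p; rewrite !inE andbF.
Qed.

Lemma ext_mulA : associative ext_mul.
Proof.
move=> x y z.
rewrite [x]extE (ext_mul_suml _ (ext_mul y z)) (ext_mul_suml _ y) (ext_mul_suml _ z).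
apply: eq_bigr => S _.
rewrite (ext_mulZl _ _ (ext_mul y z)) (ext_mulZl _ _ y) (ext_mulZl _ _ z); congr (_ *: _).
rewrite [y]extE (ext_mul_suml _ z) 2!(ext_mul_sumr _ (extb S)) (ext_mul_suml _ z).
apply: eq_bigr => T _.
rewrite (ext_mulZl _ _ z) 2!(ext_mulZr _ (extb S)) (ext_mulZl _ _ z); congr (_ *: _).
rewrite [z]extE (ext_mul_sumr _ (extb T)) (ext_mul_sumr _ (extb S)).
rewrite (ext_mul_sumr _ (ext_mul _ _)); apply: eq_bigr => U _.
rewrite (ext_mulZr _ (extb T)) (ext_mulZr _ (extb S)) (ext_mulZr _ (ext_mul _ _)).
congr (_ *: _); rewrite !ext_mulb ext_mulZr ext_mulZl !ext_mulb !scalerA.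
by rewrite setUA wedge_coefA.
Qed.

Lemma ext_mul1 : left_id (extb set0) ext_mul.
Proof.
move=> x; rewrite {1}[x]extE ext_mul_sumr [RHS]extE /=.
by apply: eq_bigr => S _; rewrite ext_mulZr ext_mulb wedge_coef0l set0U scale1r.
Qed.

Lemma ext_mulr1 : right_id (extb set0) ext_mul.
Proof.
move=> x; rewrite {1}[x]extE ext_mul_suml [RHS]extE /=.
by apply: eq_bigr => S _; rewrite ext_mulZl ext_mulb wedge_coef0r setU0 scale1r.
Qed.

Lemma ext1_neq0 : extb set0 != 0.
Proof.
apply/eqP=> /ffunP /(_ set0); rewrite !ffunE eqxx => /eqP.
by rewrite (oner_eq0 k).
Qed.

HB.instance Definition _ := GRing.Zmodule_isNzRing.Build (extalg k n)
  ext_mulA ext_mul1 ext_mulr1 ext_mulDl ext_mulDr ext1_neq0.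

Lemma ext_scaleAl (a : k) x y : a *: (x * y) = (a *: x) * y.
Proof. by rewrite -[RHS]/(ext_mul _ _) ext_mulZl. Qed.

Lemma ext_scaleAr (a : k) x y : a *: (x * y) = x * (a *: y).
Proof. by rewrite -[RHS]/(ext_mul _ _) ext_mulZr. Qed.

HB.instance Definition _ :=
  GRing.Lmodule_isLalgebra.Build k (extalg k n) ext_scaleAl.
HB.instance Definition _ :=
  GRing.Lalgebra_isAlgebra.Build k (extalg k n) ext_scaleAr.

Lemma extb0 : extb set0 = 1. Proof. by []. Qed.

Lemma extbM S T : extb S * extb T = wedge_coef S T *: extb (S :|: T).
Proof. exact: ext_mulb. Qed.

Definition ext_gen (i : 'I_n) : extalg k n := extb [set i].

(* The derivation of degree -1 mapping every ext_gen i to 1; see ext_d_gen and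
   the graded Leibniz rule ext_dM. *)
Definition ext_d x : extalg k n :=
  \sum_S x S *:
    \sum_(i in S) (-1) ^+ #|[set j in S | (j < i)%N]| *: extb (S :\ i).

Definition ext_homog (m : int) x := forall S, x S != 0 -> #|S|%:Z = m.

(* The augmentation E -> k, which kills the generators. *)
Definition ext_aug x : k := x set0.

End ExteriorAlgebra.

Lemma leibniz_step (R : pzRingType) (g d p y dy : R) m :
  p * y - g * (d * y + (-1) ^+ m * (p * dy)) =
  (p - g * d) * y + (-1) ^+ m.+1 * (g * p * dy).
Proof.
rewrite mulrBl mulrDr opprD addrA exprS mulN1r mulNr !mulrA; congr (_ - _).
by congr (_ * _ * _); apply: commr_sign.
Qed.

Section ExteriorAlgebraFacts.

Variables (k : fieldType) (n : nat).
Implicit Types (x y z : extalg k n) (S T U : {set 'I_n}).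

Lemma ext_mulE x y U : (x * y) U =
  \sum_S \sum_T x S * y T * wedge_coef k S T * (U == S :|: T)%:R.
Proof.
rewrite -[x * y]/(ext_mul x y) /ext_mul sum_ffunE; apply: eq_bigr => S _.
by rewrite sum_ffunE; apply: eq_bigr => T _; rewrite !ffunE.
Qed.

Lemma extb_prod S : extb k S = \prod_(i in S) ext_gen k i.
Proof.
suff gen (s : seq 'I_n) : sorted (fun i j : 'I_n => (i < j)%N) s ->
    extb k [set i in s] = \prod_(i <- s) ext_gen k i.
  rewrite -big_filter -gen; first by congr (extb _ _);
    apply/setP=> i; rewrite inE mem_filter mem_index_enum andbT.
  rewrite [index_enum _]unlock -enumT; apply: sorted_filter;
    first by move=> ? ? ?; apply: ltn_trans.
  by have := iota_ltn_sorted 0 n; rewrite -val_enum_ord sorted_map.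
elim: s => [|a s IHs] sas.
  by rewrite big_nil -extb0; congr (extb _ _); apply/setP=> i; rewrite !inE.
rewrite big_cons -IHs ?(path_sorted sas) // extbM.
have lta : forall b, b \in s -> (a < b)%N.
  by apply/allP; apply: order_path_min sas => ? ? ?; apply: ltn_trans.
rewrite /wedge_coef disjoints1 inE; case: ifP => [_|/negbT/negPn as_]; last first.
  by have := lta _ as_; rewrite ltnn.
rewrite /inversions (_ : [set p : 'I_n * 'I_n | _] = set0) ?cards0 ?expr0 ?scale1r.
  by congr (extb _ _); apply/setP=> i; rewrite !inE.
apply/setP=> -[p q]; rewrite !inE /=; apply/negP=> /and3P[/eqP-> /lta aq].
by rewrite ltnNge (ltnW aq).
Qed.

Lemma ext_dD x y : ext_d (x + y) = ext_d x + ext_d y.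
Proof.
by rewrite /ext_d -big_split; apply: eq_bigr => S _ /=; rewrite !ffunE scalerDl.
Qed.

Lemma ext_dZ (a : k) x : ext_d (a *: x) = a *: ext_d x.
Proof.
rewrite /ext_d scaler_sumr; apply: eq_bigr => S _ /=.
by rewrite !ffunE scalerA.
Qed.

Lemma ext_db S : ext_d (extb k S) =
    \sum_(i in S) (-1) ^+ #|[set j in S | (j < i)%N]| *: extb k (S :\ i).
Proof.
rewrite /ext_d (bigD1 S) //= [X in _ + X]big1 ?addr0 ?ffunE ?eqxx ?scale1r //.
by move=> T /negPf nT; rewrite ffunE nT scale0r.
Qed.

Lemma ext_d_gen (i : 'I_n) : ext_d (ext_gen k i) = 1.
Proof.
rewrite ext_db big_set1 setDv (_ : [set j in _ | _] = set0) ?cards0 ?expr0 ?scale1r //.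
by apply/setP=> j; rewrite !inE; case: eqP => // ->; rewrite ltnn.
Qed.

Lemma ext_aug1 : ext_aug (1 : extalg k n) = 1.
Proof. by rewrite /ext_aug -extb0 ffunE eqxx. Qed.

Lemma ext_augM x y : ext_aug (x * y) = ext_aug x * ext_aug y.
Proof.
rewrite /ext_aug ext_mulE (bigD1 set0) //= [X in _ + X]big1 ?addr0.
  rewrite (bigD1 set0) //= [X in _ + X]big1 ?addr0.
    by rewrite wedge_coef0l setU0 eqxx !mulr1.
  by move=> T /negPf nT; rewrite set0U eq_sym nT mulr0.
move=> S /negPf nS; apply: big1 => T _.
by rewrite eq_sym setU_eq0 nS mulr0.
Qed.

Lemma wedge_coef1 (i : 'I_n) T : wedge_coef k [set i] T =
  if i \in T then 0 else (-1) ^+ #|[set j in T | (j < i)%N]|.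
Proof.
rewrite /wedge_coef disjoints1; case: (i \in T) => //=; congr (_ ^+ _).
rewrite /inversions -[RHS](card_imset _ (_ : injective (pair i))); last by move=> ? ? [].
apply: eq_card => -[p q]; rewrite !inE /=; apply/and3P/imsetP => [[/eqP-> qT qi]|[t]].
  by exists q => //; rewrite inE qT.
by rewrite inE => /andP[tT ti] [-> ->]; rewrite eqxx.
Qed.

Lemma ext_d0 : ext_d (0 : extalg k n) = 0.
Proof. by have := ext_dZ 0 (0 : extalg k n); rewrite !scale0r. Qed.

Lemma ext_d_sum (J : finType) (F : J -> extalg k n) :
  ext_d (\sum_j F j) = \sum_j ext_d (F j).
Proof. exact: (big_morph _ ext_dD ext_d0). Qed.

Lemma ext_d_genM (i : 'I_n) y :
  ext_d (ext_gen k i * y) = y - ext_gen k i * ext_d y.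
Proof.
rewrite [y]extE mulr_sumr !ext_d_sum mulr_sumr -sumrB; apply: eq_bigr => T _.
rewrite -ext_scaleAr !ext_dZ -ext_scaleAr -scalerBr; congr (_ *: _).
rewrite extbM wedge_coef1 ext_dZ !ext_db mulr_sumr.
pose pos T (i : 'I_n) := #|[set j in T | (j < i)%N]|.
rewrite -/(pos T i).
have posD (j a : 'I_n) : a \in T -> pos T j = ((a < j) + pos (T :\ a) j)%N.
  move=> aT; rewrite /pos (cardsD1 a [set _ in T | _]) inE aT; congr (_ + _)%N.
  by apply: eq_card => t; rewrite !inE andbA.
case: (boolP (i \in T)) => iT.
  rewrite scale0r (bigD1 i) //= [\sum_(_ in _ | _) _]big1 ?addr0; last first.
    move=> j /andP[jT ji]; rewrite -ext_scaleAr extbM wedge_coef1 !inE.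
    by rewrite eq_sym ji iT scale0r scaler0.
  rewrite -ext_scaleAr extbM wedge_coef1 !inE eqxx /= scalerA -!/(pos _ _).
  by rewrite (posD i i) // ltnn -expr2 sqrr_sign scale1r setD1K // subrr.
rewrite (big_setD1 i (setU11 i T)) /= scalerDr scalerA -!/(pos _ _).
have -> : pos ([set i] :|: T) i = pos T i.
  apply: eq_card => t; rewrite !inE; case: eqP => // ->; by rewrite ltnn (negPf iT).
have -> : ([set i] :|: T) :\ i = T by rewrite setU1K.
rewrite -expr2 sqrr_sign scale1r; congr (_ + _).
rewrite scaler_sumr -sumrN; apply: eq_bigr => j jT.
have ji : j != i by apply: contraNneq iT => <-.
rewrite -ext_scaleAr extbM wedge_coef1 !inE eq_sym (negPf ji) (negPf iT) /=.
rewrite !scalerA -scaleNr -!/(pos _ _).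
have -> : ([set i] :|: T) :\ j = [set i] :|: T :\ j.
  by apply/setP=> t; rewrite !inE; case: (t =P i) => // ->; rewrite eq_sym (negPf ji).
congr (_ *: _).
have -> : pos ([set i] :|: T) j = ((i < j) + pos T j)%N.
  rewrite /pos (cardsD1 i) !inE eqxx /=; congr (_ + _)%N; apply: eq_card => t.
  by rewrite !inE; case: (t =P i) => // ->; rewrite (negPf iT).
rewrite (posD i j) // -[RHS]mulN1r -!exprD -exprS; apply/eqP.
rewrite -[X in X == _]signr_odd -[X in _ == X]signr_odd !(oddD, oddS) /=.
by case: ltngtP ji => [ij|ij|/val_inj->]; rewrite ?eqxx //= => _;
  case: (odd (pos T j)); case: (odd (pos (T :\ j) i)).
Qed.

Lemma ext_dM (m : nat) x y : ext_homog m x ->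
  ext_d (x * y) = ext_d x * y + (-1) ^+ m * (x * ext_d y).
Proof.
move=> hx; rewrite [x]extE mulr_suml !ext_d_sum !mulr_suml mulr_sumr -big_split.
apply: eq_bigr => S _ /=; have [->|xS] := eqVneq (x S) 0.
  by rewrite scale0r !mul0r ext_d0 mul0r mulr0 addr0.
have [] := hx S xS; move: (x S) => c <- {x hx xS m}.
rewrite -!ext_scaleAl -ext_scaleAr !ext_dZ -ext_scaleAl -scalerDr; congr (_ *: _).
have cardE : #|S| = size [seq i <- index_enum 'I_n | i \in S].
  by rewrite -sum1_card -big_filter sum1_size.
have -> : extb k S = \prod_(i <- [seq i <- index_enum 'I_n | i \in S]) ext_gen k i.
  by rewrite big_filter extb_prod.
rewrite {}cardE; elim: {S} (filter _ _) => [|i s IHs].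
  by rewrite big_nil !mul1r -extb0 ext_db big_set0 mul0r add0r.
by rewrite big_cons /= -mulrA !ext_d_genM IHs leibniz_step.
Qed.

End ExteriorAlgebraFacts.

Section OrlikSolomon.

Variables (k : fieldType) (K : fieldType) (l n : nat).
Variable H : 'I_n -> {vspace 'rV[K]_l}.

Definition codim_cap (J : {set 'I_n}) : nat :=
  (l - \dim (\bigcap_(i in J) H i)%VS)%N.

Definition dependent (J : {set 'I_n}) : bool := (codim_cap J < #|J|)%N.

(* The two-sided ideal generated by the ext_d e_J, J dependent: the e_S span the
   algebra over k, so they suffice as multipliers. *)
Definition os_ideal : {vspace extalg k n} :=
  (\sum_(J | dependent J) \sum_S \sum_T
     <[extb k S * ext_d (extb k J) * extb k T]>)%VS.

End OrlikSolomon.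

Section Tor.

Variables (k : fieldType) (n : nat).

(* A sequence of graded free right modules of finite rank over E = extalg k n.
   Elements of the free right module E^r are column vectors, and a matrix acts
   on the left; the basis element a of the i-th term has degree gdeg a.
   Nothing here makes it a complex: see resolution. *)
Record grfree := GrFree {
  rk : nat -> nat;
  gdeg : forall i, 'I_(rk i) -> int;
  diff : forall i, 'M[extalg k n]_(rk i, rk i.+1);
  diff_homog : forall i a b, ext_homog (gdeg b - gdeg a) (diff i a b)
}.

Variables (I : {vspace extalg k n}) (F : grfree).

(* F is a graded free resolution of E / I; the map from F_0 onto E / I lifts to
   the row vector eps over E. *)
Definition resolution (eps : 'rV[extalg k n]_(rk F 0)) : Prop :=
  [/\ forall b, ext_homog (gdeg b) (eps 0 b),
      forall x, exists v : 'cV_(rk F 0), x - (eps *m v) 0 0 \in I,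
      forall v : 'cV_(rk F 0),
        (eps *m v) 0 0 \in I <-> exists w, v = diff F 0 *m w
    & forall i (v : 'cV_(rk F i.+1)),
        diff F i *m v = 0 <-> exists w, v = diff F i.+1 *m w].

(* The differentials of the complex F (x)_E k. *)
Definition diffk i : 'M[k]_(rk F i, rk F i.+1) :=
  map_mx (@ext_aug k n) (diff F i).

Definition cycles i : {vspace 'cV[k]_(rk F i)} :=
  match i with
  | 0 => fullv
  | i'.+1 => lker (linfun (mulmx (diffk i')))
  end.

Definition boundaries i : {vspace 'cV[k]_(rk F i)} :=
  limg (linfun (mulmx (diffk i))).

(* The part of degree j of F_i (x)_E k. *)
Definition piece i (j : int) : {vspace 'cV[k]_(rk F i)} :=
  (\sum_(a : 'I_(rk F i) | gdeg a == j) <[delta_mx a 0%R]>)%VS.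

(* dim_k Tor_i^E(E / I, k)_j when F is a graded free resolution of E / I; by
   boundaries_sub_cycles the subtraction does not truncate. *)
Definition tor_dim i (j : int) : nat :=
  (\dim (cycles i :&: piece i j) - \dim (boundaries i :&: piece i j))%N.

End Tor.

Section Graphs.

Variables (l : nat) (G : rel 'I_l).

Definition edges : {set 'I_l * 'I_l} :=
  [set p : 'I_l * 'I_l | (p.1 < p.2)%N && G p.1 p.2].

(* z_i = z_j, for p = (i, j); see mem_hyperplane. *)
Definition hyperplane (K : fieldType) (p : 'I_l * 'I_l) : {vspace 'rV[K]_l} :=
  lker (linfun (fun z : 'rV[K]_l => z 0 p.1 - z 0 p.2 : K^o)).

Definition graphic (K : fieldType) (e : 'I_#|edges|) : {vspace 'rV[K]_l} :=
  hyperplane K (enum_val e).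

(* A subgraph is a pair (vertex set, edge set), edges being written (i, j) with
   i < j as in edges. *)
Definition is_subgraph (X : {set 'I_l} * {set 'I_l * 'I_l}) : bool :=
  X.2 \subset edges :&: setX X.1 X.1.

Definition iso_complete (r : nat) (X : {set 'I_l} * {set 'I_l * 'I_l}) : bool :=
  [exists f : {ffun 'I_r -> 'I_l},
    [&& injectiveb f, f @: setT == X.1
      & [forall a, forall b,
          (((f a, f b) \in X.2) || ((f b, f a) \in X.2)) == (a != b)]]].

(* kappa s counts the copies of the complete graph on s + 1 vertices. *)
Definition kappa (s : nat) : nat :=
  #|[set X | is_subgraph X && iso_complete s.+1 X]|.

End Graphs.

Lemma mem_hyperplane l (K : fieldType) (p : 'I_l * 'I_l) (z : 'rV[K]_l) :
  (z \in hyperplane K p) = (z 0 p.1 == z 0 p.2).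
Proof.
pose f (z : 'rV[K]_l) : K^o := z 0 p.1 - z 0 p.2.
have lf : linear f.
  by move=> a u v; rewrite /f !mxE /GRing.scale /= mulrBr opprD addrACA.
pose fL := HB.pack_for {linear _ -> _} f (GRing.isLinear.Build K _ _ _ f lf).
by rewrite memv_ker -/f -[f]/(GRing.Linear.sort fL) lfunE subr_eq0.
Qed.

Section TorFacts.
Variables (k : fieldType) (n : nat).
Notation E := (extalg k n).
Implicit Types (x y z : E) (S T U : {set 'I_n}).

Lemma linfunE' (U V : vectType k) (f : U -> V) : linear f -> linfun f =1 f.
Proof.
move=> lf; pose fL := HB.pack_for {linear U -> V} f (GRing.isLinear.Build k _ _ _ f lf).
exact: (lfunE fL).
Qed.

Lemma mulmxk_linear r s (D : 'M[k]_(r, s)) : linear (mulmx D : 'cV_s -> 'cV_r).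
Proof. by move=> a u v; rewrite mulmxDr -scalemxAr. Qed.

Lemma boundaries_sub_cycles (I : {vspace E}) (F : grfree k n) eps i :
  resolution I (F := F) eps -> (boundaries F i <= cycles F i)%VS.
Proof.
case: i => [|i] [_ _ _ ex]; first exact: subvf.
apply/subvP=> _ /memv_imgP[w _ ->]; rewrite memv_ker !linfunE'; try exact: mulmxk_linear.
rewrite mulmxA; suff -> : diffk F i *m diffk F i.+1 = 0 by rewrite mul0mx.
have D0 : diff F i *m diff F i.+1 = 0.
  apply/matrixP=> a b.
  have /ex : exists w, col b (diff F i.+1) = diff F i.+1 *m w.
    by exists (delta_mx b 0); rewrite -colE.
  by rewrite colE mulmxA -colE => /colP/(_ a); rewrite !mxE.
apply/matrixP=> a b; have /matrixP/(_ a b) := D0; rewrite !mxE.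
move=> Dab; transitivity (ext_aug (\sum_j diff F i a j * diff F i.+1 j b)).
  rewrite [RHS]/ext_aug sum_ffunE; apply: eq_bigr => c _.
  by rewrite !mxE -[RHS]/(ext_aug _) ext_augM.
by rewrite Dab /ext_aug ffunE.
Qed.

End TorFacts.

(* Existence of graded free resolutions of finite rank (resolution_exists,
   os_resolution_exists): tor_dim is meaningful for every Orlik-Solomon ideal. *)
Module FreeResolution.

Section Construction.

Variables (k : fieldType) (n : nat).
Notation E := (extalg k n).
Implicit Types (x y z : E) (S T U : {set 'I_n}).

Definition pr (m : int) x : E :=
  [ffun S : {set 'I_n} => if #|S|%:Z == m then x S else 0].

Lemma pr_linear m : linear (pr m).
Proof.
move=> a u v; apply/ffunP=> S; rewrite !ffunE; case: ifP => // _.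
by rewrite scaler0 addr0.
Qed.

Lemma pr_homog m x : ext_homog m (pr m x).
Proof. by move=> S; rewrite ffunE; case: (_ =P m) => // _; rewrite eqxx. Qed.

Lemma homogM p q x y : ext_homog p x -> ext_homog q y -> ext_homog (p + q) (x * y).
Proof.
move=> hx hy U; rewrite ext_mulE => nz.
have [S nzS] : exists S, \sum_T x S * y T * wedge_coef k S T * (U == S :|: T)%:R != 0.
  apply/existsP; apply: contraNT nz; rewrite negb_exists => /forallP h.
  by apply/eqP/big1 => S _; apply/eqP; have := h S; rewrite negbK.
have [T] : exists T, x S * y T * wedge_coef k S T * (U == S :|: T)%:R != 0.
  apply/existsP; apply: contraNT nzS; rewrite negb_exists => /forallP h.
  by apply/eqP/big1 => T _; apply/eqP; have := h T; rewrite negbK.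
rewrite !mulf_eq0 !negb_or -!andbA => /and4P[/hx <- /hy <-].
rewrite /wedge_coef; case: ifP => [dST _|_]; last by rewrite eqxx.
case: (U =P _) => [-> _|_]; last by rewrite eqxx.
by rewrite cardsU (disjoint_setI0 dST) cards0 subn0 PoszD.
Qed.

Lemma pr_id p x : ext_homog p x -> pr p x = x.
Proof.
move=> hx; apply/ffunP=> S; rewrite ffunE; case: eqP => // nS.
by apply/eqP; rewrite eq_sym; apply/negPn/negP => /hx.
Qed.

Lemma pr_0 p q x : ext_homog p x -> p != q -> pr q x = 0.
Proof.
move=> hx pq; apply/ffunP=> S; rewrite !ffunE; case: eqP => // Sq.
by apply/eqP/negPn/negP => /hx Sp; rewrite -Sp Sq eqxx in pq.
Qed.

Lemma homog_sum (J : finType) (P : pred J) p (f : J -> E) :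
  (forall j, P j -> ext_homog p (f j)) -> ext_homog p (\sum_(j | P j) f j).
Proof.
move=> hf; elim/big_ind: _ => [S|x y hx hy S|//]; first by rewrite ffunE eqxx.
rewrite ffunE; have [->|/hx//] := eqVneq (x S) 0.
by rewrite add0r => /hy.
Qed.

Lemma homogZ p (c : k) x : ext_homog p x -> ext_homog p (c *: x).
Proof. by move=> hx S; rewrite ffunE mulf_eq0 negb_or => /andP[_ /hx]. Qed.

Lemma homogb S : ext_homog #|S| (extb k S).
Proof. by move=> T; rewrite ffunE; case: (T =P S) => [->//|_]; rewrite eqxx. Qed.

Definition degs : seq int := [seq #|V|%:Z | V : {set 'I_n}].

Lemma sum_pr (s : seq int) x : uniq s ->
  (forall S, x S != 0 -> #|S|%:Z \in s) -> x = \sum_(m <- s) pr m x.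
Proof.
move=> us hs; apply/ffunP=> S; rewrite sum_ffunE.
under eq_bigr do rewrite ffunE eq_sym.
rewrite -big_mkcond; have [x0|x0] := eqVneq (x S) 0; first by rewrite x0 big1.
by rewrite -big_filter (perm_big [:: #|S|%:Z]) ?big_seq1 //; apply: uniq_perm;
   rewrite ?filter_uniq // => m; rewrite mem_filter inE andbC;
   case: eqP => [->|]; rewrite ?hs ?andbF.
Qed.

Lemma prM p m x y : ext_homog p x -> pr m (x * y) = x * pr (m - p) y.
Proof.
move=> hx; rewrite {1}(@sum_pr (undup degs) y) ?undup_uniq; last first.
- by move=> S _; rewrite mem_undup; apply: image_f.
- by [].
have prsum s (f : int -> E) : pr m (\sum_(j <- s) f j) = \sum_(j <- s) pr m (f j).
  apply: (big_morph (pr m)) => [a b|]; first by have := pr_linear m 1 a b; rewrite !scale1r.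
  by apply/ffunP=> S; rewrite !ffunE if_same.
rewrite mulr_sumr prsum
  [in RHS](@sum_pr (undup degs) (pr (m - p) y)) ?undup_uniq //; last first.
  by move=> S _; rewrite mem_undup; apply: image_f.
rewrite mulr_sumr; apply: eq_bigr => j _.
have [jm|jm] := eqVneq (p + j) m.
  rewrite -jm pr_id; last by apply: homogM => //; apply: pr_homog.
  by rewrite addrAC subrr add0r [in RHS]pr_id //; apply: pr_homog.
rewrite (pr_0 (homogM hx (@pr_homog _ _))) //.
rewrite (@pr_0 (m - p)) ?mulr0 //; first exact: pr_homog.
by apply: contraNneq jm => <-; rewrite addrC subrK.
Qed.

Section Gens.
Variables (r : nat) (d : 'I_r -> int).
Notation W := {ffun 'I_r -> E}.

Definition prW (j : int) (f : W) : W := [ffun a => pr (j - d a) (f a)].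

Lemma prW_linear j : linear (prW j).
Proof. by move=> a u v; apply/ffunP=> i; rewrite !ffunE pr_linear. Qed.

Definition Wdegs := undup [seq d p.1 + #|p.2|%:Z | p : 'I_r * {set 'I_n}].

Lemma sum_prW f : f = \sum_(j <- Wdegs) prW j f.
Proof.
apply/ffunP=> a; rewrite sum_ffunE.
rewrite {1}(@sum_pr [seq j - d a | j <- Wdegs] (f a)).
- by rewrite big_map; apply: eq_bigr => j _; rewrite ffunE.
- by rewrite map_inj_uniq ?undup_uniq //; apply: addIr.
move=> S _; apply/mapP; exists (d a + #|S|%:Z); last by rewrite addrC addKr.
by rewrite mem_undup; apply/mapP; exists (a, S); rewrite ?mem_enum.
Qed.

Variable K : {vspace W}.
Hypothesis Kgr : forall j f, f \in K -> prW j f \in K.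

Definition Kj j : {vspace W} := (linfun (prW j) @: K)%VS.

Definition gens : seq (W * int) :=
  flatten [seq [seq (g : W, j) | g <- vbasis (Kj j)] | j <- Wdegs].

Lemma KjP j g : g \in Kj j -> g \in K /\ forall a, ext_homog (j - d a) (g a).
Proof.
move=> /memv_imgP[f fK ->]; rewrite linfunE'; last exact: prW_linear.
by split=> [|a]; [apply: Kgr|rewrite ffunE; apply: pr_homog].
Qed.

Lemma gensP g j : (g, j) \in gens -> g \in K /\ forall a, ext_homog (j - d a) (g a).
Proof.
by case/flatten_mapP=> j' _ /mapP[g' /vbasis_mem g'K [-> ->]]; apply: KjP.
Qed.

Definition Dgens : 'M[E]_(r, size gens) := \matrix_(a, b) (tnth (in_tuple gens) b).1 a.
Definition dgens (b : 'I_(size gens)) : int := (tnth (in_tuple gens) b).2.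

Lemma Dgens_homog a b : ext_homog (dgens b - d a) (Dgens a b).
Proof.
rewrite mxE /dgens; have := mem_tnth b (in_tuple gens).
by case: (tnth _ _) => g j /gensP[].
Qed.

Lemma Dgens_in b : [ffun a => Dgens a b] \in K.
Proof.
have := mem_tnth b (in_tuple gens).
have -> : [ffun a => Dgens a b] = (tnth (in_tuple gens) b).1.
  by apply/ffunP=> a; rewrite ffunE mxE.
by case: (tnth _ _) => g j /gensP[].
Qed.

Definition cvf (v : 'cV[E]_r) : W := [ffun a => v a 0].

Lemma Dgens_span (v : 'cV[E]_r) : cvf v \in K -> exists w, v = Dgens *m w.
Proof.
move=> vK; suff [w vw] : exists w, cvf v = cvf (Dgens *m w).
  by exists w; apply/colP=> a; have /ffunP/(_ a) := vw; rewrite !ffunE.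
rewrite [cvf v]sum_prW big_seq.
pose X f := exists w, f = cvf (Dgens *m w).
have XD f g : X f -> X g -> X (f + g).
  move=> [w ->] [w' ->]; exists (w + w'); apply/ffunP=> a.
  by rewrite mulmxDr !ffunE [RHS]mxE.
have X0 : X 0 by exists 0; apply/ffunP=> a; rewrite !ffunE mulmx0 mxE.
elim/big_ind: _ => // j jW.
have : prW j (cvf v) \in Kj j by rewrite -linfunE' ?memv_img //; apply: prW_linear.
move=> /coord_vbasis ->; elim/big_ind: _ => // i _.
set c := coord _ _ _; have gi : ((vbasis (Kj j))`_i, j) \in gens.
  apply/flatten_mapP; exists j => //; apply/mapP; exists (vbasis (Kj j))`_i => //.
  by rewrite mem_nth // size_tuple ltn_ord.
have [b bE] := tnthP (in_tuple gens) _ gi.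
exists (\col_b' (if b' == b then c *: 1 else 0)); apply/ffunP=> a; rewrite !ffunE.
rewrite mxE (bigD1 b) //= big1 ?addr0 => [|b' /negPf nb]; last by rewrite mxE nb mulr0.
by rewrite !mxE eqxx -ext_scaleAr mulr1 -bE.
Qed.

End Gens.

Record step := Step {
  sr : nat; sd : 'I_sr -> int; sm : nat; sd' : 'I_sm -> int;
  sD : 'M[E]_(sr, sm);
  sH : forall a b, ext_homog (sd' b - sd a) (sD a b) }.

Section Next.
Variable s : step.
Definition act (f : {ffun 'I_(sm s) -> E}) : {ffun 'I_(sr s) -> E} :=
  [ffun a => \sum_b sD s a b * f b].

Lemma act_linear : linear act.
Proof.
move=> c u v; apply/ffunP=> a; rewrite !ffunE scaler_sumr -big_split.
by apply: eq_bigr => b _ /=; rewrite !ffunE mulrDr ext_scaleAr.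
Qed.

Definition kerK := lker (linfun act).

Lemma kerK_gr j f : f \in kerK -> prW (@sd' s) j f \in kerK.
Proof.
rewrite !memv_ker !linfunE' ?act_linear; try exact: act_linear.
move=> /eqP /ffunP f0; apply/eqP/ffunP=> a; have := f0 a; rewrite !ffunE => f0a.
have : pr (j - sd a) (\sum_b sD s a b * f b) = 0.
  by rewrite f0a; apply/ffunP=> S; rewrite !ffunE if_same.
rewrite (big_morph (pr (j - sd a)) (id1 := 0) (op1 := +%R)); last first.
- by apply/ffunP=> S; rewrite !ffunE if_same.
- by move=> u v; have := pr_linear (j - sd a) 1 u v; rewrite !scale1r.
move=> h; rewrite -[RHS]h; apply: eq_bigr => b _; rewrite (prM _ _ (@sH s a b)) ffunE.
congr (_ * pr _ _).
by rewrite opprB addrA subrK.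
Qed.

Definition next : step :=
  @Step _ (@sd' s) _ _ _ (@Dgens_homog _ (@sd' s) kerK kerK_gr).

Lemma nextP (v : 'cV[E]_(sm s)) : sD s *m v = 0 <-> exists w, v = sD next *m w.
Proof.
split=> [Dv|[w ->]].
  apply: (@Dgens_span _ (@sd' s) kerK); rewrite memv_ker linfunE'; last exact: act_linear.
  apply/eqP/ffunP=> a; have /colP/(_ a) := Dv; rewrite !ffunE !mxE => Dva.
  by rewrite -[RHS]Dva; apply: eq_bigr => b _; rewrite ffunE.
rewrite mulmxA (_ : sD s *m sD next = 0) ?mul0mx //.
apply/matrixP=> a b; have := @Dgens_in _ (@sd' s) kerK kerK_gr b.
rewrite memv_ker linfunE'; last exact: act_linear.
move=> /eqP/ffunP/(_ a); rewrite !ffunE !mxE => Dva.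
by rewrite -[RHS]Dva; apply: eq_bigr => c _; rewrite ffunE.
Qed.
End Next.

Section Exist.
Variable I : {vspace E}.
Hypothesis Igr : forall m x, x \in I -> pr m x \in I.
Hypothesis Ir : forall x y, x \in I -> x * y \in I.

Definition ev0 (f : {ffun 'I_1 -> E}) : E := f 0.
Lemma ev0_linear : linear ev0. Proof. by move=> a u v; rewrite /ev0 !ffunE. Qed.
Definition K0 : {vspace {ffun 'I_1 -> E}} := (linfun ev0 @^-1: I)%VS.
Lemma K0P f : (f \in K0) = (f 0 \in I).
Proof. by rewrite -memv_preim linfunE' //; exact: ev0_linear. Qed.
Lemma K0_gr j f : f \in K0 -> prW (fun _ => 0) j f \in K0.
Proof. by rewrite !K0P ffunE; apply: Igr. Qed.

Definition step0 : step := @Step _ (fun _ => 0) _ _ _ (@Dgens_homog _ _ K0 K0_gr).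
Fixpoint steps i := if i is i'.+1 then next (steps i') else step0.

Definition res_rk i := sr (steps i).
Definition res_F : grfree k n :=
  @GrFree k n res_rk (fun i => @sd (steps i)) (fun i => sD (steps i))
    (fun i => @sH (steps i)).

Lemma resolution_exists : exists (F : grfree k n) eps, resolution I (F := F) eps.
Proof.
exists res_F; exists (1%:M : 'M[E]_1); split.
- by move=> b; rewrite !ord1 mxE eqxx -extb0; have := @homogb set0; rewrite cards0.
- by move=> x; exists x%:M; rewrite mul1mx mxE eqxx subrr mem0v.
- move=> v; rewrite mul1mx; split=> [v0|[w ->]].
    by apply: (@Dgens_span _ (fun _ => 0) K0); rewrite K0P ffunE.
  rewrite mxE; apply: memv_suml => b _; apply: Ir.
  by have := @Dgens_in _ _ K0 K0_gr b; rewrite K0P ffunE.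
- by move=> i v; apply: nextP.
Qed.
End Exist.
End Construction.

Section OrlikSolomonQuotient.
Variables (k K : fieldType) (l n : nat) (H : 'I_n -> {vspace 'rV[K]_l}).
Notation OS := (os_ideal k H).
Notation gen S J T := (extb k S * ext_d (extb k J) * extb k T).

Lemma os_gen J S T : dependent H J -> gen S J T \in OS.
Proof.
move=> dJ; rewrite memvE /os_ideal; apply: (sumv_sup J) => //.
by apply: (sumv_sup S) => //; apply: (sumv_sup T).
Qed.

Lemma os_sub (V : {vspace extalg k n}) :
  (forall J S T, dependent H J -> gen S J T \in V) -> (OS <= V)%VS.
Proof.
move=> h; apply/subv_sumP=> J dJ; apply/subv_sumP=> S _; apply/subv_sumP=> T _.
by rewrite -memvE; apply: h.
Qed.

Lemma os_gr m x : x \in OS -> pr m x \in OS.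
Proof.
move=> xO; rewrite -(linfunE' (@pr_linear k n m)) memv_preim.
move: x xO; apply/subvP; apply: os_sub => J S T dJ.
rewrite -memv_preim linfunE'; last exact: pr_linear.
have hg : ext_homog (#|S|%:Z + (#|J|%:Z - 1) + #|T|%:Z) (gen S J T).
  apply: homogM (@homogb _ _ T); apply: homogM (@homogb _ _ S) _.
  rewrite ext_db; apply: homog_sum => i iJ; apply: homogZ.
  have := @homogb k n (J :\ i); rewrite (cardsD1 i J) iJ PoszD.
  by rewrite (_ : 1 + _ - 1 = #|J :\ i|%:Z) // addrC addKr.
have [<-|e] := eqVneq (#|S|%:Z + (#|J|%:Z - 1) + #|T|%:Z) m.
  by rewrite pr_id // os_gen.
by rewrite (pr_0 hg e) mem0v.
Qed.

Lemma os_mulr x y : x \in OS -> x * y \in OS.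
Proof.
have lin : linear ( *%R^~ y : extalg k n -> extalg k n).
  by move=> a u v; rewrite mulrDl -ext_scaleAl.
move=> xO; rewrite -(linfunE' lin) memv_preim.
move: x xO; apply/subvP; apply: os_sub => J S T dJ.
rewrite -memv_preim linfunE' // [y]extE mulr_sumr; apply: memv_suml => U _.
by rewrite -ext_scaleAr -mulrA extbM -ext_scaleAr !memvZ // os_gen.
Qed.

Lemma os_resolution_exists : exists (F : grfree k n) eps, resolution OS (F := F) eps.
Proof. by apply: resolution_exists; [exact: os_gr | exact: os_mulr]. Qed.
End OrlikSolomonQuotient.

End FreeResolution.

(* Main.v *)
(* In divided-power form Tor_i^E(E/I, k)_(i+1) is the homology of
   D_(i+1)(V) -> V (x) D_i(V) -> (E/I)_2 (x) D_(i-1)(V), where V = E_1. By the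
   Poincare lemma it is the space of closed 2-forms with values in I_2 and
   coefficients of degree m = i - 1. An element of D_m(V) is encoded as a
   symmetric function of a sequence of m indices, so that the derivative in
   direction i is s |-> f (i :: s).

   I_2 is spanned by the forms (e_a - e_c)(e_b - e_c), for abc a triangle of G.
   A plane <u, v> of V such that uv is in I_2 gives the closed forms f(u, v) uv,
   a space of dimension m + 1. There is such a plane for each triangle, spanned
   by e_a - e_c and e_b - e_c, and one for each copy of K_4, spanned by the
   differences of the sums of e over its three perfect matchings. When m >= 1
   the closed forms are the direct sum of these spaces: closedness forces the
   coefficient of a triangle to have a nonzero derivative only along edges that
   lie in a K_4 with it, and the derivatives leaving the triangles of a K_4 only
   depend on the perfect matching of the edge and are the derivatives of a single
   polynomial in u and v. Once these are subtracted, each coefficient only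
   depends on the edges of its triangle. *)
Require Import Defs.
From mathcomp Require Import all_boot all_order all_algebra.
From mathcomp Require Import boolp reals complex.
From mathcomp Require Import zify ring.

Set Implicit Arguments.
Unset Strict Implicit.
Unset Printing Implicit Defensive.

Import Order.TTheory GRing.Theory Num.Theory.
Import FreeResolution.
Local Open Scope ring_scope.

(** * The Koszul complex in divided powers *)

Section Koszul.
Variables (k : fieldType) (n : nat).
Notation E := (extalg k n).
Notation g := (ext_gen k).

(** The resolution is arbitrary, so Tor carries no evident map to closed forms. Zigzags in a double
    complex only give a linear relation between cycles and forms, and a dimension count on this
    relation replaces the isomorphism. The relation ends in actual forms rather than in classes
    because the ideal vanishes in degrees 0 and 1. The form [uv] of a K_4 is itself a signed sum of
    its four triangle forms, so with constant coefficients it would add nothing new. A K_4 becomes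
    visible only through the coefficient of one of its triangles differentiated along an edge to the
    fourth vertex; this is where [2 <= i] enters. Divided powers are never divided out: an element
    of degree m in the divided powers of a plane is a functional on polynomials in one variable,
    given by its values on the powers of ['X]. *)

Definition symf (T : Type) (c : seq 'I_n -> T) :=
  forall s s', perm_eq s s' -> c s = c s'.

Lemma symf_cons (T : Type) (c : seq 'I_n -> T) i :
  symf c -> symf (fun s => c (i :: s)).
Proof. by move=> cs s s' ss'; apply: cs; rewrite perm_cons. Qed.

Lemma symf_swap (T : Type) (c : seq 'I_n -> T) i j s :
  symf c -> c (i :: j :: s) = c (j :: i :: s).
Proof. by move=> cs; apply: cs; apply/permP => p /=; rewrite addnCA. Qed.

Lemma ext_mul_genr (x : E) (i : 'I_n) U : (x * g i) U =
  if i \in U then x (U :\ i) * wedge_coef k (U :\ i) [set i] else 0.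
Proof.
rewrite ext_mulE.
have -> : \sum_S \sum_T x S * g i T * wedge_coef k S T * (U == S :|: T)%:R =
          \sum_S x S * wedge_coef k S [set i] * (U == S :|: [set i])%:R.
  apply: eq_bigr => S _; rewrite (bigD1 [set i]) //= big1 ?addr0.
    by rewrite /ext_gen ffunE eqxx mulr1.
  by move=> T /negPf nT; rewrite /ext_gen ffunE nT mulr0 !mul0r.
have w0 (S : {set 'I_n}) : i \in S -> wedge_coef k S [set i] = 0.
  by move=> iS; rewrite /wedge_coef disjoint_sym disjoints1 iS.
case: ifP => iU.
  rewrite (bigD1 (U :\ i)) //= big1 ?addr0.
    by rewrite setUC setD1K // eqxx mulr1.
  move=> S SU; case: (boolP (i \in S)) => [/w0->|iS]; first by rewrite mulr0 mul0r.
  case: eqP => [UE|_]; last by rewrite mulr0.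
  by move: SU; rewrite UE setUC setU1K ?eqxx.
apply: big1 => S _; case: eqP => [UE|_]; last by rewrite mulr0.
by move: iU; rewrite UE !inE eqxx orbT.
Qed.

Lemma genM_anti (i j : 'I_n) : g i * g j = - (g j * g i).
Proof.
rewrite /ext_gen !extbM !wedge_coef1 !inE.
rewrite [in RHS]eq_sym; have [->|ij] := eqVneq i j; first by rewrite !scale0r oppr0.
rewrite setUC -scaleNr; congr (_ *: _).
have cE (a b : 'I_n) : #|[set x in [set a] | (x < b)%N]| = (a < b)%N.
  case: (ltnP a b) => ab.
    rewrite (_ : [set x in _ | _] = [set a]) ?cards1 //.
    by apply/setP => x; rewrite !inE; case: eqP => // ->.
  apply/eqP; rewrite cards_eq0; apply/eqP/setP => x; rewrite !inE.
  by case: eqP => // ->; rewrite ltnNge ab.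
rewrite !cE; case: ltngtP => ij'; rewrite ?expr0 ?expr1 ?opprK //.
by move/val_inj: ij' ij => ->; rewrite eqxx.
Qed.

Lemma gen_sq (i : 'I_n) : g i * g i = 0.
Proof. by rewrite /ext_gen extbM wedge_coef1 inE eqxx scale0r. Qed.

(** The Koszul differential. Generators multiply on the right, so that it commutes without signs
    with the matrices of a resolution, which act on the left. *)
Definition ed (f : seq 'I_n -> E) s : E := \sum_i f (i :: s) * g i.

Lemma eq_ed (f f' : seq 'I_n -> E) s :
  (forall i, f (i :: s) = f' (i :: s)) -> ed f s = ed f' s.
Proof. by move=> ff'; apply: eq_bigr => i _; rewrite ff'. Qed.

Lemma ed_coef f s U :
  ed f s U = \sum_(i in U) f (i :: s) (U :\ i) * wedge_coef k (U :\ i) [set i].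
Proof.
by rewrite /ed sum_ffunE [RHS]big_mkcond; apply: eq_bigr => i _; rewrite ext_mul_genr.
Qed.

Lemma edD (a : k) (f f' : seq 'I_n -> E) s :
  ed (fun s => a *: f s + f' s) s = a *: ed f s + ed f' s.
Proof.
rewrite /ed scaler_sumr -big_split; apply: eq_bigr => i _ /=.
by rewrite mulrDl ext_scaleAl.
Qed.

Lemma edB (f f' : seq 'I_n -> E) s : ed (fun s => f s - f' s) s = ed f s - ed f' s.
Proof. by rewrite /ed -sumrB; apply: eq_bigr => i _; rewrite mulrBl. Qed.

Lemma ed0 s : ed (fun=> 0) s = 0.
Proof. by rewrite /ed big1 // => i _; rewrite mul0r. Qed.

Lemma ed_sym f : symf f -> symf (ed f).
Proof.
by move=> fs s s' ss'; apply: eq_bigr => i _; congr (_ * _); apply: symf_cons ss'.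
Qed.

(** The terms at [(i, j)] and [(j, i)] cancel, derivatives being symmetric and generators
    anticommuting; the diagonal terms vanish because generators square to zero. *)
Lemma ed_ed f s : symf f -> ed (ed f) s = 0.
Proof.
move=> fs; rewrite /ed.
under eq_bigr do rewrite mulr_suml.
pose A (i j : 'I_n) := f (j :: i :: s) * g j * g i.
have AN i j : A i j = - A j i.
  by rewrite /A -!mulrA genM_anti mulrN; congr (- (_ * _)); apply: symf_swap.
have A0 i : A i i = 0 by rewrite /A -mulrA gen_sq mulr0.
rewrite -/(A _ _) pair_bigA /= (bigID (fun p : 'I_n * 'I_n => p.1 < p.2)%N) /=.
rewrite [X in _ + X](bigID (fun p : 'I_n * 'I_n => p.2 < p.1)%N) /=.
rewrite [X in _ + (_ + X)]big1 ?addr0.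
  rewrite [X in _ + X](_ : _ = - \sum_(p : 'I_n * 'I_n | (p.1 < p.2)%N) A p.1 p.2).
    by rewrite addrN.
  rewrite -sumrN (reindex_inj (h := fun p : 'I_n * 'I_n => (p.2, p.1))) /=.
    by apply: eq_big => -[i j] /=; [case: ltngtP | move=> _; exact: AN].
  by move=> [? ?] [? ?] [-> ->].
move=> [i j] /=; rewrite -!leqNgt -eqn_leq => /eqP/val_inj->; exact: A0.
Qed.

Lemma wedge_max (U : {set 'I_n}) (t : 'I_n) :
  (forall u, u \in U -> (u < t)%N) -> wedge_coef k U [set t] = 1.
Proof.
move=> Ut; rewrite /wedge_coef disjoint_sym disjoints1.
case: (boolP (t \in U)) => [/Ut|_]; first by rewrite ltnn.
rewrite /= /inversions (_ : [set p | _] = set0) ?cards0 //; apply/setP => -[a b].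
rewrite !inE /=; apply/negP => /and3P[/Ut ab /eqP->]; lia.
Qed.

Lemma wedge_setU1_max (U : {set 'I_n}) (t i : 'I_n) :
  (forall u, u \in U -> (u < t)%N) -> i \in U ->
  wedge_coef k ((t |: U) :\ i) [set i] = - wedge_coef k (U :\ i) [set i].
Proof.
move=> Ut iU; have it := Ut i iU.
have ti : t != i by apply: contraTneq it => ->; rewrite ltnn.
have tU : t \notin U :\ i.
  by apply/negP; rewrite !inE => /andP[_ /Ut]; rewrite ltnn.
rewrite (_ : (t |: U) :\ i = [set t] :|: U :\ i); last first.
  by apply/setP => x; rewrite !inE; case: (x =P t) => // ->; rewrite ti.
have d1 : [disjoint [set t] & U :\ i] by rewrite disjoints1.
rewrite /wedge_coef.
rewrite !(disjoint_sym _ [set i]) !disjoints1 !inE eqxx eq_sym (negPf ti) /=.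
rewrite inversionsUl // addnC exprD /inversions.
rewrite [X in _ * (-1) ^+ X](_ : _ = 1)%N ?expr1 ?mulrN1 //.
rewrite (_ : [set p | _] = [set (t, i)]) ?cards1 //; apply/setP => -[a b].
rewrite !inE /= xpair_eqE; case: (a =P t) => //= ->.
by case: (b =P i) => //= ->; rewrite it.
Qed.

Definition topP (s : seq 'I_n) (U : {set 'I_n}) (t : 'I_n) :=
  [&& t \in s, all (fun i : 'I_n => i <= t)%N s & [forall u in U, u < t]%N].

(** The contracting homotopy, read on coefficients: e_U x^(s) takes the coefficient that [f] has
    after [t], the largest index, is moved from [s] to [U]. The default 0 covers the case where the
    largest index already lies in [U]. *)
Definition ehom (f : seq 'I_n -> E) s : E :=
  [ffun U : {set 'I_n} =>
     (if [pick t | topP s U t] is Some t then f (rem t s) (t |: U) else 0) : k^o].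

Lemma topP_uniq s U t t' : topP s U t -> topP s U t' -> t = t'.
Proof.
case/and3P=> ts /allP st _ /and3P[ts' /allP st' _].
by apply: val_inj; apply/eqP; rewrite eqn_leq st' ?st.
Qed.

Lemma ehomE f s U t : topP s U t -> ehom f s U = f (rem t s) (t |: U).
Proof.
by move=> tP; rewrite ffunE; case: pickP => [t' /(topP_uniq tP)<-|/(_ t)]; rewrite ?tP.
Qed.

Lemma ehom_sym f : symf f -> symf (ehom f).
Proof.
move=> fs s s' ss'; apply/ffunP => U; rewrite !ffunE.
have PE : topP s U =1 topP s' U.
  by move=> t; rewrite /topP (perm_mem ss') (perm_all _ ss').
rewrite (eq_pick PE); case: pickP => // t /and3P[ts' _ _].
have ts : t \in s by rewrite (perm_mem ss').
congr (fun_of_fin _ _); apply: fs; rewrite -(perm_cons t).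
by rewrite -!(permPl (perm_to_rem _)) // (permPl ss') perm_to_rem.
Qed.

Lemma ehom_homog f q m : (forall s, size s = q -> ext_homog m (f s)) ->
  forall s, size s = q.+1 -> ext_homog (m - 1) (ehom f s).
Proof.
move=> fh s sq U; rewrite ffunE; case: pickP => [t|]; last by rewrite eqxx.
case/and3P=> ts _ /forall_inP Ut nz.
have <- : Posz #|t |: U| = m by apply: fh nz; rewrite size_rem // sq.
by rewrite cardsU1; case: (boolP (t \in U)) => [/Ut|_]; rewrite ?ltnn // PoszD addrC addKr.
Qed.

(* The Koszul complex is contracted onto k by moving the largest index that
   occurs in e_U x^(s) from the exterior to the divided power part. *)
Lemma poincare (f : seq 'I_n -> E) q : symf f -> (q = 0%N -> f [::] set0 = 0) ->
  (forall s, (size s).+1 = q -> ed f s = 0) ->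
  forall s, size s = q -> f s = ed (ehom f) s.
Proof.
move=> fs f0 df s sq; apply/ffunP => U.
rewrite ed_coef.
(* [t] is the largest index occurring in [s] or [U]. If there is none, both are empty and [f0]
   applies. *)
have [[t /and3P[tm ts tU]]|] : (exists t, [&& t \in s ++ enum U,
    all (fun i : 'I_n => i <= t)%N s & [forall u in U, u <= t]%N]) \/ s ++ enum U = [::].
- case sE: (s ++ enum U) => [|a r]; [by right|left].
  have ain : a \in s ++ enum U by rewrite sE mem_head.
  case: (@arg_maxnP _ a (fun x => x \in s ++ enum U) val ain) => t tm tM.
  rewrite -sE; exists t; rewrite tm /=; apply/andP; split.
    by apply/allP => i si; apply: tM; rewrite mem_cat si.
  by apply/forall_inP => u uU; apply: tM; rewrite mem_cat mem_enum uU orbT.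
- move/forall_inP: tU => tU.
  case: (boolP (t \in U)) => UT.
    have U't u : u \in U :\ t -> (u < t)%N.
      by rewrite !inE => /andP[ut /tU]; rewrite leq_eqVlt => /predU1P[/val_inj|//] uE;
        rewrite uE eqxx in ut.
    rewrite (bigD1 t) //= big1 ?addr0.
      rewrite (@ehomE _ _ _ t); first by rewrite /= eqxx setD1K // wedge_max // mulr1.
      by rewrite /topP mem_head /= leqnn ts; apply/forall_inP.
    (* For [i] other than [t], the maximum [t] remains in [U :\ i], so [ehom] takes its default
       value. *)
    move=> i /andP[iU it]; rewrite ffunE; case: pickP => [t'|]; last by rewrite mul0r.
    case/and3P => t's _ /forall_inP/(_ t); rewrite !inE eq_sym it UT => /(_ isT) tt'.
    move: t's; rewrite inE => /predU1P[t'E|/(allP ts)]; last by lia.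
    by have := tU i iU; rewrite -t'E; lia.
  have U't u : u \in U -> (u < t)%N.
    by move=> uU; have := tU u uU; rewrite leq_eqVlt => /predU1P[/val_inj uE|//];
      rewrite -uE uU in UT.
  have tins : t \in s by move: tm; rewrite mem_cat mem_enum (negPf UT) orbF.
  (* Closedness at this coefficient: the summand of index [t] is [f s U], and the others are, up to
     sign, the summands of [ed (ehom f) s U]. *)
  have : ed f (rem t s) (t |: U) = 0.
    by rewrite df ?ffunE // size_rem // -sq; case: (s) tins.
  rewrite [X in X = _ -> _]ed_coef.
  rewrite big_setU1 //= setU1K // wedge_max // mulr1.
  rewrite (fs (t :: rem t s) s); last by rewrite perm_sym perm_to_rem.
  move/eqP; rewrite addr_eq0 => /eqP ->; rewrite -sumrN; apply: eq_bigr => i iU.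
  rewrite wedge_setU1_max // mulrN opprK; congr (_ * _).
  have it := U't i iU; have ti : t != i by apply: contraTneq it => ->; rewrite ltnn.
  rewrite (@ehomE _ _ _ t).
    rewrite /= eq_sym (negPf ti); congr (fun_of_fin _ _).
    by apply/setP => x; rewrite !inE; case: (x =P t) => // ->; rewrite ti.
  rewrite /topP inE tins orbT /= (ltnW it) ts /=; apply/forall_inP => u.
  by rewrite !inE => /andP[_ /U't].
case: s sq => //= q0 UE.
have -> : U = set0 by apply/setP => x; rewrite -mem_enum UE inE in_nil.
by rewrite f0 // big_set0.
Qed.

End Koszul.

(** * The linear strand of Tor *)

Section LinearStrand.
Variables (k : fieldType) (n : nat).
Notation E := (extalg k n).

Lemma homogD m (x y : E) : ext_homog m x -> ext_homog m y -> ext_homog m (x + y).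
Proof.
move=> hx hy S; rewrite ffunE; have [->|/hx//] := eqVneq (x S) 0.
by rewrite add0r => /hy.
Qed.

Lemma homog0 m : ext_homog m (0 : E).
Proof. by move=> S; rewrite ffunE eqxx. Qed.

Lemma homogB m (x y : E) : ext_homog m x -> ext_homog m y -> ext_homog m (x - y).
Proof. by move=> hx hy; rewrite -scaleN1r; apply: homogD => //; apply: homogZ. Qed.

Lemma homog_ed (f : seq 'I_n -> E) q m :
  (forall s, size s = q.+1 -> ext_homog m (f s)) ->
  forall s, size s = q -> ext_homog (m + 1) (ed f s).
Proof.
move=> fh s sq; apply: homog_sum => i _; apply: homogM; first by apply: fh; rewrite /= sq.
by have := @homogb k n [set i]; rewrite cards1.
Qed.

Lemma prB m (x y : E) : pr m (x - y) = pr m x - pr m y.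
Proof. by have := @pr_linear k n m (-1) y x; rewrite !scaleN1r !(addrC (- _)). Qed.

Lemma pr_sum m (J : finType) (f : J -> E) : pr m (\sum_a f a) = \sum_a pr m (f a).
Proof.
apply: (big_morph (pr m)) => [x y|]; last by apply/ffunP=> S; rewrite !ffunE if_same.
by have := @pr_linear k n m 1 x y; rewrite !scale1r.
Qed.

Lemma mulmxBE r (e : 'rV[E]_r) (v w : 'cV[E]_r) :
  (e *m (v - w)) 0 0 = (e *m v) 0 0 - (e *m w) 0 0.
Proof. by rewrite mulmxBr mxE [X in _ + X]mxE. Qed.

Lemma mulmxDE r (e : 'rV[E]_r) (v w : 'cV[E]_r) :
  (e *m (v + w)) 0 0 = (e *m v) 0 0 + (e *m w) 0 0.
Proof. by rewrite mulmxDr mxE. Qed.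

Section Columns.
Variable r : nat.
Implicit Type c : seq 'I_n -> 'cV[E]_r.

Definition kd c s : 'cV[E]_r := \col_a ed (fun s => c s a 0) s.

Lemma eq_kd c c' s : (forall i, c (i :: s) = c' (i :: s)) -> kd c s = kd c' s.
Proof. by move=> cc'; apply/colP => a; rewrite !mxE; apply: eq_ed => i; rewrite cc'. Qed.

Lemma kdB c c' s : kd (fun s => c s - c' s) s = kd c s - kd c' s.
Proof.
by apply/colP => a; rewrite !mxE -edB; apply: eq_ed => i; rewrite !mxE.
Qed.

Lemma kdD (x : k) c c' s : kd (fun s => x%:A *: c s + c' s) s = x%:A *: kd c s + kd c' s.
Proof.
apply/colP => a; rewrite !mxE -ext_scaleAl mul1r -edD; apply: eq_ed => i.
by rewrite !mxE -ext_scaleAl mul1r.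
Qed.

Lemma kd0 s : kd (fun=> 0) s = 0.
Proof.
by apply/colP => a; rewrite !mxE ed0.
Qed.

Lemma symf_entry c (a : 'I_r) : symf c -> symf (fun s => c s a 0).
Proof. by move=> cs s s' /cs ->. Qed.

Lemma kd_sym c : symf c -> symf (kd c).
Proof.
move=> cs s s' ss'; apply/colP => a; rewrite !mxE; apply: ed_sym ss'.
exact: symf_entry.
Qed.

Lemma kd_kd c s : symf c -> kd (kd c) s = 0.
Proof.
move=> cs; apply/colP => a; rewrite !mxE.
rewrite -[RHS](@ed_ed _ _ (fun s => c s a 0) s); last exact: symf_entry.
by apply: eq_ed => i; rewrite mxE.
Qed.

Definition prV m (d : 'I_r -> int) (v : 'cV[E]_r) : 'cV[E]_r :=
  \col_a pr (m - d a) (v a 0).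

Lemma prV_homog m d v a : ext_homog (m - d a) (prV m d v a 0).
Proof. by rewrite mxE; apply: pr_homog. Qed.

Lemma prV_id m (d : 'I_r -> int) (v : 'cV[E]_r) :
  (forall a, ext_homog (m - d a) (v a 0)) -> prV m d v = v.
Proof. by move=> hv; apply/colP => a; rewrite mxE pr_id. Qed.

End Columns.

Lemma mul_kd r r' (D : 'M[E]_(r',
  r)) (c : seq 'I_n -> 'cV[E]_r) s : D *m kd c s = kd (fun s => D *m c s) s.
Proof.
apply/colP => a; rewrite !mxE /ed.
under [RHS]eq_bigr do rewrite mxE mulr_suml.
rewrite [RHS]exchange_big /=; apply: eq_bigr => b _.
by rewrite mxE mulr_sumr; apply: eq_bigr => i _; rewrite mulrA.
Qed.

Lemma mul_kdE r (e : 'rV[E]_r) (c : seq 'I_n -> 'cV[E]_r) s : (e *m kd c s) 0 0 = ed (fun s =>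
  (e *m c s) 0 0) s.
Proof. by rewrite mul_kd mxE. Qed.


Lemma prV_mul r r' (da : 'I_r -> int) (db : 'I_r' -> int) (D : 'M[E]_(r, r')) m w :
  (forall a b, ext_homog (db b - da a) (D a b)) ->
  prV m da (D *m w) = D *m prV m db w.
Proof.
move=> Dh; apply/colP => a; rewrite !mxE pr_sum; apply: eq_bigr => b _.
by rewrite (prM _ _ (Dh a b)) mxE; congr (_ * pr _ _); rewrite opprB addrA subrK.
Qed.

(** Lifts along the resolution are chosen sequence by sequence. Choosing only at sorted sequences
    makes the choice symmetric. *)
Lemma symf_choice (T : Type) (P : seq 'I_n -> T -> Prop) :
  (forall s s' x, perm_eq s s' -> P s x -> P s' x) ->
  (forall s, exists x, P s x) -> exists2 b, symf b & forall s, P s (b s).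
Proof.
move=> Psym /choice[b bP]; pose srt := sort (fun x y : 'I_n => (x <= y)%N).
exists (fun s => b (srt s)); last first.
  by move=> s; apply: Psym (bP _); rewrite perm_sort.
move=> s s' ss'; congr b; apply/perm_sortP => // [x y|x y z|x y].
- exact: leq_total.
- exact: leq_trans.
- by rewrite -eqn_leq => /eqP/val_inj.
Qed.

Variables (I : {vspace E}) (F : grfree k n) (eps : 'rV[E]_(rk F 0)).
Hypothesis resF : resolution I eps.
Hypothesis Igr : forall m x, x \in I -> pr m x \in I.
Hypothesis Ilow : forall m x, m <= 1 -> x \in I -> ext_homog m x -> x = 0.
Variable m : nat.
Notation N := m.+1.
Notation j := (N.+1%:Z).

(** The part of internal degree [j] of F_p (x)_E (E (x) D_q(V)), where x^(s) has degree [q]. Only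
    the values on sequences of length [q] matter, but symmetry is kept everywhere. *)
Definition chain p q (c : seq 'I_n -> 'cV[E]_(rk F p)) := symf c /\
  forall s, size s = q -> forall a, ext_homog (j - q%:Z - gdeg a) (c s a 0).

Lemma chainB p q (c c' : seq 'I_n -> 'cV[E]_(rk F p)) : chain q c -> chain q c' ->
  chain q (fun s => c s - c' s).
Proof.
move=> [cs ch] [cs' ch']; split=> [s s' ss'|s sq a]; first by rewrite (cs _ _ ss') (cs' _ _ ss').
by rewrite !mxE; apply: homogB; [apply: ch | apply: ch'].
Qed.

Lemma chain_kd p q (c : seq 'I_n -> 'cV[E]_(rk F p)) : chain q.+1 c -> chain q (kd c).
Proof.
move=> [cs ch]; split; first exact: kd_sym.
move=> s sq a; rewrite mxE.
have := @homog_ed (fun s => c s a 0) q _ (fun s e => ch s e a) s sq.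
by congr ext_homog; lia.
Qed.

Lemma chain_diff p q (c : seq 'I_n -> 'cV[E]_(rk F p.+1)) :
  chain q c -> chain q (fun s => diff F p *m c s).
Proof.
move=> [cs ch]; split; first by move=> s s' /cs ->.
move=> s sq a; rewrite -[c s](@prV_id _ (j - q%:Z) (@gdeg _ _ F p.+1)); last exact: ch.
rewrite -(prV_mul (da := @gdeg _ _ F p)); last by move=> *; apply: diff_homog.
exact: prV_homog.
Qed.

Lemma eps_homog q (c : seq 'I_n -> 'cV[E]_(rk F 0)) s : chain q c -> size s = q ->
  ext_homog (j - q%:Z) ((eps *m c s) 0 0).
Proof.
case: resF => eh _ _ _ [_ ch] sq; rewrite mxE; apply: homog_sum => b _.
by have := homogM (eh b) (ch s sq b); congr ext_homog; lia.
Qed.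

(** The Poincare lemma entry by entry; in divided degree 0 the constant term is the only
    obstruction. *)
Lemma kd_exact p q (c : seq 'I_n -> 'cV[E]_(rk F p)) : chain q c ->
  (forall s, (size s).+1 = q -> kd c s = 0) ->
  (q = 0%N -> forall a, c [::] a 0 set0 = 0) ->
  exists2 b, chain q.+1 b & forall s, size s = q -> c s = kd b s.
Proof.
move=> [cs ch] dc c0; exists (fun s => \col_a ehom (fun s => c s a 0) s); first split.
- move=> s s' ss'; apply/colP => a; rewrite !mxE; apply: ehom_sym ss'; exact: symf_entry.
- move=> s sq a; rewrite mxE.
  have := ehom_homog (f := fun s => c s a 0) (fun s e => ch s e a) sq.
  by congr ext_homog; lia.
move=> s sq; apply/colP => a; rewrite mxE.
rewrite (poincare (f := fun s => c s a 0) (q := q)) //; first last.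
- by move=> s' /dc/colP/(_ a); rewrite !mxE.
- by move/c0.
- exact: symf_entry.
by apply: eq_ed => i; rewrite mxE.
Qed.

(** The kernel of the map out of F_p in the augmented resolution, with E / I as the term after
    F_0. *)
Definition killed p : 'cV[E]_(rk F p) -> Prop :=
  match p with
  | 0 => fun v => (eps *m v) 0 0 \in I
  | p'.+1 => fun v => diff F p' *m v = 0
  end.

Lemma killedP p (v : 'cV[E]_(rk F p)) : killed v <-> exists w, v = diff F p *m w.
Proof. by case: resF => _ _ ex0 ex; case: p v => [|p] v; [exact: ex0 | exact: ex]. Qed.

Lemma lift_diff p q (c : seq 'I_n -> 'cV[E]_(rk F p)) : chain q c ->
  (forall s, size s = q -> killed (c s)) ->
  exists2 b, chain q b & forall s, size s = q -> c s = diff F p *m b s.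
Proof.
move=> [cs ch] ck.
pose P s (w : 'cV[E]_(rk F p.+1)) := size s = q -> c s = diff F p *m w /\
  forall a, ext_homog (j - q%:Z - gdeg a) (w a 0).
have [||b bs bP] := @symf_choice _ P.
- by move=> s s' x ss' Psx sq; rewrite -(cs _ _ ss'); apply: Psx; rewrite (perm_size ss').
- move=> s; case: (eqVneq (size s) q) => [sq|/eqP nq]; last by exists 0.
  have /killedP[w cE] := ck s sq.
  exists (prV (j - q%:Z) (@gdeg _ _ F p.+1) w) => _; split; last exact: prV_homog.
  rewrite -(prV_mul (da := @gdeg _ _ F p)) -?cE; last by move=> *; apply: diff_homog.
  by rewrite prV_id //; apply: ch.
by exists b; [split=> // s /bP[] | move=> s /bP[]].
Qed.

Lemma lift_eps q (f : seq 'I_n -> E) : symf f ->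
  (forall s, size s = q -> ext_homog (j - q%:Z) (f s)) ->
  exists2 c : seq 'I_n -> 'cV[E]_(rk F 0), chain q c &
    forall s, size s = q -> f s - (eps *m c s) 0 0 \in I.
Proof.
move=> fs fh; case: resF => eh surj _ _.
pose P s (w : 'cV[E]_(rk F 0)) := size s = q -> f s - (eps *m w) 0 0 \in I /\
  forall a, ext_homog (j - q%:Z - gdeg a) (w a 0).
have [||b bs bP] := @symf_choice _ P.
- by move=> s s' x ss' Psx sq; rewrite -(fs _ _ ss'); apply: Psx; rewrite (perm_size ss').
- move=> s; case: (eqVneq (size s) q) => [sq|/eqP nq]; last by exists 0.
  have [w wP] := surj (f s).
  exists (prV (j - q%:Z) (@gdeg _ _ F 0) w) => _; split; last exact: prV_homog.
  rewrite -(prV_mul (da := fun=> 0)); last by move=> a b; rewrite subr0 ord1.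
  by rewrite mxE subr0 -(pr_id (fh s sq)) -prB Igr.
by exists b; [split=> // s /bP[] | move=> s /bP[]].
Qed.

(* The zigzags of the double complex F (x)_E (E (x) D(V)), whose total homology
   is computed both by F (x)_E k and by (E / I) (x) D(V). *)
Fixpoint zigzag p q : (seq 'I_n -> 'cV[E]_(rk F p)) -> (seq 'I_n -> E) -> Prop :=
  match p with
  | 0 => fun c eta => chain q c /\
      forall s, (size s).+1 = q -> eta s = ed (fun s => (eps *m c s) 0 0) s
  | p'.+1 => fun c eta => chain q c /\ exists2 c', zigzag q.+1 c' eta &
      forall s, size s = q -> diff F p' *m c s = kd c' s
  end.

(** With [N = m.+1], the values that count are those on sequences of length [m]; closedness is
    tested at length [m - 1] and is vacuous for [m = 0]. *)
Definition closed_form (eta : seq 'I_n -> E) := [/\ symf eta,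
  forall s, (size s).+1 = N -> eta s \in I /\ ext_homog 2 (eta s) &
  forall s, (size s).+2 = N -> ed eta s = 0].

Lemma zigzag_chain p q (c : seq 'I_n -> 'cV[E]_(rk F p)) eta : zigzag q c eta -> chain q c.
Proof. by case: p c => [|p] c []. Qed.

Lemma zigzag_killed p q (c : seq 'I_n -> 'cV[E]_(rk F p)) eta s :
  zigzag q.+1 c eta -> (p + q.+1)%N = N -> size s = q ->
  (forall s, (size s).+1 = N -> eta s \in I) -> killed (kd c s).
Proof.
case: p c => [|p] c /= [_ ez] pq sq etaI.
  by rewrite mul_kdE -ez ?sq // etaI // sq.
case: ez => c' /zigzag_chain[c's _] Dc.
rewrite mul_kd (@eq_kd _ _ (kd c')) ?kd_kd // => i.
by apply: Dc; rewrite /= sq.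
Qed.

Lemma zigzag_up p q (c : seq 'I_n -> 'cV[E]_(rk F p)) eta :
  zigzag q.+1 c eta -> (p + q.+1)%N = N ->
  (forall s, (size s).+1 = N -> eta s \in I) ->
  exists c' : seq 'I_n -> 'cV[E]_(rk F p.+1), zigzag q c' eta.
Proof.
move=> z pq etaI.
have [|c' c'ch cE] := lift_diff (chain_kd (zigzag_chain z)).
  by move=> s sq; apply: zigzag_killed z pq sq etaI.
by exists c'; split=> //; exists c => // s sq; rewrite cE.
Qed.

(** Since [kd c] is killed, the differential of [c] is Koszul-closed, hence of the form [kd c'], and
    [kd c'] is killed in turn as an image of the differential. Positivity of [q] keeps the descent
    away from constant terms. *)
Lemma zigzag_down p q (c : seq 'I_n -> 'cV[E]_(rk F p)) : chain q c -> (0 < q)%N ->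
  (p + q)%N = N -> (forall s, (size s).+1 = q -> killed (kd c s)) ->
  exists2 eta, closed_form eta & zigzag q c eta.
Proof.
elim: p q c => [|p IHp] q c cc q0 pq ck.
  exists (ed (fun s => (eps *m c s) 0 0)); last by split.
  have es : symf (fun s => (eps *m c s) 0 0) by case: cc => cs _ s s' /cs ->.
  split; first exact: ed_sym.
    move=> s sN; have sq : (size s).+1 = q by rewrite sN -pq.
    split; first by rewrite -mul_kdE; apply: ck.
    have h2 := @homog_ed (fun s => (eps *m c s) 0 0) (size s) (j - q%:Z).
    suff -> : 2 = j - q%:Z + 1 by apply: h2 => // s' s's; apply: eps_homog => //; rewrite s's.
    lia.
  by move=> s _; apply: ed_ed.
have [c' c'ch c'E] : exists2 c', chain q.+1 c' & forall s,
  size s = q -> diff F p *m c s = kd c' s.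
  apply: kd_exact; [exact: chain_diff| |lia].
  by move=> s sq; rewrite -mul_kd; apply: ck.
have [|||eta ecl z] := IHp q.+1 c' c'ch => //; first lia.
  by move=> s [sq]; rewrite -c'E //; apply/killedP; exists (c s).
by exists eta => //; split=> //; exists c'.
Qed.

(** When the form at the end is zero, the bottom of the zigzag is a Koszul boundary modulo [I].
    Correcting each step by the Koszul boundary found below it carries this back up to [c]. *)
Lemma zigzag_boundary p q (c : seq 'I_n -> 'cV[E]_(rk F p)) eta :
  zigzag q c eta -> (p + q)%N = N -> (forall s, (size s).+1 = N -> eta s = 0) ->
  exists2 b : seq 'I_n -> 'cV[E]_(rk F p), chain q.+1 b &
    forall s, size s = q -> killed (c s - kd b s).
Proof.
elim: p q c => [|p IHp] q c [cc ez] pq eta0.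
  have es : symf (fun s => (eps *m c s) 0 0) by case: cc => cs _ s s' /cs ->.
  pose f := ehom (fun s => (eps *m c s) 0 0).
  have fE s : size s = q -> (eps *m c s) 0 0 = ed f s.
    apply: (poincare es); first by lia.
    by move=> s' s'q; rewrite -ez // eta0 // -pq s'q.
  have fh s : size s = q.+1 -> ext_homog (j - q.+1%:Z) (f s).
    move=> sq; have := ehom_homog (f := fun s => (eps *m c s) 0 0)
      (fun s e => eps_homog cc e) sq.
    by congr ext_homog; lia.
  have [b bc bE] := lift_eps (ehom_sym es) fh; exists b => // s sq /=.
  rewrite mulmxBE mul_kdE fE // -edB (_ : ed _ s = 0) ?mem0v //.
  rewrite -[RHS](ed0 _ s); apply: eq_ed => i; have sq' : size (i :: s) = q.+1 by rewrite /= sq.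
  (* At the bottom [q = N], so this degree is 0, where [I] vanishes: the lift modulo [I] is an
     equality. *)
  apply: (@Ilow (j - q.+1%:Z)); [lia|exact: bE|].
  by apply: homogB; [exact: fh|exact: eps_homog].
case: ez => c' z' Dc.
have [||b' bc' bE] := IHp q.+1 c' z' => //; first lia.
have [|b bc bE'] := lift_diff (chainB (zigzag_chain z') (chain_kd bc')).
  exact: bE.
exists b => // s sq /=; rewrite mulmxBr Dc // mul_kd -kdB.
rewrite (@eq_kd _ _ (kd b')) ?kd_kd //; first by case: bc'.
move=> i; have sq' : size (i :: s) = q.+1 by rewrite /= sq.
by rewrite -bE' // opprB addrC subrK.
Qed.

(** A boundary of the double complex has zero form. Subtracting the differential of [b] from the
    next element of the zigzag leaves a Koszul boundary, so the hypothesis passes down to F_0; there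
    [kd b] contributes [ed (ed _)] and [b'] contributes an element of [I] of degree 1. *)
Lemma zigzag_inj p q (c : seq 'I_n -> 'cV[E]_(rk F p)) eta :
  zigzag q c eta -> (p + q)%N = N ->
  (exists (b : seq 'I_n -> 'cV[E]_(rk F p)) (b' : seq 'I_n -> 'cV[E]_(rk F p.+1)),
    [/\ chain q.+1 b, chain q b' &
        forall s, size s = q -> c s = kd b s + diff F p *m b' s]) ->
  forall s, (size s).+1 = N -> eta s = 0.
Proof.
elim: p q c => [|p IHp] q c [cc ez] pq [b [b' [bc b'c cE]]].
  move=> s sN; have sq : (size s).+1 = q by rewrite sN -pq.
  rewrite ez // (eq_ed (f' := ed (fun s => (eps *m b s) 0 0))) ?ed_ed //.
    by case: bc => bs _ s1 s2 /bs ->.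
  move=> i; rewrite cE // mulmxDE mul_kdE [X in _ + X](_ : _ = 0) ?addr0 //.
  apply: (@Ilow (j - q%:Z)); first by lia.
    by apply/(killedP (p := 0)); exists (b' (i :: s)).
  by apply: (eps_homog (chain_diff b'c)).
case: ez => c' z' Dc; apply: (IHp q.+1 c' z'); first lia.
have [|//|b'' b''c b''E] := kd_exact (chainB (zigzag_chain z') (chain_diff bc)).
- move=> s [sq]; rewrite kdB -Dc // -mul_kd cE // mulmxDr mulmxA.
  rewrite (_ : diff F p *m diff F p.+1 = 0) ?mul0mx ?addr0 ?subrr //.
  apply/matrixP => x y.
  have : diff F p *m col y (diff F p.+1) = 0.
    by apply/(killedP (p := p.+1)); exists (delta_mx y 0); rewrite -colE.
  by move/colP/(_ x); rewrite !mxE => h; rewrite -[RHS]h; apply: eq_bigr => z _; rewrite mxE.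
exists b'', b; split=> // s sq; by rewrite -b''E // subrK.
Qed.

Lemma zigzagD p q (x : k) (c c' : seq 'I_n -> 'cV[E]_(rk F p)) eta eta' :
  zigzag q c eta -> zigzag q c' eta' ->
  zigzag q (fun s => x%:A *: c s + c' s) (fun s => x *: eta s + eta' s).
Proof.
have cD p' q' (d d' : seq 'I_n -> 'cV[E]_(rk F p')) : chain q' d -> chain q' d' ->
    chain q' (fun s => x%:A *: d s + d' s).
  move=> [ds dh] [ds' dh']; split; first by move=> s s' ss'; rewrite (ds _ _ ss') (ds' _ _ ss').
  move=> s sq a; rewrite !mxE -ext_scaleAl mul1r.
  by apply: homogD; [apply: homogZ; apply: dh | apply: dh'].
have mulA r r' (D : 'M[E]_(r', r)) (v : 'cV[E]_r) : D *m (x%:A *: v) = x%:A *: (D *m v).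
  apply/colP => a; rewrite !mxE mulr_sumr; apply: eq_bigr => b _.
  by rewrite mxE -!ext_scaleAl !mul1r ext_scaleAr.
elim: p q c c' => [|p IHp] q c c' [cc ez] [cc' ez']; split; try exact: cD.
  move=> s sq; rewrite ez // ez' // -edD; apply: eq_ed => i.
  by rewrite mulmxDE mulA; congr (_ + _); rewrite [RHS]mxE -ext_scaleAl mul1r.
case: ez => d zd Dc; case: ez' => d' zd' Dc'.
exists (fun s => x%:A *: d s + d' s); first exact: IHp.
by move=> s sq; rewrite kdD mulmxDr mulA Dc // Dc'.
Qed.

Lemma zigzag0 p q : zigzag q (fun=> 0 : 'cV[E]_(rk F p)) (fun=> 0).
Proof.
elim: p q => [|p IHp] q; split; try by split=> // s sq a; rewrite mxE; apply: homog0.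
  by move=> s _; rewrite (eq_ed (f' := fun=> 0)) ?ed0 // => i; rewrite mulmx0 mxE.
by exists (fun=> 0) => // s _; rewrite kd0 mulmx0.
Qed.

End LinearStrand.

(** [Gam] behaves like the graph of an isomorphism from Z / B to W. Values chosen on a basis of [Z]
    extend to a linear map whose graph lies in [Gam]; having no indeterminacy, [Gam] coincides with
    this graph over [Z], so the map is onto with kernel [B]. *)
Lemma dim_linear_relation (k : fieldType) (V W : vectType k) (Z B : {vspace V})
    (Gam : V -> W -> Prop) :
  (forall a z z' w w', Gam z w -> Gam z' w' -> Gam (a *: z + z') (a *: w + w')) ->
  (B <= Z)%VS ->
  (forall z, z \in Z -> exists w, Gam z w) ->
  (forall w, exists2 z, z \in Z & Gam z w) ->
  (forall z, z \in Z -> Gam z 0 -> z \in B) ->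
  (forall z, z \in B -> Gam z 0) ->
  (forall w, Gam 0 w -> w = 0) ->
  (\dim Z = \dim B + dim W)%N.
Proof.
move=> GD BZ Gtot Gsurj GB BG Ginj.
have [wf wfP] : exists wf : 'I_(\dim Z) -> W, forall i : 'I_(\dim Z), Gam (vbasis Z)`_i (wf i).
  apply: (@fin_all_exists _ _ (fun (i : 'I_(\dim Z)) w => Gam (vbasis Z)`_i w)) => i; apply: Gtot.
  by apply: vbasis_mem; rewrite mem_nth // size_tuple.
pose f z := \sum_i coord (vbasis Z) i z *: wf i.
have fl : linear f.
  move=> a u v; rewrite /f scaler_sumr -big_split; apply: eq_bigr => i _ /=.
  by rewrite linearP scalerDl scalerA.
have G0 : Gam 0 0 by apply: BG; apply: mem0v.
have Gf z : z \in Z -> Gam z (f z).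
  move=> zZ; rewrite {1}(coord_vbasis zZ) /f.
  apply: (big_ind2 Gam) => // [z1 w1 z2 w2 h1 h2|i _].
    by have := GD 1 _ _ _ _ h1 h2; rewrite !scale1r.
  by have := GD (coord (vbasis Z) i z) _ _ _ _ (wfP i) G0; rewrite !addr0.
have Gu z w : z \in Z -> Gam z w -> w = f z.
  move=> /Gf zf zw; have := GD (-1) _ _ _ _ zf zw.
  by rewrite !scaleN1r addNr => /Ginj/eqP; rewrite addrC subr_eq0 => /eqP.
rewrite -(limg_ker_dim (linfun f) Z); congr (_ + _)%N.
  congr (\dim _); apply/vspaceP => z; rewrite memv_cap memv_ker linfunE' //.
  apply/andP/idP => [[zZ /eqP f0]|zB].
    by apply: GB => //; rewrite -f0; apply: Gf.
  have zZ := subvP BZ _ zB; split=> //; apply/eqP; apply/esym; exact: Gu (BG _ zB).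
rewrite -dimvf; congr (\dim _); apply/vspaceP => w; rewrite memvf.
have [z zZ zw] := Gsurj w; apply/memv_imgP; exists z => //.
by rewrite linfunE' //; apply: Gu.
Qed.

(** * The linear strand as a space of closed forms *)

Section TorStrand.
Variables (k : fieldType) (n : nat).
Notation E := (extalg k n).
Variables (I : {vspace E}) (F : grfree k n) (eps : 'rV[E]_(rk F 0)).
Hypothesis resF : resolution I eps.
Hypothesis Igr : forall m x, x \in I -> pr m x \in I.
Hypothesis Ilow : forall m x, m <= 1 -> x \in I -> ext_homog m x -> x = 0.

Lemma mem_piece p j (z : 'cV[k]_(rk F p)) :
  reflect (forall a, gdeg a != j -> z a 0 = 0) (z \in piece F p j).
Proof.
apply: (iffP idP) => [/memv_sumP[f fP ->] a ja|z0].
  rewrite summxE big1 // => b /[dup] bj /fP/vlineP[x ->].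
  have /negPf ab : a != b by apply: contraNneq ja => ->.
  by rewrite !mxE ab mulr0.
have -> : z = \sum_(a | gdeg a == j) z a 0 *: delta_mx a 0.
  apply/colP => b; rewrite summxE; have [bj|bj] := boolP (gdeg b == j).
    rewrite (bigD1 b) //= big1 ?addr0; first by rewrite !mxE !eqxx mulr1.
    by move=> a /andP[_ ab]; rewrite !mxE eq_sym (negPf ab) mulr0.
  rewrite z0 // big1 // => a aj; have /negPf ba : b != a by apply: contraNneq bj => ->.
  by rewrite !mxE ba mulr0.
by apply: memv_suml => a aj; apply: (subvP (sumv_sup a aj (subvv _))); rewrite memvZ ?memv_line.
Qed.

Lemma ext_aug_mul r r' (D : 'M[E]_(r, r')) (w : 'cV[E]_r') a :
  ext_aug ((D *m w) a 0) = (map_mx (@ext_aug k n) D *m map_mx (@ext_aug k n) w) a 0.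
Proof.
rewrite !mxE [LHS]/ext_aug sum_ffunE; apply: eq_bigr => b _.
by rewrite -[LHS]/(ext_aug _) ext_augM !mxE.
Qed.

Lemma aug_const r (z : 'cV[k]_r) :
  map_mx (@ext_aug k n) (map_mx (fun x => x%:A : E) z) = z.
Proof. by apply/colP => a; rewrite !mxE /ext_aug -extb0 !ffunE eqxx /GRing.scale /= mulr1. Qed.

Lemma ed_aug (f : seq 'I_n -> E) s : ed f s set0 = 0.
Proof. by rewrite ed_coef big_set0. Qed.

Variable m : nat.
Notation N := m.+1.

(** Constant lifts split the augmentation and start the zigzags. The equation on degrees amounts to
    [q = 0]. *)
Lemma chain_const p q (z : 'cV[k]_(rk F p)) : (N.+1%:Z - q%:Z) = N.+1%:Z ->
  z \in piece F p N.+1 ->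
  chain (F := F) m q (fun=> map_mx (fun x => x%:A : E) z).
Proof.
move=> q0 /mem_piece z0; split=> // s _ a; rewrite mxE q0.
have [aj|/z0->] := eqVneq (gdeg a) (N.+1%:Z); last by rewrite scale0r; apply: homog0.
by rewrite aj subrr; apply: homogZ; have := @homogb k n set0; rewrite cards0.
Qed.

Lemma piece_aug p (v : 'cV[E]_(rk F p)) :
  (forall a, ext_homog (N.+1%:Z - gdeg a) (v a 0)) ->
  map_mx (@ext_aug k n) v \in piece F p N.+1.
Proof.
move=> vh; apply/mem_piece => a aj; rewrite mxE; apply/eqP; apply: contraNT aj.
by move=> /(vh a); rewrite cards0 => /eqP; rewrite eq_sym subr_eq0 eq_sym.
Qed.

Lemma diffk_homog_preim p (w : 'cV[k]_(rk F p.+1)) : diffk F p *m w \in piece F p N.+1 ->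
  exists2 w', w' \in piece F p.+1 N.+1 & diffk F p *m w = diffk F p *m w'.
Proof.
move=> /mem_piece z0; exists (\col_b if gdeg b == N.+1%:Z then w b 0 else 0).
  by apply/mem_piece => b /negPf bj; rewrite mxE bj.
apply/colP => a; rewrite [RHS]mxE; have [aj|/[dup] aj /z0->] := eqVneq (gdeg a) N.+1%:Z.
  rewrite mxE; apply: eq_bigr => b _; rewrite !mxE; case: eqP => // bj.
  rewrite /ext_aug (_ : diff F p a b set0 = 0) ?mul0r //; apply/eqP.
  by apply: contra_notT bj => /(@diff_homog _ _ F p); rewrite cards0 aj; lia.
rewrite big1 // => b _; rewrite !mxE; case: eqP => [bj|_]; last by rewrite mulr0.
rewrite /ext_aug (_ : diff F p a b set0 = 0) ?mul0r //; apply/eqP.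
by apply: contraNT aj => /(@diff_homog _ _ F p); rewrite cards0 bj => ?; apply/eqP; lia.
Qed.

Variable W : vectType k.
Variable Phi : W -> seq 'I_n -> E.
Hypothesis Phi_lin : forall a w w' s, Phi (a *: w + w') s = a *: Phi w s + Phi w' s.
Hypothesis Phi_closed : forall w, closed_form I m (Phi w).
Hypothesis Phi_surj : forall eta, closed_form I m eta ->
  exists w, forall s, size s = m -> eta s = Phi w s.
Hypothesis Phi_inj : forall w, (forall s, size s = m -> Phi w s = 0) -> w = 0.

Definition strand_rel (z : 'cV[k]_(rk F N)) (w : W) :=
  exists (c : seq 'I_n -> 'cV[E]_(rk F N)) eta,
    [/\ zigzag eps m 0 c eta, map_mx (@ext_aug k n) (c [::]) = z &
        forall s, size s = m -> eta s = Phi w s].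

Theorem tor_linear_strand : tor_dim F N N.+1%:Z = dim W.
Proof.
have Phi0 s : Phi 0 s = 0.
  by apply: (@addrI _ (1 *: Phi 0 s)); rewrite -Phi_lin !scale1r !addr0.
set Z := (cycles F N :&: piece F N N.+1)%VS; set B := (boundaries F N :&: piece F N N.+1)%VS.
rewrite /tor_dim -/Z -/B (_ : \dim Z = \dim B + dim W)%N ?addKn //.
have ZP z : z \in Z = (diffk F m *m z == 0) && (z \in piece F N N.+1).
  by rewrite memv_cap memv_ker linfunE' //; apply: mulmxk_linear.
apply: (dim_linear_relation (Gam := strand_rel)).
- move=> a z z' w w' [c [eta [zc <- eE]]] [c' [eta' [zc' <- eE']]].
  exists (fun s => a%:A *: c s + c' s), (fun s => a *: eta s + eta' s); split.
  + exact: zigzagD.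
  + by apply/colP => b; rewrite !mxE -ext_scaleAl mul1r [LHS]ffunE ffunE.
  + by move=> s sm; rewrite eE // eE' // Phi_lin.
- by apply: capvS => //; apply: boundaries_sub_cycles resF.
- move=> z; rewrite ZP => /andP[/eqP dz zp].
  pose c : seq 'I_n -> _ := fun=> map_mx (fun x => x%:A : E) z.
  have cc : chain (F := F) m 0 c by apply: chain_const; rewrite ?subr0.
  (* The cycle condition says that the differential of the constant lift has no constant term, so it
     is a Koszul boundary and the descent can start. *)
  have [||c' cc' c'E] := kd_exact (chain_diff cc); first by [].
    move=> _ a; rewrite -[LHS]/(ext_aug _) ext_aug_mul aug_const.
    by have /colP/(_ a) := dz; rewrite !mxE.
  have [|||eta ecl zz] := zigzag_down resF cc' => //.
  + by rewrite addn1.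
  + by move=> [|//] _; rewrite -c'E //; apply/(killedP resF); exists (c [::]).
  have [w wE] := Phi_surj ecl.
  by exists w, c, eta; split; [split=> //; exists c' | exact: aug_const |].
- move=> w; have [es eI ed0'] := Phi_closed w.
  (* A closed form has a potential with values in degree 1. As [I] vanishes there, its lift to F_0
     maps exactly onto it and starts an ascending zigzag. *)
  have wE s : size s = m -> Phi w s = ed (ehom (Phi w)) s.
    move=> sm; apply: (poincare es (q := m)) => //.
      move=> m0; apply/eqP; apply: contraTT isT => nz.
      by have [|_ /(_ _ nz)] := eI [::]; rewrite ?m0 // cards0.
    by move=> s' s'm; apply: ed0'; rewrite s'm.
  have fh s : size s = N -> ext_homog (N.+1%:Z - N%:Z) (ehom (Phi w) s).
    move=> sN; have := @ehom_homog _ _ (Phi w) m 2 _ s sN.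
    suff -> : 2 - 1 = N.+1%:Z - N%:Z by apply=> s' s'm; have [|] := eI s'; rewrite ?s'm.
    by lia.
  have fs := ehom_sym es.
  have [c0 c0c c0E] := lift_eps resF Igr fs fh.
  have z0 : zigzag eps m N c0 (Phi w).
    split=> // s [sm]; rewrite wE //; apply: eq_ed => i.
    have siN : size (i :: s) = N by rewrite /= sm.
    apply/eqP; rewrite -subr_eq0; apply/eqP; apply: (Ilow (m := N.+1%:Z - N%:Z)); first by lia.
      exact: c0E.
    by apply: homogB; [exact: fh | exact: (eps_homog resF c0c)].
  have up p q : (p + q)%N = N -> exists c : seq 'I_n -> 'cV[E]_(rk F p), zigzag eps m q c (Phi w).
    elim: p q => [|p IHp] q pq; first by rewrite -[q]add0n pq; exists c0.
    have [|c cz] := IHp q.+1; first lia.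
    apply: (zigzag_up resF cz) => //; first lia.
    by move=> s sN; have [] := eI s sN.
  have [|c cz] := up N 0%N; first by rewrite addn0.
  have [cs ch] := zigzag_chain cz.
  exists (map_mx (@ext_aug k n) (c [::])); last by exists c, (Phi w).
  rewrite ZP piece_aug; last by move=> a; have := ch [::] erefl a; rewrite subr0.
  rewrite andbT; apply/eqP/colP => a; rewrite -ext_aug_mul.
  case: cz => _ [c' _ ->] //; rewrite [RHS]mxE mxE; exact: ed_aug.
- move=> z zZ [c [eta [cz cE eE]]].
  have [||b _ bE] := zigzag_boundary resF Igr Ilow cz; first by rewrite addn0.
    by move=> s [sm]; rewrite eE.
  move: zZ; rewrite ZP => /andP[_ zp]; rewrite memv_cap zp andbT.
  have /(killedP resF)[v vE] := bE [::] erefl.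
  apply/memv_imgP; exists (map_mx (@ext_aug k n) v); first exact: memvf.
  rewrite linfunE'; last exact: mulmxk_linear.
  rewrite -cE; apply/colP => a; rewrite -ext_aug_mul -vE mxE.
  have -> : (c [::] - kd b [::]) a 0 = c [::] a 0 - ed (fun s => b s a 0) [::] by rewrite !mxE.
  by rewrite /ext_aug !ffunE ed_aug subr0.
- move=> z; rewrite memv_cap => /andP[/memv_imgP[v _]].
  rewrite linfunE'; last exact: mulmxk_linear.
  move=> -> /diffk_homog_preim[v' v'p ->].
  (* The differential of the constant lift of [v'] is killed by the next differential, so its zigzag
     continues by zeros and has form 0. *)
  pose c : seq 'I_n -> _ := fun=> map_mx (fun x => x%:A : E) v'.
  have cc : chain (F := F) m 0 c by apply: chain_const; rewrite ?subr0.
  exists (fun s => diff F N *m c s), (fun=> 0); split.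
  + split; first exact: chain_diff.
    exists (fun=> 0); first exact: zigzag0.
    move=> s _; rewrite kd0; have /(killedP resF (p := N)) // : exists w,
      diff F N *m c s = diff F N *m w.
    by exists (c s).
  + by apply/colP => a; rewrite mxE ext_aug_mul aug_const.
  + by move=> s _; rewrite Phi0.
- move=> w [c [eta [cz cE eE]]]; apply: Phi_inj => s sm; rewrite -eE //.
  have cc := zigzag_chain cz.
  (* The augmentation of [c [::]] is 0, so [c] is a Koszul boundary and [zigzag_inj] applies with
     [b' = 0]. *)
  have [||b bc bE] := kd_exact cc; first by [].
    by move=> _ a; have /colP/(_ a) := cE; rewrite !mxE.
  apply: (zigzag_inj resF Ilow cz); rewrite ?addn0 ?sm //.
  exists b, (fun=> 0); split=> //.
    by split=> // s' _ a; rewrite mxE; apply: homog0.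
  by move=> s' s'0; rewrite mulmx0 addr0 bE.
Qed.

End TorStrand.

(** * The graphic matroid *)

Lemma card_setU2_gt2 (T : finType) (A B : {set T}) :
  #|A| = 2%N -> #|B| = 2%N -> A != B -> (2 < #|A :|: B|)%N.
Proof.
move=> A2 B2 AB; rewrite ltnNge; apply: contra AB => U2.
have AU : A = A :|: B by apply/eqP; rewrite eqEcard subsetUl A2.
have BU : B = A :|: B by apply/eqP; rewrite eqEcard subsetUr B2.
by rewrite AU -BU.
Qed.

Section GraphicMatroid.
Variables (l : nat) (G : rel 'I_l).
Notation n := #|edges G|.
Implicit Types (a b c : 'I_n) (J : {set 'I_n}).

Definition ends a : {set 'I_l} := [set (enum_val a).1; (enum_val a).2].
Definition vertices J : {set 'I_l} := \bigcup_(a in J) ends a.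
Definition triangle J := (#|J| == 3%N) && (#|vertices J| == 3%N).
Definition clique (V : {set 'I_l}) :=
  [forall x in V, forall y in V, (x != y) ==> G x y].

Lemma edge_enum a : ((enum_val a).1 < (enum_val a).2)%N /\ G (enum_val a).1 (enum_val a).2.
Proof. by have := enum_valP a; rewrite inE => /andP. Qed.

Lemma card_ends a : #|ends a| = 2%N.
Proof.
have [lt _] := edge_enum a; rewrite /ends cards2.
by case: eqP lt => // ->; rewrite ltnn.
Qed.

Lemma ends_inj : injective ends.
Proof.
move=> a b; rewrite /ends => ab; apply: enum_val_inj.
have [la _] := edge_enum a; have [lb _] := edge_enum b.
case: (enum_val a) (enum_val b) la lb ab => [x y] [z t] /= xy zt ab.
have xE : x = z \/ x = t by apply/set2P; rewrite -ab set21.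
have yE : y = z \/ y = t by apply/set2P; rewrite -ab set22.
by case: xE yE xy => -> [] ->; rewrite ?ltnn // ltnNge (ltnW zt).
Qed.

Lemma vertices_cards2 a b : a != b -> (2 < #|ends a :|: ends b|)%N.
Proof. by move=> ab; rewrite card_setU2_gt2 ?card_ends // (inj_eq ends_inj). Qed.

Lemma ends_vertices a J : a \in J -> ends a \subset vertices J.
Proof. by move=> aJ; apply: (bigcup_sup a). Qed.

Lemma vertices2 J : (1 < #|J|)%N -> (2 < #|vertices J|)%N.
Proof.
case/card_gt1P => a [b [aJ bJ ab]]; apply: leq_trans (vertices_cards2 ab) _.
by apply: subset_leq_card; rewrite subUset !ends_vertices.
Qed.

(** The degrees of the vertices add up to twice the number of edges, so with more vertices than
    edges some vertex has degree at most 1. *)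
Lemma leaf J : (#|J| < #|vertices J|)%N -> exists v a,
  [/\ a \in J, v \in ends a & forall b, b \in J -> v \in ends b -> b = a].
Proof.
pose deg v := (\sum_(a in J) (v \in ends a))%N.
have degE : (\sum_(v in vertices J) deg v = 2 * #|J|)%N.
  rewrite /deg exchange_big /= mulnC -sum_nat_const; apply: eq_bigr => a aJ.
  rewrite -big_mkcondr sum1_card -(card_ends a); apply: eq_card => v.
  apply/andP/idP => [[]//|va]; split=> //; exact: (subsetP (ends_vertices aJ)).
move=> JV; have [v vV dv] : exists2 v, v \in vertices J & (deg v < 2)%N.
  apply/exists_inP; apply: contraLR JV => /exists_inPn d2.
  rewrite -leqNgt -(leq_pmul2l (ltn0Sn 1)) -degE mulnC -sum_nat_const.
  by apply: leq_sum => v /d2; rewrite -leqNgt.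
have [a aJ va] := bigcupP vV; exists v, a; split=> // b bJ vb; apply/eqP.
apply: contraLR dv => ba; rewrite -leqNgt /deg (bigD1 a) //= va.
by rewrite (bigD1 b) /= ?bJ // vb.
Qed.

Lemma clique_edge x y (symG : symmetric G) : x != y -> G x y -> exists a, ends a = [set x; y].
Proof.
move=> xy Gxy.
have [x' [y' [lt G' <-]]] : exists x' y' : 'I_l, [/\ (x' < y')%N, G x' y' & [set x';
  y'] = [set x; y]].
  case: (ltngtP x y) => [lt|lt|/val_inj e]; last by rewrite e eqxx in xy.
    by exists x, y.
  by exists y, x; rewrite symG setUC.
have pE : (x', y') \in edges G by rewrite inE lt.
by exists (enum_rank_in pE (x', y')); rewrite /ends enum_rankK_in.
Qed.

Lemma ends_adj a x y (symG : symmetric G) : ends a = [set x; y] -> x != y -> G x y.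
Proof.
have [lt Ga] := edge_enum a; rewrite /ends; case: (enum_val a) lt Ga => z t /= zt Gzt e xy.
have xE : x = z \/ x = t by apply/set2P; rewrite e set21.
have yE : y = z \/ y = t by apply/set2P; rewrite e set22.
by case: xE yE xy => -> [] ->; rewrite ?eqxx // symG.
Qed.

Section Arrangement.
Variable K : fieldType.
Notation H := (graphic (G := G) K).

Lemma mem_graphic a (z : 'rV[K]_l) :
  reflect {in ends a &, forall x y, z 0 x = z 0 y} (z \in H a).
Proof.
rewrite mem_hyperplane; apply: (iffP eqP) => [e x y|]; last by apply; rewrite !inE eqxx ?orbT.
by rewrite !inE => /orP[]/eqP-> /orP[]/eqP->.
Qed.

Lemma dim_graphic_ge (U : {vspace 'rV[K]_l}) a : (\dim U <= (\dim (U :&: H a)).+1)%N.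
Proof.
pose f := linfun (fun z : 'rV[K]_l => z 0 (enum_val a).1 - z 0 (enum_val a).2 : K^o).
have : (\dim (f @: U) <= 1)%N by apply: leq_trans (dimvS (subvf _)) _; rewrite dimvf.
by move=> f1; rewrite -(limg_ker_dim f U) -(addn1 (\dim (U :&: H a))) leq_add2l.
Qed.

(** Acyclicity is stated by counting vertices of subsets, which provides a leaf at each step.
    Removing the leaf edge strictly enlarges the intersection. *)
Lemma forest_codim J : (forall J', J' \subset J -> J' != set0 -> (#|J'| < #|vertices J'|)%N) ->
  (\dim (\bigcap_(a in J) H a)%VS + #|J| <= l)%N.
Proof.
elim: {J}#|J| {-2}J (erefl #|J|) => [|r IHr] J Jr forest.
  rewrite Jr addn0; apply: leq_trans (dimvS (subvf _)) _; by rewrite dimvf /dim /= mul1n.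
have J0 : J != set0 by rewrite -card_gt0 Jr.
have [v [a [aJ va leafv]]] := leaf (forest J (subxx _) J0).
have Jr' : #|J :\ a| = r by move: Jr; rewrite (cardsD1 a J) aJ => -[].
have := IHr _ Jr' (fun J' sJ => forest J' (subset_trans sJ (subsetDl _ _))).
apply: leq_trans; rewrite Jr Jr' addnS -addSn leq_add2r (big_setD1 a aJ) /=.
set U := (\bigcap_(b in J :\ a) H b)%VS.
rewrite ltn_neqAle dimvS ?capvSr // andbT; apply: contraTneq isT => dE.
have /eqP UE : (H a :&: U == U)%VS by rewrite eqEdim capvSr /= dE.
(* The coordinate vector of the leaf lies on every other hyperplane but not on that of the leaf
   edge. *)
pose z : 'rV[K]_l := delta_mx 0 v.
have zU : z \in U.
  rewrite /U; elim/big_ind: _ => [|V V' zV zV'|b]; rewrite ?memvf ?memv_cap ?zV //.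
  rewrite !inE => /andP[ba bJ]; apply/mem_graphic.
  have vb x : x \in ends b -> z 0 x = 0.
    rewrite mxE eqxx /=; case: (x =P v) => //= -> vb; by rewrite (leafv b) ?eqxx in ba.
  by move=> x y /vb-> /vb ->.
move: zU; rewrite -UE memv_cap => /andP[/mem_graphic zH _].
have [w wa wv] : exists2 w, w \in ends a & w != v.
  have : (1 < #|ends a|)%N by rewrite card_ends.
  case/card_gt1P => x [y [xa ya xy]]; have [xv|xv] := eqVneq x v; last by exists x.
  by exists y; rewrite // -xv eq_sym.
have := zH _ _ va wa; rewrite !mxE !eqxx (negPf wv) /= => /eqP.
by rewrite oner_eq0.
Qed.

(** A dependent set is not a forest, whereas one or two edges, or three edges on at least four
    vertices, form a forest. *)
Lemma dependent_card J : dependent H J -> (2 < #|J|)%N /\ (#|J| = 3%N -> triangle J).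
Proof.
have small J' : J' != set0 -> (#|J'| < 3)%N -> (#|J'| < #|vertices J'|)%N.
  rewrite -card_gt0; case c: #|J'| => [|[|[|]]] // _ _; last by apply: vertices2; rewrite c.
  have /card_gt0P[a aJ] : (0 < #|J'|)%N by rewrite c.
  by rewrite -(card_ends a); apply: subset_leq_card; apply: ends_vertices.
move=> dJ; have not_forest : ~ (forall J',
  J' \subset J -> J' != set0 -> (#|J'| < #|vertices J'|)%N).
  by move/forest_codim; move: dJ; rewrite /dependent /codim_cap; lia.
split=> [|J3].
  rewrite ltnNge; apply/negP => J2; apply: not_forest => J' sJ J0; apply: small => //.
  exact: leq_ltn_trans (subset_leq_card sJ) _.
rewrite /triangle J3 eqxx /= eqn_leq vertices2 ?J3 // andbT leqNgt; apply/negP => V3.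
apply: not_forest => J' sJ J0; have [J'J|] := eqVneq J' J; first by rewrite J'J J3.
by rewrite eqEcard sJ J3 -ltnNge; apply: small.
Qed.

(** Two edges of a triangle share a vertex, and the equations of their hyperplanes imply that of the
    third edge. *)
Lemma triangle_dependent J : triangle J -> dependent H J.
Proof.
case/andP=> /eqP J3 /eqP V3; rewrite /dependent /codim_cap J3.
have /card_gt1P[a [b [aJ bJ ab]]] : (1 < #|J|)%N by rewrite J3.
have sub : (H a :&: H b <= \bigcap_(c in J) H c)%VS.
  apply/subv_bigcapP => c cJ; apply/subvP => z;
    rewrite memv_cap => /andP[/mem_graphic za /mem_graphic zb].
  have VE : vertices J = ends a :|: ends b.
    by apply/esym/eqP; rewrite eqEcard subUset !ends_vertices //= V3 vertices_cards2.
  have [p pa pb] : exists2 p, p \in ends a & p \in ends b.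
    have /card_gt0P[p] : (0 < #|ends a :&: ends b|)%N.
      by have := cardsUI (ends a) (ends b); rewrite -VE V3 !card_ends; lia.
    by rewrite inE => /andP[]; exists p.
  have zp x : x \in ends c -> z 0 x = z 0 p.
    move/(subsetP (ends_vertices cJ)); rewrite VE inE.
    by case/orP => [xa|xb]; [apply: za | apply: zb].
  by apply/mem_graphic => x y /zp-> /zp->.
have := dimvS sub; have := dim_graphic_ge (H a) b.
have := dim_graphic_ge fullv a; rewrite capfv dimvf /dim /= mul1n; lia.
Qed.

Section OrlikSolomon2.
Variable k : fieldType.
Notation E := (extalg k n).
Notation OS := (os_ideal k H).

Definition triangle_span : {vspace E} := (\sum_(J | triangle J) <[ext_d (extb k J)]>)%VS.

(** The generator has degree [#|S| + #|J| - 1 + #|T|] with [#|J|] at least 3, so degree at most 2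
    leaves only empty multipliers and a triangle. *)
Lemma pr_os_gen m S J T : m <= 2 -> dependent H J ->
  pr m (extb k S * ext_d (extb k J) * extb k T : E) \in if m == 2 then triangle_span else 0%VS.
Proof.
move=> m2 dJ; have [J2 J3] := dependent_card dJ.
have hd : ext_homog (#|J|%:Z - 1) (ext_d (extb k J)).
  rewrite ext_db; apply: homog_sum => i iJ; apply: homogZ.
  have := @homogb k n (J :\ i); rewrite (cardsD1 i J) iJ PoszD.
  by rewrite (_ : 1 + _ - 1 = #|J :\ i|%:Z) // addrC addKr.
have hg := homogM (homogM (@homogb k n S) hd) (@homogb k n T).
have [mE|mE] := eqVneq (#|S|%:Z + (#|J|%:Z - 1) + #|T|%:Z) m; last first.
  by rewrite (pr_0 hg mE) mem0v.
have [S0 T0 J3'] : [/\ #|S| = 0, #|T| = 0 & #|J| = 3%N]%N by split; lia.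
rewrite (_ : m == 2); last by apply/eqP; lia.
rewrite -mE pr_id // (cards0_eq S0) (cards0_eq T0) extb0 mul1r mulr1.
by apply: (subvP (sumv_sup J (J3 J3') (subvv _))); rewrite memv_line.
Qed.

Lemma pr_os m x : m <= 2 -> x \in OS -> pr m x \in if m == 2 then triangle_span else 0%VS.
Proof.
move=> m2 xO; rewrite -(linfunE' (@pr_linear k n m)) memv_preim.
move: x xO; apply/subvP; apply: os_sub => J S T dJ.
by rewrite -memv_preim linfunE'; [apply: pr_os_gen | apply: pr_linear].
Qed.

Lemma os_low m x : m <= 1 -> x \in OS -> ext_homog m x -> x = 0.
Proof.
move=> m1 xO xm; have := pr_os (m := m) _ xO; rewrite pr_id //.
by rewrite (_ : m == 2 = false) ?memv0 => [/(_ _)/eqP|]; [apply; lia | lia].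
Qed.

Lemma os_deg2 x : ext_homog 2 x -> (x \in OS) = (x \in triangle_span).
Proof.
move=> x2; apply/idP/idP => [xO|]; first by have := pr_os (m := 2) _ xO; rewrite pr_id //; apply.
apply/subvP; apply/subv_sumP => J tJ; rewrite -memvE.
have := os_gen k set0 set0 (triangle_dependent tJ).
by rewrite extb0 mul1r mulr1.
Qed.

End OrlikSolomon2.
End Arrangement.

(** A complete subgraph contains every pair of its vertices as an edge, hence is determined by its
    vertex set. *)
Lemma kappaE r (symG : symmetric G) : kappa G r = #|[set V : {set 'I_l} | (#|V| == r.+1) &&
  clique V]|.
Proof.
pose sub V : {set 'I_l} * {set 'I_l * 'I_l} := (V, edges G :&: setX V V).
rewrite -(card_imset _ (_ : injective sub)); last by move=> V V' [].
apply: eq_card => -[V D]; rewrite inE; apply/andP/imsetP => /= [[sub_D]|].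
  case/existsP=> f /and3P[/injectiveP fI /eqP /= fV /forallP /= fE].
  have fED i j : (f i, f j) \in D \/ (f j, f i) \in D -> i != j.
    by move=> /orP h; have /forallP/(_ j)/eqP := fE i; rewrite h => <-.
  have Df i j : i != j -> (f i, f j) \in D \/ (f j, f i) \in D.
    by move=> h; apply/orP; have /forallP/(_ j)/eqP -> := fE i.
  have DE p : p \in D -> [/\ (p.1 < p.2)%N, G p.1 p.2, p.1 \in V & p.2 \in V].
    by move/(subsetP sub_D); rewrite !inE => /andP[/andP[-> ->] /andP[-> ->]].
  exists V; last congr (_, _).
    rewrite inE -fV card_imset // cardsT card_ord eqxx /=.
    apply/forall_inP => _ /imsetP[i _ ->]; apply/forall_inP => _ /imsetP[j _ ->].
    apply/implyP; rewrite (inj_eq fI) => /Df[/DE[_ //]|/DE[_ + _ _]].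
    by rewrite symG.
  apply/eqP; rewrite eqEsubset [X in X && _]sub_D /=; apply/subsetP => -[x y].
  rewrite !inE -fV /= => /andP[/andP[lt _]] /andP[/imsetP[i _ xE] /imsetP[j _ yE]].
  have ij : i != j by apply: contraTneq lt => ij; rewrite xE yE ij ltnn.
  case: (Df i j ij); first by rewrite xE yE.
  by case/DE=> /=; rewrite -xE -yE ltnNge (ltnW lt).
case=> W; rewrite inE => /andP[/eqP cW /forall_inP clW] [-> ->]; rewrite /is_subgraph subxx;
  split=> //.
pose f := [ffun i : 'I_r.+1 => enum_val (cast_ord (esym cW) i)].
have fI : injective f by move=> i j; rewrite !ffunE => /enum_val_inj/cast_ord_inj.
have fW i : f i \in W by rewrite ffunE; apply: enum_valP.
apply/existsP; exists f; apply/and3P; split; first exact/injectiveP.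
  rewrite eqEcard card_imset // cardsT card_ord cW leqnn andbT.
  by apply/subsetP => _ /imsetP[i _ ->].
apply/forallP => i; apply/forallP => j; rewrite !inE !fW /= !andbT.
have [->|ij] := eqVneq i j; first by rewrite ltnn.
have fij : f i != f j by rewrite (inj_eq fI).
have Gij : G (f i) (f j) by have /forall_inP/(_ _ (fW j))/implyP/(_ fij) := clW _ (fW i).
by rewrite Gij symG Gij !andbT; case: ltngtP fij => // /val_inj ->; rewrite eqxx.
Qed.

End GraphicMatroid.

(** * Closed quadratic forms *)

Section QuadraticForms.
Variables (k : fieldType) (n : nat).
Notation E := (extalg k n).
Notation g := (ext_gen k).
Implicit Types (a b c i : 'I_n) (x y : E) (s : seq 'I_n) (u v : 'I_n -> k).

(* The coefficient of g a * g b, alternating in a and b. *)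
Definition cf a b x : k := if a == b then 0 else (-1) ^+ (b < a)%N * x [set a; b].

Lemma cfP a b (z : k) x y : cf a b (z *: x + y) = z * cf a b x + cf a b y.
Proof.
rewrite /cf; case: eqP => _; first by rewrite mulr0 addr0.
by rewrite !ffunE /GRing.scale /= mulrDr mulrCA.
Qed.

Lemma cf0 a b : cf a b 0 = 0.
Proof. by rewrite /cf ffunE mulr0 if_same. Qed.

Lemma cfD a b x y : cf a b (x + y) = cf a b x + cf a b y.
Proof. by have := cfP a b 1 x y; rewrite scale1r mul1r. Qed.

Lemma cfZ a b (z : k) x : cf a b (z *: x) = z * cf a b x.
Proof. by have := cfP a b z x 0; rewrite addr0 cf0 addr0. Qed.

Lemma cfB a b x y : cf a b (x - y) = cf a b x - cf a b y.
Proof. by rewrite cfD -scaleN1r cfZ mulN1r. Qed.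

Lemma cf_sum a b (J : finType) (F : J -> E) : cf a b (\sum_j F j) = \sum_j cf a b (F j).
Proof. exact: (big_morph _ (cfD a b) (cf0 a b)). Qed.

Lemma cf_anti a b x : cf b a x = - cf a b x.
Proof.
rewrite /cf eq_sym; case: eqP => [_|/eqP ab]; first by rewrite oppr0.
rewrite setUC; case: ltngtP => [||/val_inj e]; last by rewrite e eqxx in ab.
  by rewrite expr1 expr0 mulN1r mul1r.
by rewrite expr1 expr0 mulN1r mul1r opprK.
Qed.

Lemma cfaa a x : cf a a x = 0.
Proof. by rewrite /cf eqxx. Qed.

Lemma cf_ext x : ext_homog 2 x -> (forall a b, cf a b x = 0) -> x = 0.
Proof.
move=> xh x0; apply/ffunP => S; rewrite [RHS]ffunE; apply/eqP; apply: contraT => nz.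
have [/eqP/cards2P[a [b [ab SE]]]] := xh S nz.
by have := x0 a b; move/eqP; rewrite /cf (negPf ab) mulf_eq0 signr_eq0 -SE (negPf nz).
Qed.

Definition lin u : E := \sum_i u i *: g i.

Lemma inversions11 a b : inversions [set a] [set b] = (b < a)%N.
Proof.
rewrite /inversions; case: (ltnP b a) => ba.
  rewrite (_ : [set p | _] = [set (a, b)]) ?cards1 //; apply/setP => -[i j].
  by rewrite !inE xpair_eqE /=; case: eqP => //= ->; case: eqP => //= ->; rewrite ba.
apply/eqP; rewrite cards_eq0; apply/eqP/setP => -[i j]; rewrite !inE /=.
by case: eqP => //= ->; case: eqP => //= ->; rewrite ltnNge ba.
Qed.

Lemma cf_gen a b i j : cf a b (g i * g j) =
  (a == i)%:R * (b == j)%:R - (a == j)%:R * (b == i)%:R.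
Proof.
have diag (x y : 'I_n) : x != y -> cf x y (g x * g y) = 1.
  move=> xy; rewrite /cf (negPf xy) /ext_gen extbM /wedge_coef disjoints1 inE xy.
  by rewrite !ffunE eqxx inversions11 /GRing.scale /= mulr1 -expr2 sqrr_sign.
have [->|ab] := eqVneq a b; first by rewrite cfaa mulrC subrr.
have [->|ij] := eqVneq i j; first by rewrite gen_sq cf0 subrr.
have [SE|SE] := eqVneq [set a; b] [set i; j]; last first.
  rewrite /cf (negPf ab) /ext_gen extbM !ffunE (negPf SE) scaler0 mulr0.
  case: (a =P i) SE => [->|_]; case: (b =P j) => [->|_]; rewrite ?eqxx //=.
  - by rewrite (negPf ij) !mul0r !mulr0 subr0.
  - by rewrite [j == i]eq_sym (negPf ij) !mul0r !mulr0 subr0.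
  - case: (a =P j) => [->|_]; case: (b =P i) => [->|_]; rewrite ?mul0r ?mulr0 ?subr0 //.
    by rewrite setUC eqxx.
have aE : a = i \/ a = j by apply/set2P; rewrite -SE set21.
have bE : b = i \/ b = j by apply/set2P; rewrite -SE set22.
case: aE bE ab => -> [] ->; rewrite ?eqxx // => _;
  first by rewrite diag // (negPf ij) mul0r subr0 mulr1.
rewrite genM_anti -scaleN1r cfZ diag; last by rewrite eq_sym.
by rewrite (negPf ij) mulr0 sub0r !mulr1.
Qed.

Lemma cf_lin a b u v : cf a b (lin u * lin v) = u a * v b - u b * v a.
Proof.
rewrite /lin mulr_suml cf_sum.
under eq_bigr => i _.
  rewrite mulr_sumr cf_sum.
  under eq_bigr => j _ do rewrite -ext_scaleAl -ext_scaleAr !cfZ cf_gen.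
  over.
have one (f : 'I_n -> k) (d : 'I_n) : \sum_i f i * (d == i)%:R = f d.
  rewrite (bigD1 d) //= eqxx mulr1 big1 ?addr0 // => i /negPf di.
  by rewrite eq_sym di mulr0.
transitivity (\sum_i (u i * v b * (a == i)%:R - u i * v a * (b == i)%:R)).
  apply: eq_bigr => i _; rewrite -(one v b) -(one v a) !mulr_sumr !mulr_suml -sumrB.
  by apply: eq_bigr => j _; ring.
by rewrite sumrB !one; ring.
Qed.

Lemma homog_gen i : ext_homog 1 (g i).
Proof. by have := @homogb k n [set i]; rewrite cards1. Qed.

Lemma homog_lin u : ext_homog 1 (lin u).
Proof. by apply: homog_sum => i _; apply: homogZ; apply: homog_gen. Qed.

Lemma homog_linM u v : ext_homog 2 (lin u * lin v).
Proof. by have := homogM (@homog_lin u) (@homog_lin v). Qed.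

Lemma lin_sq u : lin u * lin u = 0.
Proof.
apply: cf_ext; first exact: homog_linM.
by move=> a b; rewrite cf_lin mulrC subrr.
Qed.

Lemma lin_anti u v : lin u * lin v = - (lin v * lin u).
Proof.
apply/eqP; rewrite -addr_eq0; apply/eqP/cf_ext.
  by apply: homogD; apply: homog_linM.
by move=> a b; rewrite cfD !cf_lin; ring.
Qed.

(** For distinct indices this is, up to sign, the coefficient of [ed f s] on the monomial of [a],
    [b], [c]. With a repetition the sum vanishes because [cf] is alternating. *)
Lemma cocycle (f : seq 'I_n -> E) s a b c : ed f s = 0 ->
  cf a b (f (c :: s)) + cf b c (f (a :: s)) + cf c a (f (b :: s)) = 0.
Proof.
move=> ed0.
have [->|ab] := eqVneq a b; first by rewrite cfaa add0r cf_anti addNr.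
have [->|bc] := eqVneq b c; first by rewrite cfaa addr0 cf_anti addNr.
have [->|ca] := eqVneq c a; first by rewrite cfaa addr0 cf_anti addNr.
have w3 (x y z : 'I_n) : x != y -> y != z -> z != x ->
    [set x; y; z] :\ z = [set x; y] /\
    wedge_coef k [set x; y] [set z] = (-1) ^+ (z < x)%N * (-1) ^+ (z < y)%N.
  move=> xy yz zx; split.
    apply/setP => t; rewrite !inE; have [->|_] := eqVneq t z; last by rewrite orbF.
    by rewrite (negPf zx) eq_sym (negPf yz).
  rewrite /wedge_coef disjoint_sym disjoints1 !inE (negPf zx) eq_sym (negPf yz) /=.
  by rewrite inversionsUl ?disjoints1 ?inE // !inversions11 exprD.
have bca : [set b; c; a] = [set a; b; c] by apply/setP => t; rewrite !inE; case: (t == a);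
  rewrite ?orbT ?orbF.
have cab : [set c; a; b] = [set a; b; c].
  by apply/setP => t; rewrite !inE; case: (t == c); rewrite ?orbT ?orbF.
have : ed f s [set a; b; c] = 0 by rewrite ed0 ffunE.
have [Sc wc] := w3 a b c ab bc ca; have [Sa wa] := w3 b c a bc ca ab.
have [Sb wb] := w3 c a b ca ab bc.
rewrite ed_coef (big_setD1 c) ?inE ?eqxx ?orbT //= Sc big_setU1 ?inE //= big_set1.
rewrite bca in Sa; rewrite cab in Sb; rewrite Sa Sb wa wb wc => h0.
rewrite /cf (negPf ab) (negPf bc) (negPf ca).
(* The prefactor is the sign that sorts [a], [b], [c]. *)
transitivity ((-1) ^+ (b < a)%N * (-1) ^+ (c < a)%N * (-1) ^+ (c < b)%N *
  (f (c :: s) [set a; b] * ((-1) ^+ (c < a)%N * (-1) ^+ (c < b)%N) +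
  (f (a :: s) [set b; c] * ((-1) ^+ (a < b)%N * (-1) ^+ (a < c)%N) +
   f (b :: s) [set c; a] * ((-1) ^+ (b < c)%N * (-1) ^+ (b < a)%N)))); last by rewrite h0 mulr0.
have val_neq (x y : 'I_n) : x != y -> (x < y)%N = ~~ (y < x)%N.
  by case: ltngtP => // /val_inj ->; rewrite eqxx.
rewrite (val_neq a b) // (val_neq b c) // (val_neq a c) 1?eq_sym //.
by case: (b < a)%N; case: (c < b)%N; case: (c < a)%N; rewrite /= ?expr0 ?expr1; ring.
Qed.

(* Functionals on polynomials play the role of divided powers: (prodl u v s)
   records the s-derivative of the forms in the divided power algebra of the
   plane spanned by the linear forms u and v. *)
Definition prodl u v s : {poly k} := \prod_(i <- s) ((u i)%:P + v i *: 'X).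
Definition pairing N (w : nat -> k) (p : {poly k}) : k := \sum_(j < N) w j * p`_j.

Lemma pairingP N w (z : k) p q : pairing N w (z *: p + q) = z * pairing N w p + pairing N w q.
Proof.
rewrite /pairing mulr_sumr -big_split; apply: eq_bigr => j _ /=.
by rewrite coefD coefZ; ring.
Qed.

Lemma pairingZ N w (z : k) p : pairing N w (z *: p) = z * pairing N w p.
Proof.
rewrite -[z *: p]addr0 pairingP -[RHS]addr0; congr (_ + _).
by rewrite /pairing big1 // => j _; rewrite coef0 mulr0.
Qed.

Lemma pairing_cons N w u v i s : pairing N w (prodl u v (i :: s)) =
  u i * pairing N w (prodl u v s) + v i * pairing N w ('X * prodl u v s).
Proof.
rewrite -[X in _ + X]pairingZ -pairingP; congr pairing.
by rewrite /prodl big_cons mulrDl mul_polyC -scalerAl.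
Qed.

Lemma size_prodl u v s : (size (prodl u v s) <= (size s).+1)%N.
Proof.
rewrite /prodl; elim: s => [|i s IHs]; first by rewrite big_nil size_poly1.
rewrite big_cons; apply: leq_trans (size_polyMleq _ _) _.
have : (size ((u i)%:P + v i *: 'X)%R <= 2)%N.
  apply: leq_trans (size_polyD _ _) _; rewrite geq_max (leq_trans (size_polyC_leq1 _)) //.
  by apply: leq_trans (size_scale_leq _ _) _; rewrite size_polyX.
by move=> h; rewrite -subn1 leq_subLR add1n; apply: leq_add h IHs.
Qed.

Lemma prodl_sym u v : symf (prodl u v).
Proof. by move=> s s'; apply: perm_big. Qed.

(** The form f(u, v) uv, where [w j] is the coefficient of the j-th divided power of v in f and [N]
    exceeds the degree. *)
Definition contrib N u v w s : E := pairing N w (prodl u v s) *: (lin u * lin v).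

Lemma contrib_sym N u v w : symf (contrib N u v w).
Proof. by move=> s s' /(prodl_sym u v) ss'; rewrite /contrib ss'. Qed.

(** The differential of f(u, v) is a combination of u and v, and both are annihilated by uv. *)
Lemma contrib_closed N u v w s : ed (contrib N u v w) s = 0.
Proof.
set p := prodl u v s.
transitivity (lin u * lin v *
    (pairing N w p *: lin u + pairing N w ('X * p) *: lin v)).
  rewrite /lin [X in _ = _ * X](_ : _ = \sum_i pairing N w (prodl u v (i :: s)) *: g i).
    rewrite mulr_sumr; apply: eq_bigr => i _.
    by rewrite /contrib -ext_scaleAr -ext_scaleAl.
  rewrite !scaler_sumr -big_split; apply: eq_bigr => i _ /=.
  by rewrite pairing_cons scalerDl !scalerA; congr (_ *: _ + _ *: _); rewrite mulrC.
rewrite mulrDr -!ext_scaleAr -[X in _ + _ *: X]mulrA lin_sq mulr0 scaler0 addr0.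
by rewrite (lin_anti u v) mulNr -mulrA lin_sq mulr0 oppr0 scaler0.
Qed.

(** If every derivative of [f] is the combination with coefficients [u i] and [v i] of those along
    [a] and [b], then [f] is a divided power expression in u and v. Its coefficients are the values
    on words in [a] and [b], where u and v are dual to the two directions. *)
Lemma pairing_rec u v a b (f : seq 'I_n -> k) m : symf f ->
  u a = 1 -> v a = 0 -> u b = 0 -> v b = 1 ->
  (forall i s, (size s).+1 = m -> f (i :: s) = u i * f (a :: s) + v i * f (b :: s)) ->
  forall s, size s = m ->
  f s = pairing m.+1 (fun j => f (nseq j b ++ nseq (m - j) a)) (prodl u v s).
Proof.
move=> fs ua va ub vb frec s sm; set w := fun j => _.
(* The letters of [s'] are traded one by one for [a] or [b]; ['X^j] records the letters [b] obtained
   so far. *)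
suff H s' j r : (size s' + (j + r))%N = m ->
    f (s' ++ nseq j b ++ nseq r a) = pairing m.+1 w (prodl u v s' * 'X^j).
  by have := H s 0%N 0%N; rewrite /= cats0 expr0 mulr1 !addn0; apply.
elim: s' j r => [|i s' IHs] j r.
  rewrite add0n /prodl big_nil mul1r /= => jr.
  have jm : (j < m.+1)%N by lia.
  rewrite /pairing (bigD1 (Ordinal jm)) //= coefXn eqxx mulr1 big1 ?addr0 => [|j' jj'].
    by rewrite /w; congr (f (_ ++ nseq _ _)); lia.
  by rewrite coefXn (_ : (_ == _) = false) ?mulr0 //; apply/negbTE.
rewrite /= addSn => sz; rewrite frec; last by rewrite !size_cat !size_nseq.
have -> : f (a :: s' ++ nseq j b ++ nseq r a) = f (s' ++ nseq j b ++ nseq r.+1 a).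
  by apply: fs; apply/permP => P; rewrite /= !count_cat /= !count_nseq addnCA; congr addn;
    rewrite addnCA.
have -> : f (b :: s' ++ nseq j b ++ nseq r a) = f (s' ++ nseq j.+1 b ++ nseq r a).
  by apply: fs; apply/permP => P; rewrite /= !count_cat /= !count_cat !count_nseq addnCA.
rewrite !IHs; [|lia..].
rewrite -[X in _ + X]pairingZ -pairingP; congr pairing.
rewrite /prodl big_cons mulrDl mul_polyC mulrDl -scalerAl -scalerAl.
by rewrite -scalerAl exprS mulrCA mulrA.
Qed.

End QuadraticForms.

(** * Coefficients of a closed form on the faces of a tetrahedron *)

Section Tetrahedron.
Variables (k : fieldType) (n : nat).

(* The edges of a complete graph on vertices 1, 2, 3, 4. *)
Record tetra := Tetra {t12 : 'I_n; t13 : 'I_n; t14 : 'I_n; t23 : 'I_n; t24 : 'I_n; t34 : 'I_n}.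

Definition tetra_seq (t : tetra) : seq 'I_n :=
  [:: t12 t; t13 t; t14 t; t23 t; t24 t; t34 t].
(** The matching 14|23 is the one subtracted in both forms, so that [tetra_u] and [tetra_v] are dual
    to the edges [t12] and [t13], as [pairing_rec] requires. *)
Definition tetra_u (t : tetra) i : k :=
  (i == t12 t)%:R + (i == t34 t)%:R - (i == t14 t)%:R - (i == t23 t)%:R.
Definition tetra_v (t : tetra) i : k :=
  (i == t13 t)%:R + (i == t24 t)%:R - (i == t14 t)%:R - (i == t23 t)%:R.

Variables (t : tetra) (m : nat) (q : 'I_n -> 'I_n -> seq 'I_n -> k).
Notation e12 := (t12 t). Notation e13 := (t13 t). Notation e14 := (t14 t).
Notation e23 := (t23 t). Notation e24 := (t24 t). Notation e34 := (t34 t).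
Hypothesis tU : uniq (tetra_seq t).

Lemma tetra_coef :
  [/\ tetra_u t e12 = 1, tetra_u t e34 = 1, tetra_u t e13 = 0 & tetra_u t e24 = 0] /\
  [/\ tetra_v t e12 = 0, tetra_v t e34 = 0, tetra_v t e13 = 1 & tetra_v t e24 = 1] /\
  [/\ tetra_u t e14 = -1, tetra_u t e23 = -1, tetra_v t e14 = -1 & tetra_v t e23 = -1].
Proof.
move: tU; rewrite /= !inE !negb_or -!andbA /tetra_u /tetra_v.
rewrite (eq_sym e13 e12) (eq_sym e14 e12) (eq_sym e23 e12) (eq_sym e24 e12) (eq_sym e34 e12).
rewrite (eq_sym e14 e13) (eq_sym e23 e13) (eq_sym e24 e13) (eq_sym e34 e13).
rewrite (eq_sym e23 e14) (eq_sym e24 e14) (eq_sym e34 e14).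
rewrite (eq_sym e24 e23) (eq_sym e34 e23) (eq_sym e34 e24) !eqxx.
do ![case/andP=> /negPf ->] => _.
by do !split; rewrite /=; ring.
Qed.

Lemma tetra_coef_out i : i \notin tetra_seq t -> tetra_u t i = 0 /\ tetra_v t i = 0.
Proof.
rewrite /tetra_seq !inE !negb_or /tetra_u /tetra_v.
by do ![case/andP=> /negPf ->]; move=> /negPf ->; split; rewrite /=; ring.
Qed.

(** These hypotheses abstract [q a b s = cf a b (eta s)] for a closed form [eta]. Each [q_cyc]
    carries the number of the vertex opposite to its face; [q_opp] treats opposite edges, and
    [q_out] says that an edge outside the tetrahedron leaves the coefficient of some face
    constant. *)
Hypothesis q_sym : forall a b, symf (q a b).
Hypothesis q_anti : forall a b s, q b a s = - q a b s.
Hypothesis q_cyc4 : forall s, size s = m.+1 -> q e23 e13 s = q e12 e23 s /\ q e13 e12 s = q e12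
  e23 s.
Hypothesis q_cyc3 : forall s, size s = m.+1 -> q e24 e14 s = q e12 e24 s /\ q e14 e12 s = q e12
  e24 s.
Hypothesis q_cyc2 : forall s, size s = m.+1 -> q e34 e14 s = q e13 e34 s /\ q e14 e13 s = q e13
  e34 s.
Hypothesis q_cyc1 : forall s, size s = m.+1 -> q e34 e24 s = q e23 e34 s /\ q e24 e23 s = q e23
  e34 s.
Hypothesis q_opp : forall s, size s = m.+1 -> [/\ q e12 e34 s = 0,
  q e13 e24 s = 0 & q e14 e23 s = 0].
Hypothesis q_cocycle : forall s, size s = m -> forall a b c,
  q a b (c :: s) + q b c (a :: s) + q c a (b :: s) = 0.
Hypothesis q_out : forall i, i \notin tetra_seq t ->
  exists2 p, p \in [:: (e12, e23); (e12, e24); (e13, e34); (e23, e34)] &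
  forall s, size s = m -> q p.1 p.2 (i :: s) = 0.

(** The sign compensates the coefficient -1 of uv at [e12], [e23]: [h1] and [h2] become the
    derivatives in u and in v of the polynomial sought. *)
Let h1 s := - q e12 e23 (e34 :: s).
Let h2 s := - q e12 e23 (e24 :: s).
Let h3 s := - q e12 e23 (e14 :: s).

(* The derivatives of the four coefficients along the edges through the vertex
   opposite to the triangle depend up to sign only on the perfect matching
   12|34, 13|24 or 14|23 that contains the edge. *)
Lemma tetra_matching s : size s = m ->
  [/\ q e12 e24 (e34 :: s) = h1 s, - q e13 e34 (e12 :: s) = h1 s & q e23 e34 (e12 :: s) = h1 s] /\
  [/\ q e12 e24 (e13 :: s) = h2 s, - q e13 e34 (e24 :: s) = h2 s & q e23 e34 (e13 :: s) = h2 s] /\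
  [/\ q e12 e24 (e23 :: s) = h3 s, - q e13 e34 (e23 :: s) = h3 s & q e23 e34 (e14 :: s) = h3 s] /\
  h3 s = - h1 s - h2 s.
Proof.
move=> sm; have coc := q_cocycle sm.
have sz i : size (i :: s) = m.+1 by rewrite /= sm.
have c4 i := q_cyc4 (sz i); have c3 i := q_cyc3 (sz i).
have c2 i := q_cyc2 (sz i); have c1 i := q_cyc1 (sz i).
have op i := q_opp (sz i).
(* Each identity is a cocycle relation between two opposite edges and a third one: the coefficient
   at the opposite edges vanishes, and the other two belong to the two faces through the third
   edge. *)
have [[A1 A2 A3] [B1 B2 B3]] : [/\ q e23 e34 (e12 :: s) = h1 s,
    - q e13 e34 (e12 :: s) = h1 s & q e12 e24 (e34 :: s) = q e23 e34 (e12 :: s)] /\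
  [/\ q e23 e34 (e13 :: s) = h2 s, q e12 e24 (e13 :: s) = h2 s &
      - q e13 e34 (e24 :: s) = q e23 e34 (e13 :: s)].
  split; split; apply/eqP; rewrite -subr_eq0 /h1 /h2; apply/eqP.
  - rewrite -[RHS](coc e12 e23 e34) (q_anti e12 e34); have [-> _ _] := op e23; ring.
  - rewrite -[RHS]oppr0 -[in RHS](coc e12 e13 e34) (q_anti e12 e34); have [-> _ _] := op e13.
    by rewrite (q_anti e13 e12); have [_ ->] := c4 e34; ring.
  - rewrite -[RHS](coc e12 e24 e34) (q_anti e12 e34); have [-> _ _] := op e24.
    by rewrite (q_anti e34 e24); have [-> _] := c1 e12; ring.
  - rewrite -[RHS]oppr0 -[in RHS](coc e13 e23 e24) (q_anti e13 e24); have [_ -> _] := op e23.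
    rewrite (q_anti e23 e13) (q_anti e24 e23); have [-> _] := c4 e24; have [_ ->] := c1 e13; ring.
  - rewrite -[RHS](coc e13 e12 e24) (q_anti e13 e24); have [_ -> _] := op e12.
    by have [_ ->] := c4 e24; ring.
  - rewrite -[RHS]oppr0 -[in RHS](coc e13 e34 e24) (q_anti e13 e24); have [_ -> _] := op e34.
    by have [-> _] := c1 e13; ring.
have [C1 C2 C3 D] : [/\ q e12 e24 (e23 :: s) = h3 s, - q e13 e34 (e23 :: s) = h3 s,
    q e23 e34 (e14 :: s) = - q e13 e34 (e23 :: s) &
    q e12 e24 (e34 :: s) + q e23 e34 (e14 :: s) - q e13 e34 (e24 :: s) = 0].
  split; [apply/eqP; rewrite -subr_eq0 /h3; apply/eqP .. |].
  - rewrite -[RHS](coc e14 e12 e23) (q_anti e14 e23); have [_ _ ->] := op e12.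
    by have [_ ->] := c3 e23; ring.
  - rewrite -[RHS]oppr0 -[in RHS](coc e14 e13 e23) (q_anti e14 e23); have [_ _ ->] := op e13.
    rewrite (q_anti e23 e13); have [_ ->] := c2 e23; have [-> _] := c4 e14; ring.
  - rewrite -[RHS]oppr0 -[in RHS](coc e14 e34 e23) (q_anti e14 e23); have [_ _ ->] := op e34.
    by rewrite (q_anti e34 e14) (q_anti e23 e34); have [-> _] := c2 e23; ring.
  (* The cocycle relation of the three edges at vertex 4 provides the relation between the
     matchings. *)
  rewrite -[RHS]oppr0 -[in RHS](coc e14 e24 e34) (q_anti e24 e14) (q_anti e34 e24).
  by have [-> _] := c3 e34; have [-> _] := c1 e14; have [-> _] := c2 e24; ring.
have D3 : h3 s = - h1 s - h2 s.
  apply/eqP; rewrite -subr_eq0 -[X in _ == X]D -[h1 s]A1 -[h2 s]B1 -B3 A3 C3 C2; apply/eqP; ring.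
by do !split; rewrite ?A3 ?B3 ?C3.
Qed.

(** Each [h] can be read on several faces, so second derivatives can be swapped and then read on
    another face; this makes them depend on matchings only. The last equality is the integrability
    condition that lets [h1] and [h2] come from one polynomial. *)
Lemma tetra_rec s i : (size s).+1 = m ->
  [/\ h1 (i :: s) = tetra_u t i * h1 (e12 :: s) + tetra_v t i * h1 (e13 :: s),
      h2 (i :: s) = tetra_u t i * h2 (e12 :: s) + tetra_v t i * h2 (e13 :: s) &
      h1 (e13 :: s) = h2 (e12 :: s)].
Proof.
move=> sm; have sz j : size (j :: s) = m by rewrite /= sm.
have M j := tetra_matching (sz j).
have sw a b x y : q a b (x :: y :: s) = q a b (y :: x :: s) by apply: symf_swap.
have [[U12 U34 U13 U24] [[V12 V34 V13 V24] [U14 U23 V14 V23]]] := tetra_coef.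
have h1_13 : h1 (e13 :: s) = h2 (e12 :: s).
  by have [[_ _ <-] _] := M e13; rewrite sw; have [_ [[_ _ ->] _]] := M e12.
have h1_24 : h1 (e24 :: s) = h2 (e12 :: s).
  by have [[_ <- _] _] := M e24; rewrite sw; have [_ [[_ -> _] _]] := M e12.
have h1_14 : h1 (e14 :: s) = h3 (e12 :: s).
  by have [[_ _ <-] _] := M e14; rewrite sw; have [_ [_ [[_ _ ->] _]]] := M e12.
have h1_23 : h1 (e23 :: s) = h3 (e12 :: s).
  by have [[_ <- _] _] := M e23; rewrite sw; have [_ [_ [[_ -> _] _]]] := M e12.
have h2_34 : h2 (e34 :: s) = h1 (e13 :: s).
  by have [_ [[<- _ _] _]] := M e34; rewrite sw; have [[-> _ _] _] := M e13.
have h3_34 : h3 (e34 :: s) = h1 (e23 :: s).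
  by have [_ [_ [[<- _ _] _]]] := M e34; rewrite sw; have [[-> _ _] _] := M e23.
have h2_14 : h2 (e14 :: s) = h3 (e13 :: s).
  by have [_ [[_ _ <-] _]] := M e14; rewrite sw; have [_ [_ [[_ _ ->] _]]] := M e13.
have h2_23 : h2 (e23 :: s) = h3 (e13 :: s).
  by have [_ [[<- _ _] _]] := M e23; rewrite sw; have [_ [_ [[-> _ _] _]]] := M e13.
have h3_24 : h3 (e24 :: s) = h2 (e23 :: s).
  by have [_ [_ [[_ <- _] _]]] := M e24; rewrite sw; have [_ [[_ -> _] _]] := M e23.
have sum x : h3 (x :: s) = - h1 (x :: s) - h2 (x :: s) by have [_ [_ [_ ->]]] := M x.
(* Edges of one matching are compared through [sum], since [h1] cannot be swapped with itself. *)
have h1_34 : h1 (e34 :: s) = h1 (e12 :: s).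
  have := sum e34; rewrite h3_34 h2_34 h1_23 sum -h1_13.
  by move/(congr1 (fun x => - x - h1 (e13 :: s))) => e;
    transitivity (- (- h1 (e34 :: s) - h1 (e13 :: s)) - h1 (e13 :: s)); [ring | rewrite -e; ring].
have h2_24 : h2 (e24 :: s) = h2 (e13 :: s).
  have := sum e24; rewrite h3_24 h2_23 h1_24 sum h1_13 => e.
  by transitivity (- (- h2 (e12 :: s) - h2 (e24 :: s)) - h2 (e12 :: s)); [ring | rewrite -e;
    ring].
case: (boolP (i \in tetra_seq t)) => [|iout]; last first.
  have [-> ->] := tetra_coef_out iout; rewrite !mul0r addr0.
  have [p + q0] := q_out iout; have [[A1 A2 A3] [[B1 B2 B3] _]] := M i.
  have {}q0 x : q p.1 p.2 (x :: i :: s) = 0 by rewrite sw q0.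
  rewrite !inE => /or4P[] /eqP pE; rewrite pE /= in q0.
  - by rewrite /h1 /h2 !q0 oppr0.
  - by rewrite -A1 -B1 !q0.
  - by rewrite -A2 -B2 !q0 oppr0.
  - by rewrite -A3 -B3 !q0.
rewrite !inE => /or4P[/eqP->|/eqP->|/eqP->|/or3P[] /eqP->].
- by rewrite U12 V12 !mul1r !mul0r !addr0.
- by rewrite U13 V13 !mul1r !mul0r !add0r.
- by rewrite U14 V14 h1_14 h2_14 !sum h1_13; split; ring.
- by rewrite U23 V23 h1_23 h2_23 !sum h1_13; split; ring.
- by rewrite U24 V24 h1_24 h2_24 h1_13; split; ring.
- by rewrite U34 V34 h1_34 h2_34 h1_13; split; ring.
Qed.

(** Integrates [h1] and [h2]. The four families are the faces opposite to 4, 3, 2, 1, each with the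
    edges outside it, and the signs are the coefficients of uv on these faces. *)
Lemma tetra_primitive : exists w : nat -> k, forall s, size s = m ->
  let H i := pairing m.+2 w (prodl (tetra_u t) (tetra_v t) (i :: s)) in
  [/\ forall i, i \in [:: e14; e24; e34] -> q e12 e23 (i :: s) = - H i,
      forall i, i \in [:: e13; e23; e34] -> q e12 e24 (i :: s) = H i,
      forall i, i \in [:: e12; e23; e24] -> q e13 e34 (i :: s) = - H i &
      forall i, i \in [:: e12; e13; e14] -> q e23 e34 (i :: s) = H i].
Proof.
have [[U12 U34 U13 U24] [[V12 V34 V13 V24] [U14 U23 V14 V23]]] := tetra_coef.
have h1s : symf h1 by move=> s s' ss'; rewrite /h1 (symf_cons _ (q_sym _ _) ss').
have h2s : symf h2 by move=> s s' ss'; rewrite /h2 (symf_cons _ (q_sym _ _) ss').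
have p1 := pairing_rec h1s U12 V12 U13 V13 (fun i s sm => let: And3 h _ _ := tetra_rec i sm in h).
have p2 := pairing_rec h2s U12 V12 U13 V13 (fun i s sm => let: And3 _ h _ := tetra_rec i sm in h).
(* In divided powers the derivative in u drops the last coefficient and the derivative in v drops
   the first. Hence [h1] supplies all coefficients but the last, which comes from [h2];
   integrability makes the overlap agree. *)
pose w j := if (j < m.+1)%N then h1 (nseq j e13 ++ nseq (m - j) e12) else h2 (nseq m e13).
have w1 s : size s = m -> pairing m.+2 w (prodl (tetra_u t) (tetra_v t) s) = h1 s.
  move=> sm; rewrite (p1 s sm) /pairing big_ord_recr /= [X in _ + _ * X]nth_default ?mulr0 ?addr0.
    by apply: eq_bigr => j _; rewrite /w ltn_ord.
  by rewrite -sm size_prodl.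
have w2 s : size s = m -> pairing m.+2 w ('X * prodl (tetra_u t) (tetra_v t) s) = h2 s.
  move=> sm; rewrite (p2 s sm) /pairing big_ord_recl coefXM mulr0 add0r.
  apply: eq_bigr => j _; rewrite coefXM /=; congr (_ * _); rewrite /w /bump add1n ltnS.
  have [jm|mj] := ltnP j m; last first.
    have -> : nat_of_ord j = m by have := ltn_ord j; lia.
    by rewrite subnn cats0.
  have [|_ _ h12] := @tetra_rec (nseq j e13 ++ nseq (m - j.+1) e12) e12.
    by rewrite size_cat !size_nseq; lia.
  rewrite [LHS]h12; apply: h2s; rewrite -(subnSK jm) /=; apply/permP => P.
  by rewrite /= !count_cat /= addnCA.
exists w => s sm H; have HE i : H i = tetra_u t i * h1 s + tetra_v t i * h2 s.
  by rewrite /H pairing_cons w1 // w2.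
have [[A1 A2 A3] [[B1 B2 B3] [[C1 C2 C3] D]]] := tetra_matching sm.
split=> i; rewrite !inE => /or3P[] /eqP->; rewrite HE.
- by rewrite U14 V14 -[LHS]opprK -/(h3 s) D; ring.
- by rewrite U24 V24 -[LHS]opprK -/(h2 s); ring.
- by rewrite U34 V34 -[LHS]opprK -/(h1 s); ring.
- by rewrite U13 V13 B1; ring.
- by rewrite U23 V23 C1 D; ring.
- by rewrite U34 V34 A1; ring.
- by rewrite U12 V12 -[LHS]opprK A2; ring.
- by rewrite U23 V23 -[LHS]opprK C2 D; ring.
- by rewrite U24 V24 -[LHS]opprK B2; ring.
- by rewrite U12 V12 A3; ring.
- by rewrite U13 V13 B3; ring.
- by rewrite U14 V14 C3 D; ring.
Qed.

End Tetrahedron.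

(** * Triangles and tetrahedra of a graph *)

Lemma card_set3 (T : finType) (x y z : T) : x != y -> x != z -> y != z ->
  #|[set x; y; z]| = 3%N.
Proof.
move=> xy xz yz; rewrite setUC cardsU1 cards2 !inE negb_or.
by rewrite [z == x]eq_sym xz [z == y]eq_sym yz xy.
Qed.

Section Cliques.
Variables (l : nat) (G : rel 'I_l).
Hypothesis symG : symmetric G.
Notation n := #|edges G|.
Notation ends := (ends (G := G)).
Notation vertices := (vertices (G := G)).
Notation triangle := (triangle (G := G)).
Implicit Types (a b c i : 'I_n) (J : {set 'I_n}) (V : {set 'I_l}).

Definition edgesin V : {set 'I_n} := [set c | ends c \subset V].

Lemma mem_edgesin V c : (c \in edgesin V) = (ends c \subset V).
Proof. by rewrite inE. Qed.

Lemma ends_draws V J : J \subset edgesin V ->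
  [set ends a | a in J] \subset [set A : {set 'I_l} | A \subset V & #|A| == 2%N].
Proof.
move/subsetP => JV; apply/subsetP => _ /imsetP[a /JV + ->].
by rewrite !inE card_ends eqxx andbT.
Qed.

Lemma card_edgesin V : clique G V -> #|edgesin V| = 'C(#|V|, 2).
Proof.
move=> clV; rewrite -cards_draws -(card_imset _ (@ends_inj _ G)).
congr #|pred_of_set _|; apply/eqP; rewrite eqEsubset ends_draws //=.
apply/subsetP => A; rewrite inE => /andP[AV /cards2P[x [y [xy AE]]]].
have [xV yV] : x \in V /\ y \in V by split; apply: (subsetP AV); rewrite AE !inE eqxx ?orbT.
have Gxy : G x y by have /forall_inP/(_ _ yV)/implyP/(_ xy) := forall_inP clV _ xV.
have [a aE] := clique_edge symG xy Gxy; apply/imsetP; exists a; last by rewrite AE.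
by rewrite inE aE -AE.
Qed.

Lemma sub_edgesin_vertices J : J \subset edgesin (vertices J).
Proof. by apply/subsetP => a aJ; rewrite inE ends_vertices. Qed.

Lemma triangle_draws J : triangle J ->
  [set ends a | a in J] = [set A : {set 'I_l} | A \subset vertices J & #|A| == 2%N].
Proof.
case/andP=> /eqP J3 /eqP V3; apply/eqP.
rewrite eqEcard ends_draws ?sub_edgesin_vertices //= cards_draws V3.
by rewrite (card_imset _ (@ends_inj _ G)) J3.
Qed.

(** Three edges on three vertices exhaust the pairs of vertices, so a triangle is recovered from its
    vertex set. *)
Lemma triangleE J : triangle J -> J = edgesin (vertices J).
Proof.
move=> tJ; apply/eqP; rewrite eqEsubset sub_edgesin_vertices; apply/subsetP => a.
rewrite inE => aV; have : ends a \in [set ends a | a in J].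
  by rewrite triangle_draws // inE aV card_ends.
by case/imsetP => b bJ /ends_inj ->.
Qed.

Lemma triangle_edge J x y : triangle J -> x \in vertices J -> y \in vertices J -> x != y ->
  exists2 a, a \in J & ends a = [set x; y].
Proof.
move=> tJ xV yV xy; have : [set x; y] \in [set ends a | a in J].
  by rewrite triangle_draws // inE cards2 xy subUset !sub1set xV yV.
by case/imsetP => a aJ ->; exists a.
Qed.

Lemma triangle_clique J : triangle J -> clique G (vertices J).
Proof.
move=> tJ; apply/forall_inP => x xV; apply/forall_inP => y yV; apply/implyP => xy.
have [a _ aE] := triangle_edge tJ xV yV xy; exact: ends_adj aE xy.
Qed.

Lemma sub_clique V V' : V' \subset V -> clique G V -> clique G V'.
Proof.
move=> sV clV; apply/forall_inP => x /(subsetP sV) xV.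
by apply/forall_inP => y /(subsetP sV) yV; have /forall_inP/(_ _ yV) := forall_inP clV _ xV.
Qed.

Lemma triangle_vertices J a b : triangle J -> a \in J -> b \in J -> a != b ->
  vertices J = ends a :|: ends b.
Proof.
case/andP=> _ /eqP V3 aJ bJ ab; apply/esym/eqP.
by rewrite eqEcard subUset !ends_vertices //= V3 vertices_cards2.
Qed.

Lemma edgesin_triangle V : #|V| = 3%N -> clique G V ->
  triangle (edgesin V) /\ vertices (edgesin V) = V.
Proof.
move=> V3 clV; have E3 := card_edgesin clV; rewrite V3 in E3.
have VE : vertices (edgesin V) = V.
  apply/eqP; rewrite eqEcard V3 vertices2 ?E3 // andbT.
  by apply/bigcupsP => a; rewrite inE.
by split=> //; rewrite /triangle E3 VE V3 !eqxx.
Qed.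

Lemma triangle_set3 J a b : triangle J -> a \in J -> b \in J -> a != b ->
  exists c, [/\ J = [set a; b; c], b != c & a != c].
Proof.
case/andP=> /eqP J3 _ aJ bJ ab; have := J3.
rewrite (cardsD1 a) aJ (cardsD1 b) !inE eq_sym ab bJ => -[] /eqP/cards1P[c cE].
have cin : c \in J :\ a :\ b by rewrite cE set11.
have [cb ca] : c != b /\ c != a by move: cin; rewrite !inE; case: (c == b); case: (c == a).
exists c; split; rewrite 1?eq_sym //; apply/setP => i.
have /setP/(_ i) := cE; rewrite !inE.
have [->|ia] := eqVneq i a; first by rewrite aJ.
by have [->|ib] := eqVneq i b; first by rewrite bJ.
Qed.

Definition cotri a b := [exists J, [&& triangle J, a \in J & b \in J]].

Lemma cotri_ends a b : a != b -> cotri a b -> #|ends a :|: ends b| = 3%N.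
Proof.
move=> ab /existsP[J /and3P[tJ aJ bJ]]; rewrite -(triangle_vertices tJ aJ bJ ab).
by have /andP[_ /eqP] := tJ.
Qed.

Lemma disjoint_cotri a b : [disjoint ends a & ends b] -> ~~ cotri a b.
Proof.
move=> dab; apply/negP => ct; have ab : a != b.
  apply: contraTneq dab => ->; rewrite -setI_eq0 setIid -card_gt0 card_ends //.
have := cotri_ends ab ct; rewrite cardsU (disjoint_setI0 dab) cards0 !card_ends.
by [].
Qed.

Lemma vertices3 a b c : vertices [set a; b; c] = ends a :|: ends b :|: ends c.
Proof. by rewrite /vertices !bigcup_setU !big_set1. Qed.

(** Ordered by the opposite vertex 4, 3, 2, 1, the edges of each face being in the cyclic order that
    matches the hypotheses [q_cyc]. *)
Definition tetra_triangles (t : tetra n) : seq {set 'I_n} :=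
  [:: [set t12 t; t23 t; t13 t]; [set t12 t; t24 t; t14 t];
      [set t13 t; t34 t; t14 t]; [set t23 t; t34 t; t24 t]].

(** The last two fields say that the face 123 and one more edge, to vertex 4, already span [V]; this
    is what separates different tetrahedra in [form_of_inj]. *)
Record tetraP V (t : tetra n) : Prop := TetraP {
  tetra_uniq : uniq (tetra_seq t);
  tetra_edges : edgesin V =i tetra_seq t;
  tetra_tri : forall J, J \in tetra_triangles t -> triangle J;
  tetra_all : forall J, triangle J -> J \subset edgesin V -> J \in tetra_triangles t;
  tetra_opp : [/\ ~~ cotri (t12 t) (t34 t), ~~ cotri (t13 t) (t24 t) & ~~ cotri (t14 t) (t23 t)];
  tetra_span34 : V \subset ends (t12 t) :|: ends (t23 t) :|: ends (t34 t);
  tetra_span24 : V \subset ends (t12 t) :|: ends (t23 t) :|: ends (t24 t)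
}.

Lemma tetra_exists V : #|V| = 4%N -> clique G V -> exists t, tetraP V t.
Proof.
move=> V4 clV.
have [p [q [r [s [VE pqrs]]]]] : exists p q r s, V = [set p; q; r; s] /\ uniq [:: p; q; r; s].
  have := enum_uniq V; have VE : V = [set x in enum V] by apply/setP => x; rewrite inE mem_enum.
  have : size (enum V) = 4%N by rewrite -cardE.
  case: (enum V) VE => [|p [|q [|r [|s []]]]] // -> _ u; exists p, q, r, s; split=> //.
  by apply/setP => x; rewrite !inE !orbA.
have /and5P[+ + + _ _] := pqrs; rewrite !inE !negb_or => /and3P[pq pr ps] /andP[qr qs] rs.
have E (x y : 'I_l) : x \in V -> y \in V -> x != y -> exists a, ends a = [set x; y].
  move=> xV yV xy; apply: (clique_edge symG xy).
  by have /forall_inP/(_ _ yV)/implyP/(_ xy) := forall_inP clV _ xV.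
have [pV qV rV sV] : [/\ p \in V, q \in V, r \in V & s \in V].
  by rewrite VE !inE !eqxx !orbT.
have [a12 E12] := E _ _ pV qV pq. have [a13 E13] := E _ _ pV rV pr.
have [a14 E14] := E _ _ pV sV ps. have [a23 E23] := E _ _ qV rV qr.
have [a24 E24] := E _ _ qV sV qs. have [a34 E34] := E _ _ rV sV rs.
pose t := Tetra a12 a13 a14 a23 a24 a34.
have sub : {subset enum (edgesin V) <= tetra_seq t}.
  move=> c; rewrite mem_enum inE => cV; have /eqP/cards2P[x [y [xy cE]]] := card_ends c.
  have i1 a : ends a = [set x; y] -> c = a by move=> aE; apply: ends_inj; rewrite aE.
  have i2 a : ends a = [set y; x] -> c = a by move=> aE; apply: i1; rewrite aE setUC.
  have [xV yV] : x \in V /\ y \in V by split; apply: (subsetP cV); rewrite cE !inE eqxx ?orbT.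
  move: xV yV; rewrite VE !in_setU !in_set1 -!orbA.
  have c_in e : c = e -> e \in tetra_seq t -> c \in tetra_seq t by move=> ->.
  case/or4P=> /eqP xE; case/or4P=> /eqP yE; subst x y; (try by rewrite eqxx in xy);
  [ apply: (c_in _ (i1 _ E12)) | apply: (c_in _ (i1 _ E13)) | apply: (c_in _ (i1 _ E14))
  | apply: (c_in _ (i2 _ E12)) | apply: (c_in _ (i1 _ E23)) | apply: (c_in _ (i1 _ E24))
  | apply: (c_in _ (i2 _ E13)) | apply: (c_in _ (i2 _ E23)) | apply: (c_in _ (i1 _ E34))
  | apply: (c_in _ (i2 _ E14)) | apply: (c_in _ (i2 _ E24)) | apply: (c_in _ (i2 _ E34)) ];
  by rewrite !inE eqxx ?orbT.
(* Both lists have six entries; with the inclusion [sub] this yields at once that [t] has no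
   repetition and exhausts the edges. *)
have sz : (size (tetra_seq t) <= size (enum (edgesin V)))%N.
  by rewrite -cardE card_edgesin // V4.
have tE := (uniq_min_size (enum_uniq _) sub sz).2.
have tr x y z a b c : ends a = [set x; y] -> ends b = [set y; z] -> ends c = [set x; z] ->
    uniq [:: x; y; z] -> triangle [set a; b; c] /\ vertices [set a; b; c] = [set x; y; z].
  move=> aE bE cE /=; rewrite !inE negb_or => /and3P[/andP[xy xz] yz _].
  have vE : vertices [set a; b; c] = [set x; y; z].
    rewrite vertices3 aE bE cE; apply/setP => w; rewrite !inE.
    by case: (w == x); case: (w == y); case: (w == z).
  have neq e e' w : w \in ends e -> w \notin ends e' -> e != e'.
    by move=> we; apply: contraNneq => <-.
  have ab : a != b by apply: (neq _ _ x); rewrite ?aE ?bE !inE ?eqxx // negb_or xy.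
  have ac : a != c by apply: (neq _ _ y);
    rewrite ?aE ?cE !inE ?eqxx ?orbT // negb_or yz eq_sym xy.
  have bc : b != c by apply: (neq _ _ y);
    rewrite ?bE ?cE !inE ?eqxx ?orbT // negb_or yz eq_sym xy.
  by split=> //; rewrite /triangle vE !card_set3.
have U3 (x y z : 'I_l) : x != y -> x != z -> y != z -> uniq [:: x; y; z].
  by move=> xy xz yz; rewrite /= !inE negb_or xy xz yz.
have [T4 V4'] := tr _ _ _ _ _ _ E12 E23 E13 (U3 _ _ _ pq pr qr).
have [T3 V3] := tr _ _ _ _ _ _ E12 E24 E14 (U3 _ _ _ pq ps qs).
have [T2 V2] := tr _ _ _ _ _ _ E13 E34 E14 (U3 _ _ _ pr ps rs).
have [T1 V1] := tr _ _ _ _ _ _ E23 E34 E24 (U3 _ _ _ qr qs rs).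
have span a b c : {subset [:: p; q; r; s] <= ends a :|: ends b :|: ends c} ->
    V \subset ends a :|: ends b :|: ends c.
  by move=> h; apply/subsetP => x; rewrite VE => xV; apply: h; move: xV; rewrite !inE -!orbA.
exists t; split.
- exact: leq_size_uniq (enum_uniq _) sub sz.
- by move=> c; rewrite -tE mem_enum.
- by move=> J; rewrite !inE => /or4P[] /eqP->.
(* A triangle inside [V] misses exactly one vertex, and that vertex determines it. *)
- move=> J tJ JV; have [/eqP J3 /eqP vJ3] := andP tJ.
  have vJV : vertices J \subset V by apply/bigcupsP => a /(subsetP JV); rewrite inE.
  have [x xV xJ] : exists2 x, x \in V & x \notin vertices J.
    by apply/subsetPn; apply/negP => /subset_leq_card; rewrite V4 vJ3.
  have JE (J' : {set 'I_n}) : triangle J' -> vertices J' = V :\ x -> J = J'.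
    move=> tJ' vJ'; rewrite (triangleE tJ) (triangleE tJ') vJ'; congr edgesin.
    apply/eqP; rewrite eqEcard subsetD1 vJV xJ /= vJ3.
    by have := cardsD1 x V; rewrite V4 xV add1n => -[<-].
  have vE (y z w : 'I_l) : V = [set x; y; z; w] -> x \notin [set y; z; w] -> [set y; z;
    w] = V :\ x.
    move=> -> xn; apply/setP => v; rewrite !inE; have [vx|] := eqVneq v x; last by rewrite -!orbA.
    by move: xn; rewrite !inE -vx => /negPf ->.
  move: xV; rewrite {1}VE !inE -!orbA => /or4P[]/eqP xE; subst x; apply/or4P.
  + apply: Or44; rewrite [J](JE _ T1) // V1; apply: vE; first exact: VE.
    by rewrite !inE !negb_or pq pr ps.
  + apply: Or43; rewrite [J](JE _ T2) // V2; apply: vE;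
      last by rewrite !inE !negb_or eq_sym pq qr qs.
    by rewrite VE; apply/setP => v; rewrite !inE; case: (v == p); case: (v == q);
      case: (v == r); case: (v == s).
  + apply: Or42; rewrite [J](JE _ T3) // V3; apply: vE;
      last by rewrite !inE !negb_or eq_sym pr eq_sym qr rs.
    by rewrite VE; apply/setP => v; rewrite !inE; case: (v == p); case: (v == q);
      case: (v == r); case: (v == s).
  + apply: Or41; rewrite [J](JE _ T4) // V4'; apply: vE;
      last by rewrite !inE !negb_or eq_sym ps eq_sym qs eq_sym rs.
    by rewrite VE; apply/setP => v; rewrite !inE; case: (v == p); case: (v == q);
      case: (v == r); case: (v == s).
- have disj (x y z w : 'I_l) : x != z -> x != w -> y != z -> y != w ->
      [disjoint [set x; y] & [set z; w]].
    move=> xz xw yz yw; rewrite -setI_eq0; apply/eqP/setP => v; rewrite !inE.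
    have [->|_] := eqVneq v x; first by rewrite (negPf xz) (negPf xw).
    by have [->|_] := eqVneq v y; first by rewrite (negPf yz) (negPf yw).
  split; apply: disjoint_cotri; rewrite /= ?E12 ?E13 ?E14 ?E23 ?E24 ?E34; apply: disj => //.
  + by rewrite eq_sym.
  + by rewrite eq_sym.
  + by rewrite eq_sym.
- by apply: span => x; rewrite /= E12 E23 E34 !inE => /or4P[]/eqP->; rewrite eqxx ?orbT.
- by apply: span => x; rewrite /= E12 E23 E24 !inE => /or4P[]/eqP->; rewrite eqxx ?orbT.
Qed.

End Cliques.

(** * Closed forms with values in the Orlik-Solomon ideal *)

Section ClosedForms.
Variables (k : fieldType) (l : nat) (G : rel 'I_l).
Hypothesis symG : symmetric G.
Notation n := #|edges G|.
Notation E := (extalg k n).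
Notation g := (ext_gen k).
Notation ends := (ends (G := G)).
Notation vertices := (vertices (G := G)).
Notation triangle := (triangle (G := G)).
Notation cotri := (cotri (G := G)).
Notation edgesin := (edgesin G).
Implicit Types (a b c i : 'I_n) (J : {set 'I_n}) (V : {set 'I_l}).

Notation TS := (triangle_span G k).

Definition ediff a c i : k := (i == a)%:R - (i == c)%:R.
Definition tri_form a b c : E := lin (ediff a c) * lin (ediff b c).

Lemma lin_ediff a c : lin (ediff a c) = g a - g c.
Proof.
rewrite /lin /ediff; under eq_bigr do rewrite scalerBl.
have one d : \sum_i (i == d)%:R *: g i = g d.
  rewrite (bigD1 d) //= eqxx scale1r big1 ?addr0 // => i /negPf ->.
  by rewrite scale0r.
by rewrite sumrB !one.
Qed.

Lemma cf_tri_form a b x y z : cf a b (tri_form x y z) =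
  ((a == x)%:R - (a == z)%:R) * ((b == y)%:R - (b == z)%:R)
  - ((b == x)%:R - (b == z)%:R) * ((a == y)%:R - (a == z)%:R).
Proof. by rewrite cf_lin. Qed.

(** By the Leibniz rule ∂(abc) = bc - ac + ab = (a - c)(b - c). The scalar is the sign that sorts
    the three indices. *)
Lemma ext_d_tri_form a b c : a != b -> a != c -> b != c ->
  exists2 e : k, e != 0 & tri_form a b c = e *: ext_d (extb k [set a; b; c]).
Proof.
move=> ab ac bc.
pose e1 := wedge_coef k [set a] [set b]; pose e2 := wedge_coef k ([set a] :|: [set b]) [set c].
have e0 (S T : {set 'I_n}) : [disjoint S & T] -> wedge_coef k S T != 0.
  by rewrite /wedge_coef => ->; rewrite signr_eq0.
exists (e1 * e2).
  rewrite mulf_neq0 // e0 //; first by rewrite disjoints1 inE.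
  by rewrite disjoint_sym disjoints1 !inE negb_or ![c == _]eq_sym ac bc.
have -> : tri_form a b c = ext_d (g a * (g b * g c)).
  rewrite !ext_d_genM ext_d_gen mulr1 /tri_form !lin_ediff mulrBl !mulrBr gen_sq subr0
    (genM_anti _ c b).
  by rewrite opprK opprB [RHS]addrC.
rewrite mulrA /ext_gen extbM -ext_scaleAl extbM scalerA ext_dZ; congr (_ *: _).
Qed.

Lemma triangle_neq a b c : triangle [set a; b; c] -> [/\ a != b, a != c & b != c].
Proof.
case/andP=> /eqP J3 _; split; apply: contraTneq isT => h; move: J3; rewrite h.
- by rewrite setUid cards2; case: eqP.
- by rewrite setUAC setUid cards2; case: eqP.
- by rewrite -setUA setUid cards2; case: eqP.
Qed.

Lemma tri_form_span J a b c : triangle J -> J = [set a; b; c] -> tri_form a b c \in TS.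
Proof.
move=> tJ JE; have [ab ac bc] : [/\ a != b, a != c & b != c] by apply: triangle_neq; rewrite -JE.
have [e _ ->] := ext_d_tri_form ab ac bc; apply: memvZ; rewrite -JE.
by apply: (subvP (sumv_sup J tJ (subvv _))); rewrite memv_line.
Qed.

Lemma span_ind (V : {vspace E}) :
  (forall a b c, a != b -> a != c -> b != c -> triangle [set a; b; c] -> tri_form a b c \in V) ->
  (TS <= V)%VS.
Proof.
move=> h; apply/subv_sumP => J tJ; rewrite -memvE.
have /card_gt1P[a [b [aJ bJ ab]]] : (1 < #|J|)%N by have /andP[/eqP->] := tJ.
have [c [JE bc ac]] := triangle_set3 tJ aJ bJ ab.
have [e e0 omE] := ext_d_tri_form ab ac bc.
have := h a b c ab ac bc; rewrite omE JE in tJ * => /(_ tJ)/(memvZ e^-1).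
by rewrite scalerA mulVf // scale1r.
Qed.

Lemma cf_linear a b : linear (cf a b : E -> k^o).
Proof. by move=> z x y; rewrite cfP. Qed.

Lemma cf_zero a b x : ~~ cotri a b -> x \in TS -> cf a b x = 0.
Proof.
move=> nct; pose f := linfun (cf a b : E -> k^o).
suff /subvP h : (TS <= lker f)%VS.
  by move/h; rewrite memv_ker linfunE' => [/eqP|]; last exact: cf_linear.
apply: span_ind => x1 y1 z1 _ _ _ tJ; rewrite memv_ker linfunE'; last exact: cf_linear.
rewrite cf_tri_form; apply/eqP.
have : (a \notin [set x1; y1; z1]) || (b \notin [set x1; y1; z1]).
  by rewrite -negb_and; apply: contra nct => h; apply/existsP; exists [set x1; y1; z1];
    rewrite tJ.
by rewrite !inE !negb_or -!andbA => /orP[]/and3P[/negPf-> /negPf-> /negPf->];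
   rewrite !(subr0, mul0r, mulr0).
Qed.

(** The form of the triangle itself is ab + bc + ca, with equal coefficients. Any other triangle
    shares at most one edge with it, so its form has none of these coefficients. *)
Lemma cf_cyc a b c x : triangle [set a; b; c] -> a != b -> a != c -> b != c ->
  x \in TS -> cf b c x = cf a b x.
Proof.
move=> tabc ab ac bc; pose F (x : E) : k^o := (cf b c x - cf a b x : k).
have Fl : linear F.
  by move=> z u v; rewrite /F !cfP /GRing.scale /=; ring.
suff /subvP h : (TS <= lker (linfun F))%VS.
  by move/h; rewrite memv_ker linfunE' // subr_eq0 => /eqP.
apply: span_ind => x1 y1 z1 xy xz yz tJ; rewrite memv_ker linfunE' // /F !cf_tri_form.
have [JE|JE] := eqVneq [set x1; y1; z1] [set a; b; c]; last first.
  have key u v : u \in [set a; b; c] -> v \in [set a; b; c] -> u != v ->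
      (u \notin [set x1; y1; z1]) || (v \notin [set x1; y1; z1]).
    move=> uJ vJ uv; rewrite -negb_and; apply: contra JE => /andP[uJ' vJ'].
    rewrite (triangleE tJ) (triangleE tabc).
    by rewrite (triangle_vertices tJ uJ' vJ' uv) (triangle_vertices tabc uJ vJ uv).
  have z u v : u \in [set a; b; c] -> v \in [set a; b; c] -> u != v ->
      cf u v (tri_form x1 y1 z1) = 0.
    move=> uJ vJ uv; have := key u v uJ vJ uv; rewrite cf_tri_form !inE !negb_or -!andbA.
    by case/orP=> /and3P[/negPf-> /negPf-> /negPf->]; rewrite !(subr0, mul0r, mulr0).
  by rewrite -!cf_tri_form !z ?subrr // !inE eqxx ?orbT.
have inJ w : w \in [set a; b; c] -> [\/ w = x1, w = y1 | w = z1].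
  by rewrite -JE !inE -orbA => /or3P[]/eqP->; [apply: Or31|apply: Or32|apply: Or33].
have yx : (y1 == x1) = false by rewrite eq_sym (negPf xy).
have zx : (z1 == x1) = false by rewrite eq_sym (negPf xz).
have zy : (z1 == y1) = false by rewrite eq_sym (negPf yz).
have [aJ bJ cJ] : [/\ a \in [set a; b; c], b \in [set a; b; c] & c \in [set a; b; c]].
  by rewrite !inE !eqxx !orbT.
move: (inJ _ aJ) (inJ _ bJ) (inJ _ cJ) ab ac bc => {tabc tJ JE inJ aJ bJ cJ F Fl}.
by case=> ->; case=> ->; case=> ->;
  rewrite ?eqxx ?(negPf xy) ?(negPf xz) ?(negPf yz) ?yx ?zx ?zy //= => _ _ _;
   apply/eqP; ring.
Qed.

Lemma cf_vanish J a b x : triangle J -> a \in J -> b \in J -> a != b -> x \in TS ->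
  cf a b x = 0 -> forall a' b', a' \in J -> b' \in J -> cf a' b' x = 0.
Proof.
move=> tJ aJ bJ ab xS x0 a' b'.
have [c [JE bc ac]] := triangle_set3 tJ aJ bJ ab.
have bca : [set b; c; a] = J by rewrite JE setUC setUA.
have x1 : cf b c x = 0 by rewrite (cf_cyc (a := a)) // -JE.
have x2 : cf c a x = 0 by rewrite (cf_cyc (a := b)) // ?bca // eq_sym.
rewrite JE !inE -!orbA => /or3P[]/eqP-> /or3P[]/eqP->;
  rewrite ?cfaa // cf_anti ?x0 ?x1 ?x2 ?oppr0 //;
  by rewrite cf_anti ?x0 ?x1 ?x2 ?oppr0.
Qed.

(** An element of the span has a single free coefficient per triangle, and none at pairs of edges
    outside a common triangle. *)
Lemma span_ext x : ext_homog 2 x -> x \in TS ->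
  (forall J, triangle J -> exists a b, [/\ a \in J, b \in J, a != b & cf a b x = 0]) ->
  x = 0.
Proof.
move=> xh xS h; apply: cf_ext => // a b.
have [/existsP[J /and3P[tJ aJ bJ]]|nct] := boolP (cotri a b); last exact: cf_zero.
have [a' [b' [a'J b'J ab' x0]]] := h J tJ.
exact: (cf_vanish tJ a'J b'J ab' xS x0).
Qed.

(** The product uv is the signed sum of the four face forms; the signs are the coefficients listed
    here. *)
Lemma tetra_form V t : tetraP V t ->
  lin (tetra_u k t) * lin (tetra_v k t) \in TS /\
  [/\ cf (t12 t) (t23 t) (lin (tetra_u k t) * lin (tetra_v k t)) = -1,
      cf (t12 t) (t24 t) (lin (tetra_u k t) * lin (tetra_v k t)) = 1,
      cf (t13 t) (t34 t) (lin (tetra_u k t) * lin (tetra_v k t)) = -1 &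
      cf (t23 t) (t34 t) (lin (tetra_u k t) * lin (tetra_v k t)) = 1].
Proof.
move=> tP; have [[U12 U34 U13 U24] [[V12 V34 V13 V24] [U14 U23 V14 V23]]] := tetra_coef k
  (tetra_uniq tP).
split; last by split; rewrite cf_lin ?U12 ?U34 ?U13 ?U24 ?V12 ?V34 ?V13 ?V24 ?U14 ?U23 ?V14
  ?V23; ring.
have -> : lin (tetra_u k t) * lin (tetra_v k t) =
    - tri_form (t12 t) (t23 t) (t13 t) + tri_form (t12 t) (t24 t) (t14 t)
    - tri_form (t13 t) (t34 t) (t14 t) + tri_form (t23 t) (t34 t) (t24 t).
  apply/eqP; rewrite -subr_eq0; apply/eqP; apply: cf_ext.
    do ![apply: homogB | apply: homogD | apply: homog_linM].
    by rewrite -scaleN1r; apply: homogZ; apply: homog_linM.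
  move=> a b; rewrite cfB !cfD -!scaleN1r !cfZ !cf_tri_form cf_lin /tetra_u /tetra_v.
  move: ((a == t12 t)%:R) ((a == t13 t)%:R) ((a == t14 t)%:R) ((a == t23 t)%:R)
    ((a == t24 t)%:R) ((a == t34 t)%:R) => a1 a2 a3 a4 a5 a6.
  move: ((b == t12 t)%:R) ((b == t13 t)%:R) ((b == t14 t)%:R) ((b == t23 t)%:R)
    ((b == t24 t)%:R) ((b == t34 t)%:R) => b1 b2 b3 b4 b5 b6.
  ring.
have tr := tetra_tri tP.
by rewrite !rpredD ?rpredN //; apply: tri_form_span => //; apply: tr; rewrite !inE eqxx ?orbT.
Qed.

End ClosedForms.

(** * Derivatives of the triangle coefficients of a closed form *)

Section Parametrization.
Variables (k : fieldType) (l : nat) (G : rel 'I_l).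
Hypothesis symG : symmetric G.
Notation n := #|edges G|.
Notation E := (extalg k n).
Notation g := (ext_gen k).
Notation ends := (ends (G := G)).
Notation vertices := (vertices (G := G)).
Notation triangle := (triangle (G := G)).
Notation cotri := (cotri (G := G)).
Notation edgesin := (edgesin G).
Implicit Types (a b c i : 'I_n) (J : {set 'I_n}) (V : {set 'I_l}).
Notation TS := (triangle_span G k).
Variable m : nat.

(** The closed forms of homological degree [m.+2], with the degree 2 part of the ideal replaced by
    the triangle span: the coefficients have degree [m.+1], which encodes [2 <= i]. *)
Definition tclosed (eta : seq 'I_n -> E) := [/\ symf eta,
  forall s, size s = m.+1 -> eta s \in TS /\ ext_homog 2 (eta s) &
  forall s, size s = m -> ed eta s = 0].

(** In the cocycle relation of [a], [b], [i], the two pairs containing [i] consist of disjoint edges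
    and lie in no triangle. *)
Lemma tclosed_disjoint eta J a b i s : tclosed eta -> triangle J ->
  [disjoint ends i & vertices J] -> a \in J -> b \in J -> size s = m ->
  cf a b (eta (i :: s)) = 0.
Proof.
move=> [es eS ed0] tJ dJ aJ bJ sm.
have inS j : eta (j :: s) \in TS by have [|] := eS (j :: s); rewrite //= sm.
have dis c : c \in J -> ~~ cotri c i /\ ~~ cotri i c.
  move=> cJ; split; apply: disjoint_cotri; last exact: disjointWr (ends_vertices cJ) dJ.
  by rewrite disjoint_sym; apply: disjointWr (ends_vertices cJ) dJ.
have := cocycle a b i (ed0 s sm).
by rewrite (cf_zero (dis b bJ).1) // (cf_zero (dis a aJ).2) // !addr0.
Qed.

Lemma ends2 i x y : x \in ends i -> y \in ends i -> x != y -> ends i = [set x; y].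
Proof.
move=> xi yi xy; apply/esym/eqP.
by rewrite eqEcard subUset !sub1set xi yi cards2 xy card_ends.
Qed.

(** If [i] touches the triangle at one vertex without lying in a K_4 with it, a suitable pair of
    edges of [J] again has only one surviving term in its cocycle relation with [i]. *)
Lemma tclosed_out eta J a b i s : tclosed eta -> triangle J -> i \notin J ->
  (forall V, #|V| = 4%N -> clique G V -> vertices J \subset V -> ~~ (ends i \subset V)) ->
  a \in J -> b \in J -> size s = m -> cf a b (eta (i :: s)) = 0.
Proof.
move=> ec tJ iJ noK4 aJ bJ sm.
have [dJ|] := boolP [disjoint ends i & vertices J]; first exact: (tclosed_disjoint ec tJ).
rewrite -setI_eq0 => /set0Pn[z]; rewrite inE => /andP[zi zJ].
have : ~~ (ends i \subset vertices J) by rewrite -mem_edgesin -(triangleE tJ).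
case/subsetPn=> w wi wJ.
have zw : z != w by apply: contraNneq wJ => <-.
have iE := ends2 zi wi zw; have Gzw := ends_adj symG iE zw.
have [es eS ed0] := ec; have /andP[_ /eqP J3] := tJ.
have inS j : eta (j :: s) \in TS by have [|] := eS (j :: s); rewrite //= sm.
(* If [w] were adjacent to all of [J], adding it to the triangle would give a K_4 containing [i]. *)
have [y yJ nGyw] : exists2 y, y \in vertices J & ~~ G y w.
  apply/exists_inP; apply: contraT; rewrite negb_exists_in => /forall_inP Gw.
  have {}Gw y : y \in vertices J -> G y w by move=> /Gw; rewrite negbK.
  have := noK4 (w |: vertices J).
  rewrite cardsU1 wJ J3 iE subUset !sub1set !inE eqxx zJ orbT subsetUr /= => -> //.
  apply/forall_inP => x; rewrite !inE => /predU1P[->|xJ]; apply/forall_inP => x';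
    rewrite !inE => /predU1P[->|x'J]; apply/implyP => xx'.
  - by rewrite eqxx in xx'.
  - by rewrite symG Gw.
  - by rewrite Gw.
  - by have /forall_inP/(_ _ x'J)/implyP/(_ xx') := forall_inP (triangle_clique symG tJ) _ xJ.
have yz : y != z by apply: contraNneq nGyw => ->.
have [x xJ [xy xz]] : exists2 x, x \in vertices J & x != y /\ x != z.
  have : (0 < #|vertices J :\ y :\ z|)%N.
    have := cardsD1 y (vertices J); rewrite J3 yJ (cardsD1 z (_ :\ _)) !inE eq_sym yz zJ.
    by case: #|_|.
  case/card_gt0P => x; rewrite !inE => /and3P[xz xy xJ]; by exists x.
(* The edge xy is disjoint from [i = zw], and a triangle containing yz and zw would need the missing
   edge yw. *)
have [e1 e1J E1] := triangle_edge tJ xJ yJ xy.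
have [e2 e2J E2] := triangle_edge tJ yJ zJ yz.
have yw : y != w by apply: contraNneq wJ => <-.
have e12 : e1 != e2.
  apply: contraNneq xy => e; have : x \in ends e2 by rewrite -e E1 set21.
  by rewrite E2 !inE (negPf xz) orbF.
have n2i : ~~ cotri e2 i.
  apply: contra nGyw => /existsP[J' /and3P[tJ' e2J' iJ']].
  have e2i : e2 != i by apply: contraNneq iJ => <-.
  have vJ' := triangle_vertices tJ' e2J' iJ' e2i.
  have yJ' : y \in vertices J' by rewrite vJ' E2 !inE eqxx.
  have wJ' : w \in vertices J' by rewrite vJ' inE wi orbT.
  by have /forall_inP/(_ _ wJ')/implyP/(_ yw) := forall_inP (triangle_clique symG tJ') _ yJ'.
have ni1 : ~~ cotri i e1.
  apply: disjoint_cotri; rewrite -setI_eq0 iE E1; apply/eqP/setP => v; rewrite !inE.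
  have [->|_] := eqVneq v z; first by rewrite [z == x]eq_sym (negPf xz) [z == y]eq_sym (negPf
    yz) andbF.
  have [->|_] := eqVneq v w; last by [].
  have /negPf wx : w != x by apply: contraNneq wJ => ->.
  by rewrite wx [w == y]eq_sym (negPf yw) andbF.
have := cocycle e1 e2 i (ed0 s sm).
rewrite (cf_zero n2i) // (cf_zero ni1) // !addr0 => c0.
exact: (cf_vanish tJ e1J e2J e12 (inS i) c0).
Qed.

Lemma cf_cyc2 a b c x : triangle [set a; b; c] -> x \in TS ->
  cf b c x = cf a b x /\ cf c a x = cf a b x.
Proof.
move=> t xS; have [ab ac bc] := triangle_neq t.
have h1 := cf_cyc t ab ac bc xS; split=> //; rewrite -h1.
by apply: cf_cyc; rewrite // 1?eq_sym // [[set b; c; a]]setUC setUA.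
Qed.

(** One polynomial in u and v accounts for all derivatives of face coefficients along edges of the
    tetrahedron outside the face; derivatives inside a face are left to the triangle parts. *)
Lemma tclosed_tetra eta V t : tclosed eta -> #|V| = 4%N -> clique G V -> tetraP V t ->
  exists w : nat -> k, forall s, size s = m -> forall i J a b,
    i \in edgesin V -> i \notin J -> triangle J -> J \subset edgesin V -> a \in J -> b \in J ->
    cf a b (eta (i :: s)) = cf a b (contrib m.+2 (tetra_u k t) (tetra_v k t) w (i :: s)).
Proof.
move=> ec V4 clV tP; have [es eS ed0] := ec.
pose q a b s := cf a b (eta s).
have inS s : size s = m.+1 -> eta s \in TS by move=> /eS[].
have tri := tetra_tri tP.
have [|||||||||w wP] := @tetra_primitive k n t m q (tetra_uniq tP).
- by move=> a b s s' ss'; rewrite /q (es _ _ ss').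
- by move=> a b s; apply: cf_anti.
- by move=> s sm; apply: cf_cyc2 (inS s sm); apply: tri; rewrite !inE eqxx ?orbT.
- by move=> s sm; apply: cf_cyc2 (inS s sm); apply: tri; rewrite !inE eqxx ?orbT.
- by move=> s sm; apply: cf_cyc2 (inS s sm); apply: tri; rewrite !inE eqxx ?orbT.
- by move=> s sm; apply: cf_cyc2 (inS s sm); apply: tri; rewrite !inE eqxx ?orbT.
- move=> s sm; have [o1 o2 o3] := tetra_opp tP.
  by split; apply: cf_zero (inS s sm).
- by move=> s sm a b c; apply: cocycle; apply: ed0.
- move=> i; rewrite -(tetra_edges tP) mem_edgesin => iV.
  (* An edge not inside [V] has at most one end in [V], and the face opposite to that vertex is
     disjoint from it. *)
  have [x xV dis] : exists2 x, x \in V & [disjoint ends i & V :\ x].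
    have [d|] := boolP [disjoint ends i & V].
      have /card_gt0P[x xV] : (0 < #|V|)%N by rewrite V4.
      by exists x => //; apply: disjointWr d; apply: subsetDl.
    rewrite -setI_eq0 => /set0Pn[x]; rewrite inE => /andP[xi xV]; exists x => //.
    rewrite -setI_eq0; apply: contraT => /set0Pn[y]; rewrite in_setI in_setD1 => /and3P[yi yx yV].
    by rewrite (ends2 xi yi) 1?eq_sym // subUset !sub1set xV yV in iV.
  have V3 : #|V :\ x| = 3%N by have := cardsD1 x V; rewrite V4 xV add1n => -[].
  have [tJ vJ] := edgesin_triangle symG V3 (sub_clique (subsetDl _ _) clV).
  have JV : edgesin (V :\ x) \subset edgesin V.
    by apply/subsetP => c; rewrite !mem_edgesin => /subset_trans; apply; apply: subsetDl.
  have zero a b s : a \in edgesin (V :\ x) -> b \in edgesin (V :\ x) -> size s = m ->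
      q a b (i :: s) = 0.
    by move=> aJ bJ sm; apply: (tclosed_disjoint ec tJ) => //; rewrite vJ.
  have := tetra_all tP tJ JV; rewrite !inE => /or4P[]/eqP JE; rewrite JE in zero.
  + by exists (t12 t, t23 t); rewrite ?inE ?eqxx // => s sm; apply: zero;
      rewrite ?inE ?eqxx ?orbT.
  + by exists (t12 t, t24 t); rewrite ?inE ?eqxx ?orbT // => s sm; apply: zero;
      rewrite ?inE ?eqxx ?orbT.
  + by exists (t13 t, t34 t); rewrite ?inE ?eqxx ?orbT // => s sm; apply: zero;
      rewrite ?inE ?eqxx ?orbT.
  + by exists (t23 t, t34 t); rewrite ?inE ?eqxx ?orbT // => s sm; apply: zero;
      rewrite ?inE ?eqxx ?orbT.
exists w => s sm i J a b iV iJ tJ JV aJ bJ.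
have [oS [O1 O2 O3 O4]] := tetra_form k tP.
set c := contrib _ _ _ _ _.
have cS : eta (i :: s) - c \in TS.
  by rewrite rpredB ?inS /= ?sm // /c /contrib memvZ.
suff [a' [b' [a'J b'J ab' z]]] : exists a' b', [/\ a' \in J, b' \in J,
  a' != b' & cf a' b' (eta (i :: s) - c) = 0].
  by apply/eqP; rewrite -subr_eq0 -cfB; apply/eqP; apply: (cf_vanish tJ a'J b'J ab' cS z).
have [w4 w3 w2 w1] := wP s sm; rewrite (tetra_edges tP) in iV.
have JT := tetra_all tP tJ JV.
have in_rest (A B C : 'I_n) r : perm_eq (tetra_seq t) [:: A, B, C & r] ->
    i \in tetra_seq t -> i \notin [set A; B; C] -> i \in r.
  move=> p; rewrite (perm_mem p) !inE.
  by case: (i == A); case: (i == B); case: (i == C).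
move: JT; rewrite /tetra_triangles 3!in_cons mem_seq1 => /or4P[]/eqP JE; subst J;
  have [xy xz yz] := triangle_neq tJ.
- exists (t12 t), (t23 t); split; rewrite ?inE ?eqxx ?orbT //.
  rewrite cfB -/(q _ _ _) w4 /c /contrib ?cfZ ?O1 ?mulrN1 ?subrr //.
  by apply: (in_rest (t12 t) (t23 t) (t13 t) _ _ iV iJ); apply/permP => P /=; do 6!case: (P _).
- exists (t12 t), (t24 t); split; rewrite ?inE ?eqxx ?orbT //.
  rewrite cfB -/(q _ _ _) w3 /c /contrib ?cfZ ?O2 ?mulr1 ?subrr //.
  by apply: (in_rest (t12 t) (t24 t) (t14 t) _ _ iV iJ); apply/permP => P /=; do 6!case: (P _).
- exists (t13 t), (t34 t); split; rewrite ?inE ?eqxx ?orbT //.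
  rewrite cfB -/(q _ _ _) w2 /c /contrib ?cfZ ?O3 ?mulrN1 ?subrr //.
  by apply: (in_rest (t13 t) (t34 t) (t14 t) _ _ iV iJ); apply/permP => P /=; do 6!case: (P _).
- exists (t23 t), (t34 t); split; rewrite ?inE ?eqxx ?orbT //.
  rewrite cfB -/(q _ _ _) w1 /c /contrib ?cfZ ?O4 ?mulr1 ?subrr //.
  by apply: (in_rest (t23 t) (t34 t) (t24 t) _ _ iV iJ); apply/permP => P /=; do 6!case: (P _).
Qed.

End Parametrization.

Lemma prodl_nseq (k : fieldType) n (u v : 'I_n -> k) a b j r :
  u a = 1 -> v a = 0 -> u b = 0 -> v b = 1 -> prodl u v (nseq j b ++ nseq r a) = 'X^j.
Proof.
move=> ua va ub vb; rewrite /prodl big_cat !big_nseq ub vb ua va /=.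
rewrite scale1r scale0r !addr0 add0r.
have it p (q : {poly k}) : iter p ( *%R q) 1 = q ^+ p.
  by elim: p => //= p ->; rewrite exprS.
by rewrite !it expr1n mulr1.
Qed.

Lemma pairingXn (k : fieldType) N (w : nat -> k) j : (j < N)%N -> pairing N w 'X^j = w j.
Proof.
move=> jN; rewrite /pairing (bigD1 (Ordinal jN)) //= coefXn eqxx mulr1 big1 ?addr0 // => j' jj'.
by rewrite coefXn (_ : (_ == _) = false) ?mulr0 //; apply/negbTE.
Qed.

(** * Decomposition of closed forms into triangle and tetrahedron parts *)

Section Components.
Variables (k : fieldType) (l : nat) (G : rel 'I_l).
Hypothesis symG : symmetric G.
Notation n := #|edges G|.
Notation E := (extalg k n).
Notation ends := (ends (G := G)).
Notation triangle := (triangle (G := G)).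
Notation edgesin := (edgesin G).
Notation TS := (triangle_span G k).
Implicit Types (a b i : 'I_n) (s : seq 'I_n).
Variable m : nat.

Definition clique_of (r : nat) : finType := {V : {set 'I_l} | (#|V| == r) && clique G V}.
Notation comp := (clique_of 3 + clique_of 4)%type.

Lemma clique_ofP r (V : clique_of r) : #|val V| = r /\ clique G (val V).
Proof. by have /andP[/eqP] := valP V. Qed.

Variables (tri : clique_of 3 -> 'I_n * 'I_n * 'I_n) (tet : clique_of 4 -> tetra n).
Hypothesis triP : forall t, edgesin (val t) = [set (tri t).1.1; (tri t).1.2; (tri t).2].
Hypothesis tetP : forall x, tetraP (val x) (tet x).

Definition comp_set (c : comp) : {set 'I_l} :=
  match c with inl t => val t | inr x => val x end.
Definition comp_u (c : comp) : 'I_n -> k :=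
  match c with inl t => ediff k (tri t).1.1 (tri t).2 | inr x => tetra_u k (tet x) end.
Definition comp_v (c : comp) : 'I_n -> k :=
  match c with inl t => ediff k (tri t).1.2 (tri t).2 | inr x => tetra_v k (tet x) end.
Definition comp_form c := lin (comp_u c) * lin (comp_v c).

Definition form_of (w : {ffun comp * 'I_m.+2 -> k^o}) s : E :=
  \sum_c contrib m.+2 (comp_u c) (comp_v c) (fun j => w (c, inord j)) s.

Lemma comp_out c i : ~~ (ends i \subset comp_set c) -> comp_u c i = 0 /\ comp_v c i = 0.
Proof.
rewrite -mem_edgesin; case: c => [t|x] /=.
  rewrite triP !inE !negb_or /ediff => /andP[/andP[/negPf-> /negPf->] /negPf->].
  by rewrite subrr.
by rewrite (tetra_edges (tetP x)); apply: tetra_coef_out.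
Qed.

Lemma comp_form_out c a b : cf a b (comp_form c) != 0 ->
  (ends a \subset comp_set c) /\ (ends b \subset comp_set c).
Proof.
rewrite cf_lin => nz; split; apply: contraNT nz => /comp_out[-> ->];
  by rewrite !(mul0r, mulr0) subr0.
Qed.

Lemma pairing_out c N (w : nat -> k) i s :
  pairing N w (prodl (comp_u c) (comp_v c) (i :: s)) != 0 -> ends i \subset comp_set c.
Proof.
by rewrite pairing_cons; apply: contraNT => /comp_out[-> ->]; rewrite !mul0r addr0.
Qed.

Lemma comp_form_span c : comp_form c \in TS.
Proof.
case: c => [t|x]; last by have [] := tetra_form k (tetP x).
have [V3 clV] := clique_ofP t; have [tJ _] := edgesin_triangle symG V3 clV.
exact: tri_form_span tJ (triP t).
Qed.

Lemma form_of_linear (a : k) w w' s : form_of (a *: w + w') s = a *: form_of w s + form_of w' s.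
Proof.
rewrite /form_of scaler_sumr -big_split; apply: eq_bigr => c _ /=.
rewrite /contrib scalerA -scalerDl; congr (_ *: _).
rewrite /pairing mulr_sumr -big_split; apply: eq_bigr => j _ /=.
by rewrite !ffunE /GRing.scale /=; ring.
Qed.

Lemma form_of_closed w : tclosed m (form_of w).
Proof.
split=> [s s' ss'|s _|s _].
- by apply: eq_bigr => c _; apply: contrib_sym ss'.
- split; first by apply: memv_suml => c _; apply: memvZ; apply: comp_form_span.
  by apply: homog_sum => c _; apply: homogZ; apply: homog_linM.
rewrite /ed; under eq_bigr do rewrite mulr_suml.
by rewrite exchange_big big1 // => c _; apply: contrib_closed.
Qed.

Lemma tri_coef (t : clique_of 3) (a := (tri t).1.1) (b := (tri t).1.2) (c := (tri t).2) :
  [/\ triangle [set a; b; c], comp_u (inl t) a = 1, comp_v (inl t) a = 0,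
      comp_u (inl t) b = 0 & comp_v (inl t) b = 1] /\ val t = ends a :|: ends b.
Proof.
have [V3 clV] := clique_ofP t; have [tJ vJ] := edgesin_triangle symG V3 clV.
rewrite triP in tJ; have [ab ac bc] := triangle_neq tJ.
rewrite /a /b /c; split.
  rewrite /= /ediff !eqxx (negPf ab) (negPf ac) (negPf bc) [_ == (tri t).1.1]eq_sym (negPf ab).
  by rewrite /= !subr0; split.
have aJ : (tri t).1.1 \in edgesin (val t) by rewrite triP !inE eqxx.
have bJ : (tri t).1.2 \in edgesin (val t) by rewrite triP !inE eqxx orbT.
by rewrite -{1}vJ; apply: triangle_vertices => //; rewrite triP.
Qed.

(** Two edges of a triangle cover its vertices, so no other triangle form has a coefficient at this
    pair. *)
Lemma cf_comp_tri (t t' : clique_of 3) :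
  cf (tri t).1.1 (tri t).1.2 (comp_form (inl t')) = (t == t')%:R.
Proof.
have [[_ ua va ub vb] vt] := tri_coef t; have [<-|tt'] := eqVneq t t'.
  by rewrite /comp_form cf_lin ua va ub vb mul1r mul0r subr0.
apply/eqP; apply: contraNT tt' => /comp_form_out[/= aV bV]; apply/eqP/val_inj.
have [V3 _] := clique_ofP t; have [V3' _] := clique_ofP t'.
by apply/eqP; rewrite eqEcard vt subUset aV bV /= -vt V3 V3'.
Qed.

(** Tetrahedra are eliminated before triangles. The coefficient at two edges of a face,
    differentiated along an edge to the fourth vertex, only involves components containing all four
    vertices, hence only that tetrahedron. *)
Lemma form_of_inj w : (forall s, size s = m.+1 -> form_of w s = 0) -> w = 0.
Proof.
move=> w0.
have wX x j : w (inr x, j) = 0.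
  have [V4 _] := clique_ofP x; have := tetP x; move tE: (tet x) => t tP.
  have [[U12 U34 U13 U24] [[V12 V34 V13 V24] [U14 U23 V14 V23]]] := tetra_coef k (tetra_uniq tP).
  have key i s : size s = m ->
      (val x \subset ends (t12 t) :|: ends (t23 t) :|: ends i) ->
      pairing m.+2 (fun j => w (inr x, inord j))
        (prodl (tetra_u k t) (tetra_v k t) (i :: s)) = 0.
    move=> sm xi; have := congr1 (cf (t12 t) (t23 t)) (w0 (i :: s) _).
    rewrite cf0 cf_sum (bigD1 (inr x)) //= big1 ?addr0 => [|c cx].
      rewrite cfZ -/(comp_form (inr x)) => /(_ (congr1 _ sm)) /eqP.
      by rewrite mulf_eq0 /comp_form cf_lin /= tE U12 V12 U23 V23 mul1r mulr0 subr0 oppr_eq0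
        oner_eq0 orbF => /eqP.
    rewrite cfZ -/(comp_form c); apply/eqP; apply: contraNT cx.
    rewrite mulf_eq0 negb_or => /andP[/pairing_out ic /comp_form_out[c12 c23]].
    have xc : val x \subset comp_set c.
      by apply: subset_trans xi _; rewrite subUset ic andbT subUset c12 c23.
    case: c {ic c12 c23} xc => [t'|x'] /= xc.
      by have := subset_leq_card xc; have [-> _] := clique_ofP t'; rewrite V4.
    have -> // : x' = x; apply/val_inj/esym/eqP.
    by rewrite eqEcard xc /=; have [-> _] := clique_ofP x'; rewrite V4.
  (* The edge [t34] gives the derivative in u, which sees every coefficient but the last; [t24]
     gives the derivative in v, which sees the last. *)
  have [jm|mj] := ltnP j m.+1.
    have := key (t34 t) (nseq j (t13 t) ++ nseq (m - j) (t12 t)) _ (tetra_span34 tP).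
    rewrite size_cat !size_nseq subnKC // => /(_ erefl).
    by rewrite pairing_cons U34 V34 mul1r mul0r addr0 prodl_nseq // pairingXn ?inord_val //.
  have jE : j = inord m.+1 by apply: val_inj; rewrite /= inordK //; have := ltn_ord j; lia.
  have := key (t24 t) (nseq m (t13 t) ++ nseq 0 (t12 t)) _ (tetra_span24 tP).
  rewrite size_cat !size_nseq addn0 => /(_ erefl).
  by rewrite pairing_cons U24 V24 mul1r mul0r add0r prodl_nseq // -exprS pairingXn // -jE.
apply/ffunP => -[[t|x] j]; rewrite [RHS]ffunE; last exact: wX.
have [[_ ua va ub vb] _] := tri_coef t.
have sz : size (nseq j (tri t).1.2 ++ nseq (m.+1 - j) (tri t).1.1) = m.+1.
  by rewrite size_cat !size_nseq subnKC // -ltnS.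
have := congr1 (cf (tri t).1.1 (tri t).1.2) (w0 _ sz).
rewrite cf0 cf_sum (bigD1 (inl t)) //= big1 ?addr0 => [|[t'|x] tt'].
- rewrite cfZ -/(comp_form (inl t)) cf_comp_tri eqxx mulr1.
  by rewrite -/(comp_u (inl t)) -/(comp_v (inl t)) prodl_nseq // pairingXn // inord_val.
- rewrite cfZ -/(comp_form (inl t')) cf_comp_tri (_ : t == t' = false) ?mulr0 //.
  by apply/negbTE; apply: contraNneq tt' => ->.
by rewrite cfZ /pairing big1 ?mul0r // => i _; rewrite wX mul0r.
Qed.

(** Once the tetrahedron parts are subtracted, each triangle coefficient has zero derivative along
    edges outside its triangle. [pairing_rec] then makes it a polynomial in the two linear forms of
    the triangle. *)
Lemma form_of_surj eta : tclosed m eta ->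
  exists w, forall s, size s = m.+1 -> eta s = form_of w s.
Proof.
move=> ec; have [es eS ed0] := ec.
have [wX wXP] : exists wX : clique_of 4 -> nat -> k, forall (x : clique_of 4) s,
  size s = m -> forall i (J : {set 'I_n}) a b,
    i \in edgesin (val x) -> i \notin J -> triangle J -> J \subset edgesin (val x) ->
    a \in J -> b \in J -> cf a b (eta (i :: s)) =
      cf a b (contrib m.+2 (comp_u (inr x)) (comp_v (inr x)) (wX x) (i :: s)).
  have /fin_all_exists[wX wXP] := fun x : clique_of 4 =>
    tclosed_tetra symG ec (clique_ofP x).1 (clique_ofP x).2 (tetP x).
  by exists wX.
pose cX x := contrib m.+2 (comp_u (inr x)) (comp_v (inr x)) (wX x).
pose eta' s := eta s - \sum_x cX x s.
have eta's : symf eta'.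
  by move=> s s' ss'; rewrite /eta' (es _ _ ss'); congr (_ - _); apply: eq_bigr => x _;
    apply: contrib_sym ss'.
have eta'S s : size s = m.+1 -> eta' s \in TS.
  move=> sm; rewrite rpredB ?(eS s sm).1 // memv_suml // => x _; apply: memvZ.
  exact: comp_form_span (inr x).
have eta'0 s : size s = m -> ed eta' s = 0.
  move=> sm; rewrite edB ed0 // sub0r; apply/eqP; rewrite oppr_eq0; apply/eqP.
  rewrite /ed; under eq_bigr do rewrite mulr_suml.
  by rewrite exchange_big big1 // => x _; apply: contrib_closed.
(* At most one K_4 contains both [t] and [i], as together they span it. Its part cancels the
   derivative and the other parts contribute nothing; if there is no such K_4, [tclosed_out]
   applies. *)
have eta'_out t i s : size s = m -> i \notin edgesin (val t) ->
    cf (tri t).1.1 (tri t).1.2 (eta' (i :: s)) = 0.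
  move=> sm it; set a := (tri t).1.1; set b := (tri t).1.2.
  have [V3 clV] := clique_ofP t; have [tJ vJ] := edgesin_triangle symG V3 clV.
  have aJ : a \in edgesin (val t) by rewrite triP !inE eqxx.
  have bJ : b \in edgesin (val t) by rewrite triP !inE eqxx orbT.
  have [_ vt] := tri_coef t.
  have it' : ~~ (ends i \subset val t) by rewrite -mem_edgesin.
  have big (x : clique_of 4) : val t \subset val x -> ends i \subset val x -> (val t :|: ends i)
    = val x.
    move=> tx ix; have [V4 _] := clique_ofP x; apply/eqP.
    rewrite eqEcard subUset tx ix /= V4.
    have /proper_card : val t \proper val t :|: ends i by rewrite properE subsetUl subUset subxx.
    by rewrite V3.
  have zero (x : clique_of 4) : ~~ ((val t \subset val x) && (ends i \subset val x)) -> cf a b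
    (cX x (i :: s)) = 0.
    rewrite /cX /contrib cfZ -/(comp_form (inr x)); apply: contraNeq; rewrite mulf_eq0 negb_or.
    by case/andP=> /pairing_out -> /comp_form_out[ax bx]; rewrite vt subUset ax bx.
  rewrite /eta' cfB cf_sum.
  have [/existsP[x /andP[tx ix]]|] := boolP [exists x : clique_of 4,
    (val t \subset val x) && (ends i \subset val x)].
    rewrite (bigD1 x) //= big1 ?addr0 => [|x' xx'].
      apply/eqP; rewrite subr_eq0; apply/eqP; apply: (wXP x s sm i (edgesin (val t))) => //.
        by rewrite mem_edgesin.
      by apply/subsetP => c; rewrite !mem_edgesin => /subset_trans; apply.
    apply: zero; apply: contraNN xx' => /andP[tx' ix']; apply/eqP/val_inj.
    by rewrite -(big x) // -(big x').
  rewrite negb_exists => /forallP noX; rewrite big1 => [|x _]; last exact: zero.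
  rewrite subr0; apply: (tclosed_out symG ec tJ) => // V V4 clV'; rewrite vJ => tV.
  have PV : (#|V| == 4%N) && clique G V by rewrite V4 eqxx.
  by have := noX (Sub V PV); rewrite SubK tV.
have [wT wTP] : exists wT : clique_of 3 -> nat -> k, forall t s, size s = m.+1 ->
    cf (tri t).1.1 (tri t).1.2 (eta' s) =
    pairing m.+2 (wT t) (prodl (comp_u (inl t)) (comp_v (inl t)) s).
  apply: (@fin_all_exists _ _ (fun (t : clique_of 3) w => forall s, size s = m.+1 ->
    cf (tri t).1.1 (tri t).1.2 (eta' s) =
    pairing m.+2 w (prodl (comp_u (inl t)) (comp_v (inl t)) s))) => t.
  have [[tJ ua va ub vb] _] := tri_coef t.
  set a := (tri t).1.1; set b := (tri t).1.2; set c := (tri t).2.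
  have fs : symf (fun s => cf a b (eta' s)) by move=> s s' ss'; rewrite (eta's _ _ ss').
  eexists => s sm; apply: (pairing_rec fs ua va ub vb) sm => i s' [s'm].
  have inS j : eta' (j :: s') \in TS by rewrite eta'S //= s'm.
  have [it|it] := boolP (i \in edgesin (val t)); last first.
    by have [-> ->] := comp_out (c := inl t) (i := i) ltac:(by rewrite -mem_edgesin);
      rewrite !mul0r addr0 eta'_out.
  move: it; rewrite triP !inE -orbA => /or3P[]/eqP->.
  - by rewrite ua va mul1r mul0r addr0.
  - by rewrite ub vb mul1r mul0r add0r.
  (* Along the third edge both linear forms take the value -1, and the cocycle relation says that
     the three derivatives add up to 0. *)
  have := cocycle a b c (eta'0 s' s'm).
  have [-> _] := cf_cyc2 tJ (inS a); have [_ ->] := cf_cyc2 tJ (inS b).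
  have [ab ac bc] := triangle_neq tJ.
  rewrite /= /ediff eqxx [_ == a]eq_sym (negPf ac) [_ == b]eq_sym (negPf bc) /= sub0r => h.
  apply/eqP; rewrite -subr_eq0 -h; apply/eqP; ring.
pose w : {ffun comp * 'I_m.+2 -> k^o} :=
  [ffun p : comp * 'I_m.+2 => match p.1 with inl t => wT t p.2 | inr x => wX x p.2 end : k^o].
exists w => s sm.
have FE : form_of w s = \sum_t pairing m.+2 (wT t) (prodl (comp_u (inl t)) (comp_v (inl t)) s)
  *: comp_form (inl t)
    + \sum_x cX x s.
  rewrite /form_of big_sumType /=; congr (_ + _); apply: eq_bigr => c _; rewrite /cX /contrib /=;
    congr (_ *: _); apply: eq_bigr => j _; by rewrite /w ffunE /= inordK.
apply/eqP; rewrite -subr_eq0; apply/eqP; have [_ wS _] := form_of_closed w.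
have [fS fh] := wS s sm; have [eSs eh] := eS s sm.
apply: span_ext; [exact: homogB | exact: rpredB |] => J tJ.
have PV : (#|vertices J| == 3%N) && clique G (vertices J).
  by rewrite (triangle_clique symG tJ); have /andP[_ ->] := tJ.
pose t : clique_of 3 := Sub (vertices J) PV.
have JE : J = [set (tri t).1.1; (tri t).1.2; (tri t).2] by rewrite -triP SubK -triangleE.
have [ab _ _] : [/\ (tri t).1.1 != (tri t).1.2,
  (tri t).1.1 != (tri t).2 & (tri t).1.2 != (tri t).2].
  by apply: triangle_neq; rewrite -JE.
exists (tri t).1.1, (tri t).1.2; rewrite JE !inE !eqxx orbT; split=> //.
rewrite FE opprD addrA addrAC -[eta s - _]/(eta' s) cfB wTP // cf_sum (bigD1 t) //=.
rewrite cfZ cf_comp_tri eqxx mulr1 big1 ?addr0 ?subrr // => t' tt'.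
by rewrite cfZ cf_comp_tri eq_sym (negPf tt') mulr0.
Qed.

End Components.

Lemma clique_data (l : nat) (G : rel 'I_l) (symG : symmetric G) :
  (exists tri : clique_of G 3 -> 'I_#|edges G| * 'I_#|edges G| * 'I_#|edges G|,
    forall t, edgesin G (val t) = [set (tri t).1.1; (tri t).1.2; (tri t).2]) /\
  (exists tet : clique_of G 4 -> tetra #|edges G|, forall x, tetraP (val x) (tet x)).
Proof.
split.
  apply: (@fin_all_exists _ _ (fun (V : clique_of G 3) (t : 'I_#|edges G| * 'I_#|edges G| *
    'I_#|edges G|) =>
    edgesin G (val V) = [set t.1.1; t.1.2; t.2])) => V; have [rV clV] := clique_ofP V.
  have [tJ _] := edgesin_triangle symG rV clV.
  have /card_gt1P[a [b [aJ bJ ab]]] : (1 < #|edgesin G (val V)|)%N by have /andP[/eqP->] := tJ.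
  by have [c [JE _ _]] := triangle_set3 tJ aJ bJ ab; exists (a, b, c).
apply: (@fin_all_exists _ _ (fun (V : clique_of G 4) t => tetraP (val V) t)) => V.
have [rV clV] := clique_ofP V; exact: tetra_exists.
Qed.

Theorem lemma6p9 (k : fieldType) (hk : [pchar k] =i pred0) (R : realType)
    (l : nat) (G : rel 'I_l) (symG : symmetric G) (irrG : irreflexive G)
    (F : grfree k #|edges G|) (eps : 'rV[extalg k #|edges G|]_(rk F 0))
    (resF : resolution (os_ideal k (graphic (G := G) R[i])) eps)
    (i : nat) (hi : (2 <= i)%N) :
  tor_dim F i i.+1%:Z = (i * (kappa G 2 + kappa G 3))%N.
Proof.
case: i hi => [|[|m]] // _.
have [[tri triP] [tet tetP]] := clique_data symG.
have clE eta : tclosed m eta <-> closed_form (os_ideal k (graphic (G := G) R[i])) m.+1 eta.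
  split=> -[es eI ed0]; split=> // s sm.
  - by have [|eS e2] := eI s; [case: sm | rewrite os_deg2].
  - by apply: ed0; case: sm.
  - by have [|eS e2] := eI s; [rewrite sm | rewrite -(os_deg2 R[i])].
  - by apply: ed0; rewrite sm.
(* Here [i] is [m.+2]: each clique on 3 or 4 vertices contributes the [i] coefficients of a
   polynomial of degree [i - 1] in two variables. *)
transitivity (dim {ffun (clique_of G 3 + clique_of G 4) * 'I_m.+2 -> k^o}).
  apply: (tor_linear_strand resF _ _ (m := m.+1) (Phi := form_of tri tet)).
  - by move=> d x; apply: os_gr.
  - by move=> d x d1 xO xd; apply: os_low xO xd.
  - by move=> a w w' s; apply: form_of_linear.
  - by move=> w; apply/clE; apply: form_of_closed.
  - by move=> eta /clE; apply: form_of_surj.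
  - exact: form_of_inj.
rewrite /dim /= card_prod card_sum card_ord muln1 mulnC !kappaE //.
rewrite !card_sig; congr (_ * (_ + _))%N; apply: eq_card => V; by rewrite !inE.
Qed.
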